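(* Let $E \subset \mathbb{T}$ be a closed subset of the unit circle of (arc-length) measure $0$. Then the set $\mathcal{U}_E$ of functions with universal optimal polynomial approximants on $E$ is a dense $G_\delta$ subset of the Hardy space $H^2$.
   Context: $H^2$ is the Hardy space of holomorphic functions $f(z)=\sum_{k\ge0}a_kz^k$ on the unit disc $\mathbb{D}$ with $\|f\|_{H^2}^2=\sum_{k\ge 0}|a_k|^2<\infty$; $(H^2)^*=H^2\setminus\{0\}$. For $f\in (H^2)^*$ and $n\in\mathbb{N}$, the optimal polynomial approximant (o.p.a.) $Q_n(1/f)$ is the unique polynomial $Q$ of degree at most $n$ minimizing $\|qf-1\|_{H^2}$ over all polynomials $q$ of degree at most $n$. For a closed set $E\subset\mathbb{T}$, $C(E)$ denotes the space of continuous complex functions on $E$ with the topology of uniform convergence. $\mathcal{U}_E$ is the set of $f\in (H^2)^*$ such that for every $g\in C(E)$ there is a subsequence $(m_s)$ with $Q_{m_s}(1/f)\to g$ uniformly on $E$. *)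

(* Defs.v *)
From HB Require Import structures.
From mathcomp Require Import all_boot all_order all_algebra.
From mathcomp Require Import all_classical all_reals all_analysis.
From mathcomp Require Import complex.

Set Implicit Arguments.
Unset Strict Implicit.
Unset Printing Implicit Defensive.

Import Order.TTheory GRing.Theory Num.Theory.
Import numFieldNormedType.Exports.
Local Open Scope classical_set_scope.
Local Open Scope ring_scope.

Section H2defs.
Variable R : realType.
Local Notation C := R[i].

Definition cabs (z : C) : R := ComplexField.Normc.normc z.
Definition cdist (z w : C) : R := cabs (z - w).

Definition unit_circle : set C := [set z | cabs z = 1].

Definition expi (t : R) : C := (cos t +i* sin t)%C.

Definition arc_null (E : set C) : Prop :=
  (@lebesgue_measure R) [set t : R | 0 <= t < 2 * pi /\ E (expi t)] = 0%E.

Definition closed_in_C (E : set C) : Prop :=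
  forall z : C, (forall e : R, 0 < e -> exists w, E w /\ cdist w z < e) -> E z.

Definition cont_on (E : set C) (g : C -> C) : Prop :=
  forall z, E z -> forall e : R, 0 < e ->
    exists2 d : R, 0 < d & forall w, E w -> cdist w z < d -> cdist (g w) (g z) < e.

(* H^2: holomorphic functions on D identified with their Taylor coefficient
   sequences (a_k), with sum |a_k|^2 < oo *)
Definition sqmod (z : C) : R := cabs z ^+ 2.
Definition H2 (a : nat -> C) : Prop := cvgn (series (fun k => sqmod (a k))).
Definition h2norm (a : nat -> C) : R :=
  Num.sqrt (limn (series (fun k => sqmod (a k)))).
Definition h2sub (a b : nat -> C) : nat -> C := fun k => a k - b k.
Definition h2zero : nat -> C := fun _ => 0.

(* Taylor coefficients of q f - 1, for a polynomial q *)
Definition polymul_coef (q : {poly C}) (a : nat -> C) (k : nat) : C :=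
  \sum_(i < k.+1) q`_i * a (k - i)%N.
Definition opa_residual (q : {poly C}) (a : nat -> C) : nat -> C :=
  fun k => polymul_coef q a k - (k == 0%N)%:R.

(* q is the optimal polynomial approximant Q_n(1/f) of degree <= n:
   it minimizes || q f - 1 ||_{H^2} over polynomials of degree <= n
   (the minimizer is unique when f <> 0) *)
Definition is_opa (a : nat -> C) (n : nat) (q : {poly C}) : Prop :=
  (size q <= n.+1)%N /\
  forall q' : {poly C}, (size q' <= n.+1)%N ->
    h2norm (opa_residual q a) <= h2norm (opa_residual q' a).

Definition universal_opa (E : set C) (a : nat -> C) : Prop :=
  H2 a /\ a <> h2zero /\
  forall g : C -> C, cont_on E g ->
    exists (m : nat -> nat) (Q : nat -> {poly C}),
      (forall s, (m s < m s.+1)%N) /\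
      (forall s, is_opa a (m s) (Q s)) /\
      (forall e : R, 0 < e -> exists N : nat, forall s, (N <= s)%N ->
          forall z, E z -> cdist (Q s).[z] (g z) < e).

Definition h2_open (O : set (nat -> C)) : Prop :=
  forall a, H2 a -> O a -> exists2 e : R, 0 < e &
    forall b, H2 b -> h2norm (h2sub b a) < e -> O b.

Definition h2_dense (U : set (nat -> C)) : Prop :=
  U `<=` H2 /\
  forall a, H2 a -> forall e : R, 0 < e -> exists2 b, U b & h2norm (h2sub b a) < e.

Definition h2_Gdelta (U : set (nat -> C)) : Prop :=
  U `<=` H2 /\
  exists O : nat -> set (nat -> C), (forall n, h2_open (O n)) /\
    (forall a, H2 a -> (U a <-> forall n, O n a)).

End H2defs.

(* Main.v *)
(** For [f = P / (P^* q)], where [P] has its zeros in the open disc and [P^*] is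
    the reflected polynomial, the isometry [|P y| = |P^* y|] shows that the
    optimal approximants of [1/f] of degree at least [deg q] are all equal to
    [conj (P(0)) q].  Hence universality follows from the Baire category theorem
    once polynomials [q], invertible in H^2, can be found with [1/q] close to a
    given zero-free function in H^2 and [q] close to a given [g] on [E].

    Since [E] has measure zero, a product of factors
    [(1 - r c z) / (1 - s c z)], [s < r < 1], attached to a thin cover of [E]
    gives a polynomial [w] with [w(0) = 1], multiplier norm close to 1 and [w]
    close to 0 on [E].  Then [q = 1 + p (1 - w)] is close to [1 + p] on [E],
    while [1/q] is close to 1 in H^2.  The functions on [E] approximable in this
    way are closed under products and limits, hence contain every continuous
    function near 1, hence are stable along homotopies of nonvanishing
    functions.  As [E] misses a point of the circle, all [z - a] are reached,
    then all polynomials, and these are dense in [C(E)].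

    Multiplication by a polynomial is lower triangular on coefficients, so the
    estimates are proved for the norms of truncations and pass to H^2. *)

Require Import Defs.
From HB Require Import structures.
From mathcomp Require Import all_boot all_order all_algebra.
From mathcomp Require Import all_classical all_reals all_analysis.
From mathcomp Require Import complex.
From mathcomp Require Import ring lra.
Import Order.TTheory GRing.Theory Num.Theory.
Import numFieldNormedType.Exports.
Local Open Scope classical_set_scope.
Local Open Scope ring_scope.

Set Implicit Arguments.
Unset Strict Implicit.
Unset Printing Implicit Defensive.

(** * Moduli, power series and truncated norms *)

Section ComplexModulus.
Variable R : realType.
Local Notation C := R[i].
Local Notation Re := complex.Re.
Local Notation Im := complex.Im.
Implicit Types z w : C.

(** Up to a small perturbation, a function of $H^2$ is a product $P B$ of polynomials, with the
    zeros of $P$ in the open disc and those of $B$ outside the closed disc. Take $f = P / (P^* q_0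
    q_1)$ with $q_0$ close to $1 / (P^* B)$ in the Wiener algebra. Then $f$ is close to $P B$ as
    soon as $1/q_1$ is close to $1$ in $H^2$, and all that remains to ask of $q_1$ is to be close to
    $g / (\overline{P(0)} q_0)$ on $E$. This is why it is enough to perturb the constant $1$,
    whatever the function to be approximated.

    The obstacle is that $q_1$ must stay invertible while its values on $E$ are prescribed, possibly
    with zeros. This condition is not linear, so an approximation theorem for sums does not give it;
    it is however stable under products. Hence the detour: functions near $1$ come from products of
    small perturbations, and a nonvanishing function is reached along a path cut into steps whose
    successive quotients are near $1$. On the whole circle the winding number of $z$ would block
    such a path; on a closed set that misses a point it does not. *)

Lemma cabs_ge0 z : 0 <= cabs z.
Proof. by case: z => a b; rewrite /cabs /= sqrtr_ge0. Qed.

Lemma cabsM z w : cabs (z * w) = cabs z * cabs w.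
Proof. exact: ComplexField.Normc.normcM. Qed.

Lemma cabsD z w : cabs (z + w) <= cabs z + cabs w.
Proof. exact: le_normcD. Qed.

Lemma cabsN z : cabs (- z) = cabs z.
Proof. exact: normcN. Qed.

Lemma cabsB z w : cabs (z - w) <= cabs z + cabs w.
Proof. by rewrite -(cabsN w); exact: cabsD. Qed.

Lemma cabs_distC z w : cabs (z - w) = cabs (w - z).
Proof. by rewrite -opprB cabsN. Qed.

Lemma cabs0 : cabs (0 : C) = 0.
Proof. exact: ComplexField.Normc.normc0. Qed.

Lemma cabs1 : cabs (1 : C) = 1.
Proof. exact: ComplexField.Normc.normc1. Qed.

Lemma cabs_eq0 z : (cabs z == 0) = (z == 0).
Proof.
apply/eqP/eqP => [|->]; [exact: ComplexField.Normc.eq0_normc|exact: cabs0].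
Qed.

Lemma cabs_gt0 z : (0 < cabs z) = (z != 0).
Proof. by rewrite lt_def cabs_eq0 cabs_ge0 andbT. Qed.

Lemma cabsV z : cabs z^-1 = (cabs z)^-1.
Proof. exact: ComplexField.Normc.normcV. Qed.

Lemma cabsX z n : cabs (z ^+ n) = cabs z ^+ n.
Proof. by elim: n => [|n IH]; rewrite ?expr0 ?cabs1 // !exprS cabsM IH. Qed.

Lemma sqmodE z : sqmod z = Re z ^+ 2 + Im z ^+ 2.
Proof.
by case: z => a b; rewrite /sqmod /cabs /= sqr_sqrtr // addr_ge0 // sqr_ge0.
Qed.

Lemma cabs_real (x : R) : cabs (x%:C)%C = `|x|.
Proof. by rewrite /cabs /= expr0n addr0 sqrtr_sqr. Qed.

Lemma cabs_conj z : cabs (z^*)%C = cabs z.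
Proof. by case: z => a b; rewrite /cabs /= sqrrN. Qed.

Lemma mul_conjC z : z * (z^*)%C = ((sqmod z)%:C)%C.
Proof.
rewrite sqmodE; case: z => a b /=; apply/eqP; rewrite eq_complex /=.
by apply/andP; split; apply/eqP; ring.
Qed.

Lemma cabs_ge_dist z w : cabs z - cabs w <= cabs (z - w).
Proof. by rewrite lerBlDr (le_trans _ (cabsD _ _)) // subrK. Qed.

Lemma cabs_Re z : `|Re z| <= cabs z.
Proof.
rewrite -(ler_pXn2r (ltn0Sn 1)) ?nnegrE ?cabs_ge0 //.
by rewrite real_normK ?num_real // -[leRHS]/(sqmod z) sqmodE lerDl sqr_ge0.
Qed.

Lemma cabs_Im z : `|Im z| <= cabs z.
Proof.
rewrite -(ler_pXn2r (ltn0Sn 1)) ?nnegrE ?cabs_ge0 //.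
by rewrite real_normK ?num_real // -[leRHS]/(sqmod z) sqmodE lerDr sqr_ge0.
Qed.

Lemma cabs_ReIm z : cabs z <= `|Re z| + `|Im z|.
Proof.
rewrite -(ler_pXn2r (ltn0Sn 1)) ?nnegrE ?cabs_ge0 ?addr_ge0 //.
rewrite -[leLHS]/(sqmod z) sqmodE sqrrD !real_normK ?num_real //.
by rewrite -addrA lerD2l lerDr mulrn_wge0 // mulr_ge0.
Qed.

Lemma cabs_sum I (r : seq I) (F : I -> C) :
  cabs (\sum_(i <- r) F i) <= \sum_(i <- r) cabs (F i).
Proof.
elim: r => [|i r IH]; first by rewrite !big_nil cabs0.
by rewrite !big_cons (le_trans (cabsD _ _)) // lerD2l.
Qed.

Lemma cabs_prod I (r : seq I) (F : I -> C) :
  cabs (\prod_(i <- r) F i) = \prod_(i <- r) cabs (F i).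
Proof. by apply: (big_morph _ cabsM cabs1). Qed.

Definition rdot z w : R := Re z * Re w + Im z * Im w.

Lemma sqmodD z w : sqmod (z + w) = sqmod z + 2 * rdot z w + sqmod w.
Proof. by rewrite !sqmodE /rdot; case: z w => a b [c d] /=; ring. Qed.

Lemma sqmodZ z w : sqmod (z * w) = sqmod z * sqmod w.
Proof. by rewrite /sqmod cabsM exprMn. Qed.

Lemma sqmodN z : sqmod (- z) = sqmod z.
Proof. by rewrite /sqmod cabsN. Qed.

Lemma sqmod_ge0 z : 0 <= sqmod z.
Proof. exact: sqr_ge0. Qed.

Lemma sqmod0 : sqmod (0 : C) = 0.
Proof. by rewrite /sqmod cabs0 expr0n. Qed.

End ComplexModulus.

(** * Coefficient sequences: truncated norms, the action of polynomials, and $H^2$ *)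

Section Sequences.
Variable R : realType.
Local Notation C := R[i].
Implicit Types (a b y : nat -> C) (p q : {poly C}) (n k : nat).

Definition psqnorm n a : R := \sum_(k < n) sqmod (a k).
Definition pnorm n a : R := Num.sqrt (psqnorm n a).

Lemma psqnorm_ge0 n a : 0 <= psqnorm n a.
Proof. by apply: sumr_ge0 => k _; exact: sqmod_ge0. Qed.

Lemma pnorm_ge0 n a : 0 <= pnorm n a.
Proof. exact: sqrtr_ge0. Qed.

Lemma pnorm_sqr n a : pnorm n a ^+ 2 = psqnorm n a.
Proof. by rewrite sqr_sqrtr ?psqnorm_ge0. Qed.

Lemma psqnormS n a : psqnorm n.+1 a = psqnorm n a + sqmod (a n).
Proof. by rewrite /psqnorm big_ord_recr. Qed.

Lemma psqnorm_mono m n a : (m <= n)%N -> psqnorm m a <= psqnorm n a.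
Proof.
move=> /subnK <-; elim: (n - m)%N => [|k IH]; first by rewrite add0n.
by rewrite addSn psqnormS (le_trans IH) // lerDl sqmod_ge0.
Qed.

Lemma pnorm_mono m n a : (m <= n)%N -> pnorm m a <= pnorm n a.
Proof. by move=> mn; rewrite ler_wsqrtr // psqnorm_mono. Qed.

Lemma pnormS n a : pnorm n.+1 a = cabs (pnorm n a +i* cabs (a n))%C.
Proof. by rewrite /pnorm psqnormS /cabs /= sqr_sqrtr // psqnorm_ge0. Qed.

(* Induction on n: [pnormS] reduces the step to the triangle inequality in C. *)
Lemma pnorm_triangle n a b : pnorm n (a + b) <= pnorm n a + pnorm n b.
Proof.
elim: n => [|n IH]; first by rewrite /pnorm /psqnorm !big_ord0 sqrtr0 addr0.
rewrite !pnormS; apply: le_trans (cabsD _ _) => /=.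
rewrite /cabs /= ler_wsqrtr // lerD // ler_pXn2r ?nnegrE ?addr_ge0 ?pnorm_ge0 ?cabs_ge0 //.
exact: cabsD.
Qed.

Lemma pnorm_scale n (c : C) a : pnorm n (c *: a) = cabs c * pnorm n a.
Proof.
rewrite /pnorm /psqnorm -[cabs c]ger0_norm ?cabs_ge0 // -sqrtr_sqr.
rewrite -sqrtrM ?sqr_ge0 // mulr_sumr; congr (Num.sqrt _).
by apply: eq_bigr => k _; rewrite sqmodZ.
Qed.

Lemma pnorm_opp n a : pnorm n (- a) = pnorm n a.
Proof.
by congr (Num.sqrt _); apply: eq_bigr => k _; rewrite sqmodN.
Qed.

Lemma pnorm_triangleB n a b : pnorm n (a - b) <= pnorm n a + pnorm n b.
Proof. by rewrite -(pnorm_opp n b); exact: pnorm_triangle. Qed.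

Lemma pnorm_distC n a b : pnorm n (a - b) = pnorm n (b - a).
Proof. by rewrite -opprB pnorm_opp. Qed.

Lemma pnorm0 n : pnorm n (0 : nat -> C) = 0.
Proof. by rewrite -[0](scale0r (0 : nat -> C)) pnorm_scale cabs0 mul0r. Qed.

Lemma pnorm_sum n I (r : seq I) (F : I -> nat -> C) :
  pnorm n (\sum_(i <- r) F i) <= \sum_(i <- r) pnorm n (F i).
Proof.
elim: r => [|i r IH]; first by rewrite !big_nil pnorm0.
by rewrite !big_cons (le_trans (pnorm_triangle _ _ _)) // lerD2l.
Qed.

Lemma cabs_le_pnorm n k a : (k < n)%N -> cabs (a k) <= pnorm n a.
Proof.
move=> kn; apply: le_trans (pnorm_mono a kn).
by rewrite -(ger0_norm (cabs_ge0 (a k))) -sqrtr_sqr ler_wsqrtr // psqnormS lerDr psqnorm_ge0.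
Qed.

Definition pdot n a b : R := \sum_(k < n) rdot (a k) (b k).

Lemma psqnormD n a b : psqnorm n (a + b) = psqnorm n a + 2 * pdot n a b + psqnorm n b.
Proof.
rewrite /psqnorm /pdot mulr_sumr -!big_split /=.
by apply: eq_bigr => k _; exact: sqmodD.
Qed.

Lemma pdot_scale n a b (x : R) : pdot n a ((x%:C)%C *: b) = x * pdot n a b.
Proof.
rewrite /pdot mulr_sumr; apply: eq_bigr => k _; rewrite /rdot /=.
have -> : ((x%:C)%C *: b) k = (x%:C)%C * b k by [].
by case: (b k) => c d /=; ring.
Qed.

Lemma psqnorm_scale n (c : C) a : psqnorm n (c *: a) = sqmod c * psqnorm n a.
Proof. by rewrite -!pnorm_sqr pnorm_scale exprMn. Qed.

Lemma sqmod_real (x : R) : sqmod (x%:C)%C = x ^+ 2.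
Proof. by rewrite /sqmod cabs_real real_normK ?num_real. Qed.

Definition zshift a : nat -> C := fun k => if k is k'.+1 then a k' else 0.

Lemma psqnorm_shift n a : psqnorm n.+1 (zshift a) = psqnorm n a.
Proof. by rewrite /psqnorm big_ord_recl /= sqmod0 add0r. Qed.

Lemma psqnorm_shift_le n a : psqnorm n (zshift a) <= psqnorm n a.
Proof.
by case: n => [|n]; [rewrite /psqnorm !big_ord0|rewrite psqnorm_shift psqnorm_mono].
Qed.

Lemma pnorm_shift_le n a : pnorm n (zshift a) <= pnorm n a.
Proof. by rewrite ler_wsqrtr // psqnorm_shift_le. Qed.

Local Notation "q ** a" := (polymul_coef q a) (at level 40, left associativity).

(** Coefficients below [n] see only the truncation of [a], which is a polynomial; associativity of
    the action then comes from the polynomial ring. *)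
Lemma actE n k q a : (k < n)%N -> (q ** a) k = (q * \poly_(i < n) a i)`_k.
Proof.
move=> kn; rewrite coefM; apply: eq_bigr => i _.
by rewrite coef_poly (leq_ltn_trans (leq_subr _ _) kn).
Qed.

Lemma actM p q a : (p * q) ** a = p ** (q ** a).
Proof.
apply/funext => k; rewrite (actE _ _ (ltnSn k)) -mulrA coefM.
by apply: eq_bigr => i _; rewrite (actE _ _ (_ : k - i < k.+1)%N) // ltnS leq_subr.
Qed.

Lemma actDl p q a : (p + q) ** a = p ** a + q ** a.
Proof.
apply/funext => k; rewrite !fctE /polymul_coef -big_split /=.
by apply: eq_bigr => i _; rewrite coefD mulrDl.
Qed.

Lemma actDr p a b : p ** (a + b) = p ** a + p ** b.
Proof.
apply/funext => k; rewrite !fctE /polymul_coef -big_split /=.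
by apply: eq_bigr => i _; rewrite -mulrDr.
Qed.

Lemma actZl (c : C) p a : (c *: p) ** a = c *: (p ** a).
Proof.
apply/funext => k; rewrite -[RHS]/(c * (p ** a) k) /polymul_coef mulr_sumr.
by apply: eq_bigr => i _; rewrite coefZ -mulrA.
Qed.

Lemma actZr (c : C) p a : p ** (c *: a) = c *: (p ** a).
Proof.
apply/funext => k; rewrite -[RHS]/(c * (p ** a) k) /polymul_coef mulr_sumr.
by apply: eq_bigr => i _; rewrite -mulrCA.
Qed.

Lemma actNl p a : (- p) ** a = - (p ** a).
Proof. by rewrite -scaleN1r actZl scaleN1r. Qed.

Lemma actNr p a : p ** (- a) = - (p ** a).
Proof. by rewrite -scaleN1r actZr scaleN1r. Qed.

Lemma actBl p q a : (p - q) ** a = p ** a - q ** a.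
Proof. by rewrite actDl actNl. Qed.

Lemma actBr p a b : p ** (a - b) = p ** a - p ** b.
Proof. by rewrite actDr actNr. Qed.

Lemma act0l a : 0 ** a = 0.
Proof. by rewrite -[0 in LHS](scale0r 0) actZl scale0r. Qed.

Lemma act1l a : 1 ** a = a.
Proof.
apply/funext => k; rewrite /polymul_coef big_ord_recl big1 ?addr0.
  by rewrite coef1 mul1r subn0.
by move=> i _; rewrite coef1 mul0r.
Qed.

Lemma actCl (c : C) a : c%:P ** a = c *: a.
Proof. by rewrite -alg_polyC actZl act1l. Qed.

Lemma actXl a : 'X ** a = zshift a.
Proof.
apply/funext => -[|k].
  by rewrite /polymul_coef big_ord1 coefX mul0r.
rewrite /polymul_coef !big_ord_recl big1 ?addr0 => [|i _]; last first.
  by rewrite coefX mul0r.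
by rewrite !coefX mul0r add0r mul1r /= subSS subn0.
Qed.

Lemma act_at0 p a : (p ** a) 0%N = p`_0 * a 0%N.
Proof. by rewrite /polymul_coef big_ord1. Qed.

Lemma act_sum I (r : seq I) (F : I -> {poly C}) a :
  (\sum_(i <- r) F i) ** a = \sum_(i <- r) F i ** a.
Proof. by apply: (big_morph (fun p => p ** a)) => [p q|]; rewrite ?actDl ?act0l. Qed.

Lemma pnorm_actXn n i a : pnorm n ('X^i ** a) <= pnorm n a.
Proof.
elim: i => [|i IH]; first by rewrite expr0 act1l.
by rewrite exprS actM actXl (le_trans (pnorm_shift_le _ _)).
Qed.

(** The norm of the Wiener algebra. It dominates both the multiplier norm ([pnorm_act]) and the
    supremum on the closed disc ([cabs_horner]), so one small quantity controls the $H^2$ side and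
    the values on $E$ together. *)
Definition l1 p : R := \sum_(i < size p) cabs p`_i.

Lemma l1E m p : (size p <= m)%N -> l1 p = \sum_(i < m) cabs p`_i.
Proof.
move=> pm; rewrite /l1 (big_ord_widen m (fun i => cabs p`_i)) // big_mkcond.
apply: eq_bigr => i _; case: ltnP => // h.
by rewrite nth_default // cabs0.
Qed.

Lemma l1_ge0 p : 0 <= l1 p.
Proof. by apply: sumr_ge0 => i _; exact: cabs_ge0. Qed.

Lemma l1D p q : l1 (p + q) <= l1 p + l1 q.
Proof.
have [hp hq] : (size p <= maxn (size p) (size q))%N /\
               (size q <= maxn (size p) (size q))%N.
  by rewrite leq_maxl leq_maxr.
rewrite (l1E (size_polyD p q)) (l1E hp) (l1E hq) -big_split /=.
by apply: ler_sum => i _; rewrite coefD cabsD.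
Qed.

Lemma l1Z (c : C) p : l1 (c *: p) = cabs c * l1 p.
Proof.
rewrite (l1E (size_scale_leq c p)) (l1E (leqnn (size p))) mulr_sumr.
by apply: eq_bigr => i _; rewrite coefZ cabsM.
Qed.

Lemma l10 : l1 0 = 0.
Proof. by rewrite /l1 size_poly0 big_ord0. Qed.

Lemma l1N p : l1 (- p) = l1 p.
Proof. by rewrite -scaleN1r l1Z cabsN cabs1 mul1r. Qed.

Lemma l1B p q : l1 (p - q) <= l1 p + l1 q.
Proof. by rewrite -(l1N q); exact: l1D. Qed.

Lemma l1C (c : C) : l1 c%:P = cabs c.
Proof. by rewrite (l1E (size_polyC_leq1 c)) big_ord1 coefC. Qed.

Lemma l11 : l1 1 = 1.
Proof. by rewrite -[1]polyC1 l1C cabs1. Qed.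

Lemma l1XM p : l1 ('X * p) = l1 p.
Proof.
rewrite (@l1E (size p).+1) ?big_ord_recl ?coefXM ?cabs0 ?add0r.
  by apply: eq_bigr => i _; rewrite coefXM.
by have [->|p0] := eqVneq p 0; rewrite ?mulr0 ?size_poly0 // mulrC size_mulX.
Qed.

Lemma l1X : l1 'X = 1.
Proof. by rewrite -[X in l1 X]mulr1 l1XM l11. Qed.

Lemma l1_sum I (r : seq I) (F : I -> {poly C}) :
  l1 (\sum_(i <- r) F i) <= \sum_(i <- r) l1 (F i).
Proof.
elim: r => [|i r IH]; first by rewrite !big_nil l10.
by rewrite !big_cons (le_trans (l1D _ _)) // lerD2l.
Qed.

Lemma poly_sumE p : p = \sum_(i < size p) p`_i *: 'X^i.
Proof. by rewrite -poly_def coefK. Qed.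

Lemma l1M p q : l1 (p * q) <= l1 p * l1 q.
Proof.
rewrite {1}(poly_sumE p) mulr_suml (le_trans (l1_sum _ _)) //.
rewrite -[leRHS]/((\sum_(i < size p) cabs p`_i) * l1 q) mulr_suml.
apply: ler_sum => i _; rewrite -scalerAl l1Z ler_wpM2l ?cabs_ge0 //.
elim: (val i) => [|k IH]; first by rewrite expr0 mul1r.
by rewrite exprS -mulrA l1XM.
Qed.

Lemma pnorm_act n p a : pnorm n (p ** a) <= l1 p * pnorm n a.
Proof.
rewrite {1}(poly_sumE p) act_sum (le_trans (pnorm_sum _ _ _)) // /l1 mulr_suml.
apply: ler_sum => i _; rewrite actZl pnorm_scale ler_wpM2l ?cabs_ge0 //.
exact: pnorm_actXn.
Qed.

Lemma cabs_horner p (z : C) : cabs z <= 1 -> cabs p.[z] <= l1 p.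
Proof.
move=> z1; rewrite horner_coef (le_trans (cabs_sum _ _)) //.
apply: ler_sum => i _; rewrite cabsM cabsX ler_piMr ?cabs_ge0 //.
by rewrite exprn_ile1 ?cabs_ge0.
Qed.

Lemma psqnorm_series n a : psqnorm n a = series (fun k => sqmod (a k)) n.
Proof. by rewrite /series /= big_mkord. Qed.

Lemma H2P a : H2 a <-> exists M : R, forall n, pnorm n a <= M.
Proof.
split=> [Ha|[M HM]].
  exists (h2norm a) => n; rewrite ler_wsqrtr // psqnorm_series.
  apply: nondecreasing_cvgn_le => //.
  by apply: nondecreasing_series => k _ _; exact: sqmod_ge0.
apply: nondecreasing_is_cvgn.
  by apply: nondecreasing_series => k _ _; exact: sqmod_ge0.
exists (M ^+ 2) => _ [n _ <-]; rewrite -psqnorm_series -pnorm_sqr.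
by rewrite ler_pXn2r ?nnegrE ?pnorm_ge0 // (le_trans (pnorm_ge0 n a)).
Qed.

Lemma pnorm_le_h2norm n a : H2 a -> pnorm n a <= h2norm a.
Proof.
move=> Ha; rewrite ler_wsqrtr // psqnorm_series.
apply: nondecreasing_cvgn_le => //.
by apply: nondecreasing_series => k _ _; exact: sqmod_ge0.
Qed.

(** With [pnorm_le_h2norm], this carries estimates uniform in the truncation over to $H^2$; the
    uniform bound itself provides membership. *)
Lemma h2norm_le a (c : R) : (forall n, pnorm n a <= c) -> h2norm a <= c.
Proof.
move=> Hc; have c0 : 0 <= c by apply: le_trans (Hc 0%N); exact: pnorm_ge0.
have Ha : H2 a by apply/H2P; exists c.
rewrite -(ger0_norm c0) -sqrtr_sqr ler_wsqrtr //.
apply: limr_le => //; near=> n.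
by rewrite -psqnorm_series -pnorm_sqr ler_pXn2r ?nnegrE ?pnorm_ge0.
Unshelve. all: by end_near.
Qed.

Lemma h2norm_ge0 a : 0 <= h2norm a.
Proof. exact: sqrtr_ge0. Qed.

Lemma H2D a b : H2 a -> H2 b -> H2 (a + b).
Proof.
move=> /H2P[A HA] /H2P[B HB]; apply/H2P; exists (A + B) => n.
by rewrite (le_trans (pnorm_triangle _ _ _)) // lerD.
Qed.

Lemma H2Z (c : C) a : H2 a -> H2 (c *: a).
Proof.
move=> /H2P[A HA]; apply/H2P; exists (cabs c * A) => n.
by rewrite pnorm_scale ler_wpM2l ?cabs_ge0.
Qed.

Lemma H2B a b : H2 a -> H2 b -> H2 (a - b).
Proof. by move=> Ha Hb; rewrite -scaleN1r; apply: H2D => //; exact: H2Z. Qed.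

Lemma H2_act p a : H2 a -> H2 (p ** a).
Proof.
move=> /H2P[A HA]; apply/H2P; exists (l1 p * A) => n.
by rewrite (le_trans (pnorm_act _ _ _)) // ler_wpM2l ?l1_ge0.
Qed.

Lemma h2norm_triangle a b : H2 a -> H2 b -> h2norm (a + b) <= h2norm a + h2norm b.
Proof.
move=> Ha Hb; apply: h2norm_le => n; rewrite (le_trans (pnorm_triangle _ _ _)) //.
by rewrite lerD // pnorm_le_h2norm.
Qed.

Lemma h2norm_act p a : H2 a -> h2norm (p ** a) <= l1 p * h2norm a.
Proof.
move=> Ha; apply: h2norm_le => n; rewrite (le_trans (pnorm_act _ _ _)) //.
by rewrite ler_wpM2l ?l1_ge0 // pnorm_le_h2norm.
Qed.

(** The constant function 1. By [act_one], letting a polynomial act on it gives the coefficient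
    sequence of that polynomial. *)
Definition one_series : nat -> C := fun k => (k == 0%N)%:R.
Local Notation e0 := one_series.

Lemma opa_residualE q a : opa_residual q a = q ** a - e0.
Proof. by []. Qed.

Lemma pnorm_one n : pnorm n.+1 e0 = 1.
Proof.
rewrite /pnorm /psqnorm big_ord_recl big1 ?addr0 => [|i _]; last exact: sqmod0.
by rewrite /sqmod cabs1 expr1n sqrtr1.
Qed.

Lemma pnorm_one_le n : pnorm n e0 <= 1.
Proof. by rewrite -(pnorm_one n) pnorm_mono. Qed.

Lemma H2_one : H2 e0.
Proof. by apply/H2P; exists 1; exact: pnorm_one_le. Qed.

Lemma act_one p k : (p ** e0) k = p`_k.
Proof.
rewrite /polymul_coef big_ord_recr /= subnn mulr1 big1 ?add0r // => i _.
by rewrite /e0 subn_eq0 leqNgt ltn_ord mulr0.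
Qed.

Lemma H2_residual q a : H2 a -> H2 (opa_residual q a).
Proof. by move=> Ha; rewrite opa_residualE; apply: H2B; [exact: H2_act|exact: H2_one]. Qed.

Lemma act_inverse q y : q`_0 != 0 -> exists x, q ** x = y.
Proof.
move=> q0.
(* Each coefficient depends on all the previous ones, so [F k] carries the list of the first [k + 1]
   of them. *)
pose F := fix F k := if k is k'.+1 then
  let s := F k' in rcons s ((y k - \sum_(i < k) q`_i.+1 * s`_(k - i.+1)) / q`_0)
  else [:: y 0%N / q`_0].
have sizeF k : size (F k) = k.+1 by elim: k => [//|k IH] /=; rewrite size_rcons IH.
have Fnth k m : (m <= k)%N -> (F k)`_m = (F m)`_m.
  elim: k => [|k IH]; first by rewrite leqn0 => /eqP ->.
  rewrite leq_eqVlt => /orP[/eqP -> //|]; rewrite ltnS => mk.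
  by rewrite /= nth_rcons sizeF ltnS mk IH.
exists (fun k => (F k)`_k); apply/funext => -[|k].
  by rewrite act_at0 /= mulrC divfK.
rewrite /polymul_coef big_ord_recl subn0 /= nth_rcons sizeF ltnn eqxx.
rewrite mulrC divfK // [X in _ + X](_ : _ =
  \sum_(i < k.+1) q`_i.+1 * (F k)`_(k.+1 - i.+1)); first by rewrite subrK.
by apply: eq_bigr => i _; rewrite [in RHS]Fnth // subSS leq_subr.
Qed.

End Sequences.

(** * Thin covers of closed null subsets of the circle *)

Section Cover.
Variable R : realType.
Local Notation C := R[i].
Local Notation Re := complex.Re.
Local Notation Im := complex.Im.

Lemma cos_lipschitz (s t : R) : `|cos t - cos s| <= `|t - s|.
Proof.
wlog st : s t / s <= t => [H|].
  by case/orP: (le_total s t) => [/H //|/H]; rewrite distrC (distrC s).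
have [c _ ->] := MVT_segment st (fun x _ => is_derive_cos x)
  (continuous_subspaceT (@continuous_cos R)).
by rewrite normrM ler_piMl // normrN ler_norml sin_geN1 sin_le1.
Qed.

Lemma sin_lipschitz (s t : R) : `|sin t - sin s| <= `|t - s|.
Proof.
wlog st : s t / s <= t => [H|].
  by case/orP: (le_total s t) => [/H //|/H]; rewrite distrC (distrC s).
have [c _ ->] := MVT_segment st (fun x _ => is_derive_sin x)
  (continuous_subspaceT (@continuous_sin R)).
by rewrite normrM ler_piMl // ler_norml cos_geN1 cos_le1.
Qed.

Lemma expi_lipschitz (s t : R) : cabs (expi t - expi s) <= 2 * `|t - s|.
Proof.
rewrite (le_trans (cabs_ReIm _)) //= mulr_natl mulr2n lerD //.
  exact: cos_lipschitz.
exact: sin_lipschitz.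
Qed.

Lemma cabs_expi (t : R) : cabs (expi t) = 1.
Proof. by rewrite /cabs /= cos2Dsin2 sqrtr1. Qed.

Lemma expi_surj (z : C) : cabs z = 1 -> exists2 t : R, 0 <= t < 2 * pi & z = expi t.
Proof.
move=> z1; have := sqmodE z; rewrite /sqmod z1 expr1n.
case: z z1 => x y _ /= /esym xy.
have x1 : -1 <= x <= 1.
  rewrite -ler_norml -(ler_pXn2r (ltn0Sn 1)) ?nnegrE // expr1n real_normK ?num_real //.
  by rewrite -xy lerDl sqr_ge0.
have cx : cos (acos x) = x by rewrite acosK // itvE.
have a0 := acos_ge0 x1; have api := acos_lepi x1; have pi0 := pi_gt0 R.
have sx : sin (acos x) = `|y|.
  by rewrite sin_acos // -xy addrAC subrr add0r sqrtr_sqr.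
have [y0|y0] := leP 0 y.
  exists (acos x); first by rewrite a0 /=; lra.
  by rewrite /expi cx sx ger0_norm.
exists (2 * pi - acos x).
  have : acos x != 0.
    apply/eqP => a00; move: sx; rewrite a00 sin0 => /esym/eqP.
    by rewrite normr_eq0 => /eqP y00; rewrite y00 ltxx in y0.
  by rewrite neq_lt ltNge a0 /= => apos; apply/andP; split; lra.
rewrite /expi addrC [2 * _]mulr_natl cosD2pi sinD2pi cosN sinN cx sx ltr0_norm //.
by rewrite opprK.
Qed.

(** Arcs of one common radius [h], their number times [h] being small: a single pair of parameters
    then serves for all factors of the peak polynomial, and the product of their multiplier norms
    stays near 1. The centres need not lie in [E]. *)
Definition thin_cover (E : set C) : Prop := forall d : R, 0 < d ->
  exists (h : R) (ws : seq C), [/\ 0 < h, h < d, (size ws)%:R * h <= d,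
    forall w, w \in ws -> cabs w = 1 &
    forall z, E z -> exists2 w, w \in ws & cabs (z - w) <= h].

Variable E : set C.
Hypothesis E1 : E `<=` @unit_circle R.
Hypothesis Ecl : closed_in_C E.
Hypothesis Enull : arc_null E.

Let D := [set t : R | 0 <= t < 2 * pi /\ E (expi t)].
Let V m := \bigcup_(s in D) ball s (m.+1%:R^-1 : R).
Let mu := @lebesgue_measure R.

Let VP m t : V m t <-> exists2 s, D s & `|t - s| < m.+1%:R^-1.
Proof.
split=> [[s Ds]|[s Ds st]].
  by rewrite -ball_normE /= distrC => st; exists s.
by exists s => //; rewrite -ball_normE /= distrC.
Qed.

Let mV m : measurable (V m).
Proof.
apply: measurable_realfun.open_measurable; apply: bigcup_open => s _.
by apply: ball_open; rewrite invr_gt0.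
Qed.

Let mVV : measurable (\bigcap_m V m).
Proof. exact: bigcap_measurable. Qed.

(** Angles of [E] may accumulate at $2\pi$, which is excluded from [D]; hence the non-strict upper
    bound. Closedness of [E] puts the limit point in [E]. *)
Let V_limit t : (\bigcap_m V m) t -> 0 <= t <= 2 * pi /\ E (expi t).
Proof.
move=> Vt.
have near e : 0 < e -> exists2 s, D s & `|t - s| < e.
  move=> e0; have [m _ H] := near_infty_natSinv_lt (PosNum e0).
  have /VP[s Ds st] := Vt m I.
  exists s => //; apply: (lt_trans st). exact: (H m (leqnn m)).
split.
  apply/andP; split; rewrite leNgt; apply/negP => h.
    have [|s [/andP[s0 _] _]] := near (- t); first by rewrite oppr_gt0.
    by rewrite ltNge distrC ger0_norm; lra.
  have [|s [/andP[_ s0] _]] := near (t - 2 * pi); first by rewrite subr_gt0.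
  by rewrite ltNge ger0_norm; lra.
apply: Ecl => e e0; have [|s [_ Es] st] := near (e / 2); first by lra.
exists (expi s); split => //; rewrite /cdist cabs_distC.
by rewrite (le_lt_trans (expi_lipschitz _ _)) //; lra.
Qed.

(** The intersection exceeds the null set [D] by at most the single angle $2\pi$. Measurability of
    [D] is read off from its description as the part of the intersection in $[0, 2\pi)$. *)
Let mu_V : mu (\bigcap_m V m) = 0%E.
Proof.
have DV : D = \bigcap_m V m `&` `[0, 2 * pi[.
  apply/seteqP; split => [t Dt|t [/V_limit[_ Et] tI]].
    split; last by rewrite /= in_itv; case: Dt.
    by move=> m _; apply/VP; exists t => //; rewrite subrr normr0 invr_gt0.
  by split => //; move: tI; rewrite /= in_itv.
have mD : measurable D by rewrite DV; apply: measurableI.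
apply/eqP; rewrite eq_le measure_ge0 andbT.
pose P := [set (2 * pi : R)].
have mP : measurable P by exact: measurable_set1.
have -> : 0%E = (mu D + mu P)%E.
  by rewrite [mu D]Enull [mu P]lebesgue_measure_set1 adde0.
apply: (@le_trans _ _ (mu (D `|` P))); last exact: (measureU2 mu mD mP).
apply: le_measure; rewrite ?inE //; first exact: measurableU.
move=> t /V_limit[/andP[t0 t2] Et].
have [tpi|tpi] := eqVneq t (2 * pi); first by right.
by left; split => //; rewrite t0 /= lt_neqAle tpi.
Qed.

(** Continuity of the measure from above along the decreasing open neighbourhoods [V m]. *)
Let V_small (d : R) : 0 < d -> exists m, m.+1%:R^-1 < d /\ (mu (V m) < d%:E)%E.
Proof.
move=> d0.
(* Continuity from above needs one set of finite measure: angles lie in $[0, 8)$ and the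
   neighbourhoods have radius at most 1. *)
have V0 : (mu (V 0%N) < +oo)%E.
  apply: (@le_lt_trans _ _ (mu `]-2, 9[)).
    apply: le_measure; rewrite ?inE //; first exact: mV.
    move=> t /VP[s [/andP[s0 s2] _]].
    have h := pihalf_lt2 R; rewrite invr1 ltr_distl => /andP[h1 h2].
    by rewrite /= in_itv /=; apply/andP; split; lra.
  by rewrite /mu lebesgue_measure_itv /=; case: ifP => _; rewrite ?ltry // -EFinB ltry.
have Vmono : {homo V : n m / (n <= m)%N >-> (m <= n)%O}.
  move=> n m nm; apply/subsetPset => t /VP[s Ds st]; apply/VP; exists s => //.
  by rewrite (lt_le_trans st) // lef_pV2 ?posrE // ler_nat.
have cV : (mu \o V) x @[x --> \oo] --> 0%E.
  by rewrite -mu_V; exact: nonincreasing_cvg_mu.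
have small : \forall m \near \oo, (mu (V m) < d%:E)%E.
  apply: (cV [set x | (x < d%:E)%E]).
  by apply: open_nbhs_nbhs; split; [exact: open_ereal_lt_ereal|rewrite /= lte_fin].
have [m1 _ H1] := small; have [m2 _ H2] := near_infty_natSinv_lt (PosNum d0).
exists (maxn m1 m2); split; first exact: (H2 _ (leq_maxr _ _)).
exact: (H1 _ (leq_maxl _ _)).
Qed.

(** A grid cell of length [h = 1/(m+1)] that meets [D] lies inside [V m]; the cells are disjoint, so
    their number times [h] is at most the measure of [V m]. *)
Lemma null_thin_cover : thin_cover E.
Proof.
move=> d d0; have [|m []] := V_small (_ : 0 < d / 2); first by rewrite divr_gt0.
set h := _^-1 => hd Vd; have h0 : 0 < h by rewrite invr_gt0.
pose I j : set R := `[j%:R * h, j.+1%:R * h[%classic.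
have IP (j : nat) t : I j t <-> j%:R * h <= t < j%:R * h + h.
  by rewrite /I -[j.+1]addn1 natrD mulrDl mul1r /= in_itv.
(* Cells of length [h] covering $[0, 8)$, which contains $[0, 2\pi)$. *)
pose K := (8 * m.+1)%N.
pose P := [pred j : 'I_K | `[< exists2 s, D s & I j s >]].
have IV (j : 'I_K) : P j -> I j `<=` V m.
  move=> /asboolP[s Ds /IP/andP[s1 s2]] t /IP/andP[t1 t2].
  by apply/VP; exists s => //; rewrite -/h ltr_distl; apply/andP; split; lra.
have triv : trivIset (fun j : 'I_K => P j) (fun j : 'I_K => I j).
  have sep (i j : nat) t : I i t -> I j t -> (i <= j)%N.
    move=> /IP/andP[a _] /IP/andP[_ b].
    have := le_lt_trans a b; rewrite -[X in _ + X]mul1r -mulrDl ltr_pM2r //.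
    by rewrite natr1 ltr_nat ltnS.
  apply/trivIsetP => i j _ _ /eqP ij; apply/eqP/negPn/negP => /set0P[t [Ii Ij]].
  by apply: ij; apply/val_inj/eqP; rewrite eqn_leq (sep _ _ _ Ii Ij) (sep _ _ _ Ij Ii).
have mI j : measurable (I j) by exact: measurable_itv.
have muI j : mu (I j) = h%:E.
  rewrite /mu lebesgue_measure_itv /= lte_fin ltr_pM2r // ltr_nat ltnSn.
  by rewrite -EFinB -mulrBl -natrB // subSnn mul1r.
have card : #|P|%:R * h < d / 2.
  rewrite -lte_fin; apply: le_lt_trans Vd.
  have -> : (#|P|%:R * h)%:E = mu (\big[setU/set0]_(j < K | P j) I j).
    rewrite [RHS](measure_bigsetU_ord_cond (@lebesgue_measure R) (P := P)
      (F := fun j : 'I_K => I j)) //; last by move=> j _; exact: mI.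
    transitivity (\sum_(j < K | P j) h%:E)%E; last first.
      by apply: eq_bigr => j _; rewrite -(muI j).
    by rewrite sumEFin big_const iter_addr_0 mulr_natl.
  apply: le_measure; rewrite ?inE; [by apply: bigsetU_measurable => j _; exact: mI|exact: mV|].
  by rewrite -big_filter -bigcup_seq => t [j /= + ]; rewrite mem_filter => /andP[/IV H _] /H.
(* The radius doubles because [expi] is Lipschitz with constant 2; this is why the measure was made
   smaller than [d / 2]. *)
exists (2 * h), [seq expi (j%:R * h) | j : 'I_K in P]; split.
- by rewrite mulr_gt0.
- by move: hd; lra.
- by rewrite size_map -cardE; move: card; lra.
- by move=> w /mapP[j _ ->]; rewrite cabs_expi.
move=> z Ez; have [t /andP[t0 t2] zt] := expi_surj (E1 Ez).
have th0 : 0 <= t / h by rewrite divr_ge0 // ltW.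
have /andP[] := truncn_itv th0; set j := Num.trunc _.
rewrite ler_pdivlMr // ltr_pdivrMr // -[j.+1]addn1 natrD mulrDl mul1r => jt tj.
have jK : (j < K)%N.
  rewrite -(ltr_nat R) -(ltr_pM2r h0) (le_lt_trans jt) // (lt_trans t2) //.
  have -> : K%:R * h = 8 :> R by rewrite /K natrM -mulrA divff ?mulr1.
  by have := pihalf_lt2 R; lra.
exists (expi (j%:R * h)).
  apply/mapP; exists (Ordinal jK) => //; rewrite mem_enum; apply/asboolP; exists t.
    by split; [rewrite t0|rewrite -zt].
  by apply/IP; rewrite jt.
rewrite zt (le_trans (expi_lipschitz _ _)) // ler_pM2l //.
by rewrite ler_norml; apply/andP; split; lra.
Qed.

End Cover.

(** * Peak polynomials *)

Section Peak.
Variable R : realType.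
Local Notation C := R[i].
Local Notation Re := complex.Re.
Local Notation Im := complex.Im.
Local Notation "q ** a" := (polymul_coef q a) (at level 40, left associativity).
Implicit Types (a y : nat -> C) (p q : {poly C}) (n k L : nat).

Definition multiplier_bound p (c : R) : Prop := forall n y, pnorm n (p ** y) <= c * pnorm n y.

Lemma multiplier_boundM p q (c d : R) : 0 <= c ->
  multiplier_bound p c -> multiplier_bound q d -> multiplier_bound (p * q) (c * d).
Proof.
move=> c0 Hp Hq n y; rewrite actM -mulrA (le_trans (Hp _ _)) //.
by rewrite ler_wpM2l.
Qed.

(* [a, b, x] stand for [|y|^2, |t|^2, 2 Re<y, t>]. *)
Lemma dilation_quadratic (r s a b x : R) : 0 <= s -> s <= r -> r <= 1 ->
  0 <= b -> b <= a -> 0 <= a + x + b ->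
  (1 + s) ^+ 2 * (a - r * x + r ^+ 2 * b) <= (1 + r) ^+ 2 * (a - s * x + s ^+ 2 * b).
Proof.
move=> s0 sr r1 b0 ba H; rewrite -subr_ge0.
have -> : (1 + r) ^+ 2 * (a - s * x + s ^+ 2 * b) -
          (1 + s) ^+ 2 * (a - r * x + r ^+ 2 * b) =
  (r - s) * ((1 - r * s) * (a + x + b) + (a - b) * (1 + r + s + r * s)) by ring.
have rs1 : r * s <= 1 by rewrite mulr_ile1 //; lra.
have rs0 : 0 <= r * s by rewrite mulr_ge0 //; lra.
by apply: mulr_ge0; [lra|apply: addr_ge0; apply: mulr_ge0; lra].
Qed.

Definition realc (x : R) : C := (x%:C)%C.

Lemma cabs_realc (x : R) : 0 <= x -> cabs (realc x) = x.
Proof. by move=> x0; rewrite cabs_real ger0_norm. Qed.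

Lemma act_binomial (c : C) y : (1 - c *: 'X) ** y = y + (- c) *: zshift y.
Proof. by rewrite actBl act1l actZl actXl scaleNr. Qed.

(** The operator form of [cabs_dilation]: the unimodular number is replaced by a rotated shift,
    which on truncations is only a contraction. The hypothesis [b <= a] of [dilation_quadratic] is
    there for this case. *)
Lemma pnorm_dilation (r s : R) (al : C) n y : 0 <= s -> s <= r -> r <= 1 -> cabs al = 1 ->
  (1 + s) * pnorm n ((1 - (realc r * al) *: 'X) ** y) <=
  (1 + r) * pnorm n ((1 - (realc s * al) *: 'X) ** y).
Proof.
move=> s0 sr r1 al1; set t := al *: zshift y.
have E x : psqnorm n ((1 - (realc x * al) *: 'X) ** y) =
           psqnorm n y - x * (2 * pdot n y t) + x ^+ 2 * psqnorm n t.
  rewrite act_binomial.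
  have -> : - (realc x * al) *: zshift y = realc (- x) *: t.
    by rewrite /t scalerA /realc rmorphN mulNr.
  rewrite psqnormD pdot_scale psqnorm_scale sqmod_real sqrrN; ring.
rewrite -(ler_pXn2r (ltn0Sn 1)) ?nnegrE ?mulr_ge0 ?pnorm_ge0 //; [|lra..].
rewrite !exprMn !pnorm_sqr !E; apply: dilation_quadratic => //; first exact: psqnorm_ge0.
  by rewrite /t psqnorm_scale /sqmod al1 expr1n mul1r psqnorm_shift_le.
by rewrite -psqnormD psqnorm_ge0.
Qed.

Lemma cabs_dilation (r s : R) (t : C) : 0 <= s -> s <= r -> r <= 1 -> cabs t = 1 ->
  (1 + s) * cabs (1 - realc r * t) <= (1 + r) * cabs (1 - realc s * t).
Proof.
move=> s0 sr r1 t1.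
have E x : cabs (1 - realc x * t) ^+ 2 = 1 - x * (2 * Re t) + x ^+ 2 * 1.
  have : sqmod t = 1 by rewrite /sqmod t1 expr1n.
  rewrite -/(sqmod _) !sqmodE; case: (t) => a b /= H.
  have -> : (1 - (x * a - 0 * b)) ^+ 2 + (0 - (x * b + 0 * a)) ^+ 2 =
            1 - x * (2 * a) + x ^+ 2 * (a ^+ 2 + b ^+ 2) by ring.
  by rewrite H.
rewrite -(ler_pXn2r (ltn0Sn 1)) ?nnegrE ?mulr_ge0 ?cabs_ge0 //; [|lra..].
rewrite !exprMn !E; apply: dilation_quadratic => //.
have := cabs_Re t; rewrite t1 ler_norml => /andP[h _]; lra.
Qed.

Definition geo (c : C) L : {poly C} := \sum_(i < L) (c *: 'X) ^+ i.

Lemma geoE (c : C) L : (1 - c *: 'X) * geo c L = 1 - (c ^+ L) *: 'X^L.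
Proof.
have := subrX1 (c *: 'X : {poly C}) L; rewrite -/(geo c L) exprZn => H.
by rewrite -opprB mulNr -H opprB.
Qed.

Lemma geo_coef0 (c : C) L : (0 < L)%N -> (geo c L)`_0 = 1.
Proof.
case: L => // L _; rewrite /geo big_ord_recl expr0 coefD coef1 /= coef_sum big1 ?addr0 //.
by move=> i _; rewrite exprS -scalerAl coefZ coefXM mulr0.
Qed.

(* The quotient [(1 - r al z) / (1 - s al z)], with the geometric series of the
   inverse truncated. *)
Definition spike (r s : R) (al : C) L : {poly C} :=
  (1 - (realc r * al) *: 'X) * geo (realc s * al) L.

Lemma spike_coef0 r s al L : (0 < L)%N -> (spike r s al L)`_0 = 1.
Proof.
move=> L0; rewrite coefM big_ord1 subn0 geo_coef0 //.
by rewrite coefB coef1 coefZ coefX mulr0 subr0 mulr1.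
Qed.

(** One factor [1 + e] bounds the quotient $(1+r)/(1+s) = (2-h)/(2-e)$ given by [pnorm_dilation],
    the other one bounds $1 + (1-e)^L$, the norm left by truncating the geometric series. *)
Lemma spike_multiplier (h e : R) al L : 0 < h -> h <= e -> e < 1 -> cabs al = 1 ->
  (1 - e) ^+ L <= e -> multiplier_bound (spike (1 - h) (1 - e) al L) ((1 + e) ^+ 2).
Proof.
move=> h0 he e1 al1 HL n y; rewrite actM.
have ratio (x z : R) : 0 <= z -> (1 + (1 - e)) * x <= (1 + (1 - h)) * z -> x <= (1 + e) * z.
  move=> z0 H; have e2 : 0 < 1 + (1 - e) by move: e1; clear; lra.
  rewrite -(ler_pM2l e2) (le_trans H) // mulrA ler_wpM2r //.
  by move: h0 he e1; clear; nra.
have s0 : 0 <= 1 - e by rewrite subr_ge0 ltW.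
have h1 : 1 - h <= 1 by rewrite gerBl ltW.
have H := pnorm_dilation n (geo (realc (1 - e) * al) L ** y) s0 (lerB (lexx 1) he) h1 al1.
rewrite (le_trans (ratio _ _ (pnorm_ge0 _ _) H)) // expr2 -mulrA ler_wpM2l //.
  by move: h0 he; clear; lra.
rewrite -actM geoE actBl act1l actZl (le_trans (pnorm_triangleB _ _ _)) // mulrDl mul1r lerD2l.
rewrite pnorm_scale cabsX cabsM al1 mulr1 cabs_realc //.
by rewrite ler_pM ?pnorm_actXn ?pnorm_ge0 ?exprn_ge0.
Qed.

Lemma spike_horner (r s : R) al L z :
  (1 - realc s * (al * z)) * (spike r s al L).[z] =
  (1 - realc r * (al * z)) * (1 - (realc s * (al * z)) ^+ L).
Proof.
have /(congr1 (fun p => p.[z])) := geoE (realc s * al) L.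
rewrite /spike !hornerM !hornerD !hornerN !hornerZ !hornerC !hornerXn !hornerX.
rewrite -exprMn !(mulrA (realc _)) => <-; ring.
Qed.

(** The pointwise counterpart of [spike_multiplier], with the same two factors; it controls the
    factors attached to the other arcs. *)
Lemma spike_circle (h e : R) al L z : 0 < h -> h <= e -> e < 1 -> cabs al = 1 ->
  (1 - e) ^+ L <= e -> cabs z = 1 ->
  cabs (spike (1 - h) (1 - e) al L).[z] <= (1 + e) ^+ 2.
Proof.
move=> h0 he e1 al1 HL z1; set t := al * z.
have t1 : cabs t = 1 by rewrite cabsM al1 z1 mul1r.
have s0 : 0 <= 1 - e by rewrite subr_ge0 ltW.
have h1 : 1 - h <= 1 by rewrite gerBl ltW.
have den : e <= cabs (1 - realc (1 - e) * t).
  rewrite (le_trans _ (cabs_ge_dist _ _)) // cabs1 cabsM t1 mulr1 cabs_realc //.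
  by rewrite opprB addrC subrK.
have H := cabs_dilation s0 (lerB (lexx 1) he) h1 t1.
have := congr1 (@cabs R) (spike_horner (1 - h) (1 - e) al L z); rewrite -/t !cabsM.
have : cabs (1 - (realc (1 - e) * t) ^+ L) <= 1 + e.
  rewrite (le_trans (cabsB _ _)) // cabs1 lerD2l cabsX cabsM t1 mulr1 cabs_realc //.
move: H den (cabs_ge0 (spike (1 - h) (1 - e) al L).[z]) (cabs_ge0 (1 - realc (1 - h) * t)).
move: (cabs (1 - _ ^+ L)) (cabs (1 - realc (1 - h) * t)).
move: (cabs (1 - realc (1 - e) * t)) (cabs _.[z]).
move: h0 he e1; clear => h0 he e1 b S c a H den S0 a0 ce E.
have b0 : 0 < b by lra.
rewrite -(ler_pM2l b0) E.
apply: (@le_trans _ _ (a * (1 + e))); first by rewrite ler_wpM2l.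
rewrite expr2 !mulrA ler_wpM2r //; first by lra.
have e2 : 0 < 1 + (1 - e) by lra.
rewrite -(ler_pM2l e2) (le_trans H) // mulrCA mulrC ler_wpM2l //; first lra.
nra.
Qed.

(** Near the point of the circle conjugate to [al] the numerator is at most $2h$, the denominator at
    least $e$ and the truncation factor at most 2. The factor is thus small once [h] is much smaller
    than [e]. *)
Lemma spike_near (h e : R) al L z : 0 < h -> h <= e -> e < 1 -> cabs al = 1 ->
  (1 - e) ^+ L <= e -> cabs z = 1 -> cabs (1 - al * z) <= h ->
  cabs (spike (1 - h) (1 - e) al L).[z] <= 4 * h / e.
Proof.
move=> h0 he e1 al1 HL z1; set t := al * z => near.
have t1 : cabs t = 1 by rewrite cabsM al1 z1 mul1r.
have s0 : 0 <= 1 - e by rewrite subr_ge0 ltW.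
have s1 : 0 <= 1 - h by rewrite subr_ge0 (le_trans he) // ltW.
have e0 : 0 < e := lt_le_trans h0 he.
have den : e <= cabs (1 - realc (1 - e) * t).
  rewrite (le_trans _ (cabs_ge_dist _ _)) // cabs1 cabsM t1 mulr1 cabs_realc //.
  by rewrite opprB addrC subrK.
have num : cabs (1 - realc (1 - h) * t) <= 2 * h.
  have -> : 1 - realc (1 - h) * t = (1 - t) + realc h * t.
    by rewrite /realc rmorphB rmorph1 mulrBl mul1r opprB addrA addrAC.
  rewrite (le_trans (cabsD _ _)) // cabsM t1 mulr1 cabs_realc ?(ltW h0) //.
  by rewrite mulr_natl mulr2n lerD2r.
have := congr1 (@cabs R) (spike_horner (1 - h) (1 - e) al L z); rewrite -/t !cabsM.
have : cabs (1 - (realc (1 - e) * t) ^+ L) <= 2.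
  rewrite (le_trans (cabsB _ _)) // cabs1 cabsX cabsM t1 mulr1 cabs_realc //.
  by rewrite -[2]/(1 + 1) lerD2l (le_trans HL) // ltW.
move: den num (cabs_ge0 (spike (1 - h) (1 - e) al L).[z]) (cabs_ge0 (1 - realc (1 - h) * t)).
move: (cabs_ge0 (1 - (realc (1 - e) * t) ^+ L)).
move: (cabs (1 - _ ^+ L)) (cabs (1 - realc (1 - h) * t)).
move: (cabs (1 - realc (1 - e) * t)) (cabs _.[z]).
move: h0 e0; clear => h0 e0 b S c a c0 den num S0 a0 ce E.
rewrite ler_pdivlMr //; apply: (@le_trans _ _ (b * S)); first by rewrite mulrC ler_wpM2r.
by rewrite E (_ : 4 * h = 2 * h * 2) ?ler_pM //; ring.
Qed.

(** An upper bound $1/(1 - kx)$ for $(1+x)^k$ when $kx < 1$, in a form without division that passes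
    through the induction. *)
Lemma expr1D_bernoulli (x : R) k : 0 <= x -> (1 + x) ^+ k * (1 - k%:R * x) <= 1.
Proof.
move=> x0; elim: k => [|k IH]; first by rewrite expr0 mul0r subr0 mulr1.
apply: le_trans IH; rewrite exprSr -mulrA ler_wpM2l ?exprn_ge0 ?addr_ge0 //.
rewrite -natr1; have : 0 <= k%:R :> R by [].
by move: (k%:R : R) => m m0; nra.
Qed.

Lemma exists_small_power (e : R) : 0 < e -> e < 1 -> exists2 L, (0 < L)%N & (1 - e) ^+ L <= e.
Proof.
move=> e0 e1.
have s0 : 0 <= 1 - e by rewrite subr_ge0 ltW.
have : `|1 - e| < 1 by rewrite ger0_norm //; lra.
move=> /cvg_expr /cvgrPdist_lt /(_ e e0)[L _ /(_ L.+1 (leqnSn L))] /= H.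
by exists L.+1 => //; move: H; rewrite sub0r normrN ger0_norm ?exprn_ge0 // => /ltW.
Qed.

Lemma peak_polynomial (E : set C) : E `<=` @unit_circle R -> thin_cover E ->
  forall e : R, 0 < e -> e <= 1 -> exists w : {poly C},
    [/\ w`_0 = 1, multiplier_bound w (1 + e) & forall z, E z -> cabs w.[z] <= e].
Proof.
move=> E1 cov e e0 e1.
(* With [f = 8 h / e], the cover bound gives $2 M f = 16 M h / e \le e/2$ for [M] arcs, hence
   $(1+f)^{2M} \le 1/(1 - e/2) \le 1 + e$. *)
have d0 : 0 < e ^+ 2 / 32 by rewrite divr_gt0 // exprn_gt0.
have [h [ws [h0 hd whd ws1 cover]]] := cov _ d0.
(* This parameter makes the bound $4h/f$ of [spike_near] equal to [e / 2]. *)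
pose f := 8 * h / e.
have f0 : 0 < f by rewrite divr_gt0 // mulr_gt0.
have hf : h <= f by rewrite /f ler_pdivlMr // mulrC ler_wpM2r ?(ltW h0) //; lra.
have f1 : f < 1.
  by rewrite /f ltr_pdivrMr // mul1r; move: hd e0 e1; clear; nra.
have Mf : (2 * size ws)%:R * f <= e / 2.
  rewrite /f natrM mulrA ler_pdivrMr //.
  by move: whd; move: ((size ws)%:R) => M; clear; nra.
have [L L0 HL] := exists_small_power f0 f1.
pose phi w := spike (1 - h) (1 - f) (w^*)%C L.
have bound : ((1 + f) ^+ 2) ^+ size ws <= 1 + e.
  have := expr1D_bernoulli (2 * size ws) (ltW f0); rewrite exprM.
  have : 0 <= ((1 + f) ^+ 2) ^+ size ws by rewrite !exprn_ge0 //; lra.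
  move: Mf e0 e1; move: (((1 + f) ^+ 2) ^+ size ws) ((2 * size ws)%:R * f) => X Y.
  by clear; nra.
have f12 : 1 <= (1 + f) ^+ 2 by rewrite exprn_ege1 //; lra.
have cj w : w \in ws -> cabs (w^*)%C = 1 by move=> /ws1; rewrite cabs_conj.
have mono (s : seq C) : (size s <= size ws)%N -> ((1 + f) ^+ 2) ^+ size s <= 1 + e.
  by move=> ?; rewrite (le_trans _ bound) // ler_weXn2l.
exists (\prod_(w <- ws) phi w); split.
- elim: (ws) => [|w s IH]; first by rewrite big_nil coef1.
  by rewrite big_cons coefM big_ord1 subn0 IH spike_coef0 // mulr1.
- have H : multiplier_bound (\prod_(w <- ws) phi w) (((1 + f) ^+ 2) ^+ size ws).
    move: cj; clear - h0 hf f1 HL f12; elim: ws => [|w s IH] cj.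
      by rewrite big_nil => n y; rewrite act1l expr0 mul1r.
    rewrite big_cons -[size (w :: s)]/(size s).+1 exprS.
      apply: multiplier_boundM; first by lra.
      by apply: spike_multiplier => //; apply: cj; rewrite mem_head.
    by apply: IH => v vs; apply: cj; rewrite in_cons vs orbT.
  by move=> n y; rewrite (le_trans (H n y)) // ler_wpM2r ?pnorm_ge0.
move=> z Ez; have z1 : cabs z = 1 := E1 z Ez.
have [w wws zw] := cover z Ez.
(* The factor of the arc containing [z] is small; all the others together contribute at most
   [1 + e]. *)
rewrite horner_prod cabs_prod (perm_big _ (perm_to_rem wws)) big_cons /=.
have A : cabs (phi w).[z] <= e / 2.
  rewrite (le_trans (spike_near (h := h) _ _ _ _ _ _ _)) ?cj //.
    have -> : 1 - (w^*)%C * z = (w^*)%C * (w - z).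
      rewrite mulrBr [_ * w]mulrC mul_conjC /sqmod (ws1 _ wws) expr1n; congr (_ - _).
    by rewrite cabsM cj // mul1r cabs_distC.
  by rewrite /f (_ : _ / _ = e / 2) //; field; rewrite !gt_eqF.
have B : \prod_(v <- rem w ws) cabs (phi v).[z] <= 1 + e.
  apply: le_trans (mono (rem w ws) _); last by rewrite size_rem // leq_pred.
  have : {subset rem w ws <= ws} by exact: mem_rem.
  elim: (rem w ws) => [|v s IH] sub; first by rewrite big_nil expr0.
  rewrite big_cons -[size (v :: s)]/(size s).+1 exprS ler_pM ?cabs_ge0 ?prodr_ge0 //.
  - by move=> *; exact: cabs_ge0.
  - by apply: spike_circle => //; apply: cj; apply: sub; rewrite mem_head.
  - by apply: IH => u us; apply: sub; rewrite in_cons us orbT.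
have B0 : 0 <= \prod_(v <- rem w ws) cabs (phi v).[z].
  by apply: prodr_ge0 => *; exact: cabs_ge0.
apply: (@le_trans _ _ (e / 2 * (1 + e))); first by rewrite ler_pM ?cabs_ge0.
by move: e0 e1; clear; nra.
Qed.

End Peak.

(** * Polynomial approximation on E *)

Section PolynomialApproximation.
Variable R : realType.
Local Notation C := R[i].
Local Notation Re := complex.Re.
Local Notation Im := complex.Im.
Variable E : set C.
Hypothesis E1 : E `<=` @unit_circle R.
Implicit Types (G F : C -> C) (p q : {poly C}).

(** The uniform closure of the polynomials on [E]. It contains all continuous functions on [E] by
    [poly_approx_continuous], but the closure properties below are needed before that. *)
Definition poly_approx G : Prop := forall e : R, 0 < e ->
  exists p : {poly C}, forall z, E z -> cabs (p.[z] - G z) <= e.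

Lemma cabs_horner_E p z : E z -> cabs p.[z] <= l1 p.
Proof. by move=> /E1 z1; apply: cabs_horner; rewrite z1. Qed.

Lemma poly_approx_ext G F : (forall z, E z -> G z = F z) -> poly_approx G -> poly_approx F.
Proof.
move=> GF HG e /HG[p Hp]; exists p => z Ez; rewrite -GF //; exact: Hp.
Qed.

Lemma poly_approx_poly p : poly_approx (fun z => p.[z]).
Proof. by move=> e e0; exists p => z _; rewrite subrr cabs0 ltW. Qed.

Lemma poly_approx_const (c : C) : poly_approx (fun=> c).
Proof.
by apply: poly_approx_ext (poly_approx_poly c%:P) => z _; rewrite hornerC.
Qed.

Lemma poly_approx_id : poly_approx id.
Proof. by apply: poly_approx_ext (poly_approx_poly 'X) => z _; rewrite hornerX. Qed.

Lemma poly_approx_bounded G : poly_approx G ->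
  exists2 B : R, 0 < B & forall z, E z -> cabs (G z) <= B.
Proof.
move=> /(_ 1 ltr01)[p Hp]; exists (l1 p + 1); first by rewrite ltr_wpDl ?l1_ge0.
move=> z Ez; have -> : G z = p.[z] - (p.[z] - G z) by rewrite opprB addrC subrK.
by rewrite (le_trans (cabsB _ _)) // lerD ?cabs_horner_E ?Hp.
Qed.

Lemma poly_approx_limit G :
  (forall e : R, 0 < e -> exists2 F, poly_approx F & forall z, E z -> cabs (F z - G z) <= e) ->
  poly_approx G.
Proof.
move=> H e e0; have e2 : 0 < e / 2 by rewrite divr_gt0.
have [F /(_ _ e2)[p Hp] HF] := H _ e2; exists p => z Ez.
rewrite -(subrKA (F z)) (le_trans (cabsD _ _)) // (splitr e) lerD ?Hp ?HF //.
Qed.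

Lemma poly_approxD G F : poly_approx G -> poly_approx F -> poly_approx (fun z => G z + F z).
Proof.
move=> HG HF e e0; have e2 : 0 < e / 2 by rewrite divr_gt0.
have [p Hp] := HG _ e2; have [q Hq] := HF _ e2; exists (p + q) => z Ez.
by rewrite hornerD opprD addrACA (le_trans (cabsD _ _)) // (splitr e) lerD ?Hp ?Hq.
Qed.

Lemma poly_approxM G F : poly_approx G -> poly_approx F -> poly_approx (fun z => G z * F z).
Proof.
move=> HG HF e e0; have [B B0 HB] := poly_approx_bounded HG.
have e1 : 0 < e / (2 * B) by rewrite divr_gt0 // mulr_gt0.
have [q Hq] := HF _ e1.
have d0 : 0 < l1 q + 1 by rewrite ltr_wpDl ?l1_ge0.
have e2 : 0 < e / (2 * (l1 q + 1)) by rewrite divr_gt0 // mulr_gt0.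
have [p Hp] := HG _ e2; exists (p * q) => z Ez.
have -> : (p * q).[z] - G z * F z = (p.[z] - G z) * q.[z] + G z * (q.[z] - F z).
  by rewrite hornerM; ring.
rewrite (le_trans (cabsD _ _)) // (splitr e) lerD // cabsM.
  have -> : e / 2 = e / (2 * (l1 q + 1)) * (l1 q + 1) by field; rewrite gt_eqF.
  rewrite ler_pM ?cabs_ge0 ?Hp // (le_trans (cabs_horner_E _ _)) //.
  by rewrite lerDl.
have -> : e / 2 = B * (e / (2 * B)) by field; rewrite gt_eqF.
by rewrite ler_pM ?cabs_ge0 ?HB ?Hq.
Qed.

Lemma poly_approxX G n : poly_approx G -> poly_approx (fun z => G z ^+ n).
Proof.
move=> HG; elim: n => [|n IH].
  by apply: poly_approx_ext (poly_approx_const 1) => z _; rewrite expr0.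
by apply: poly_approx_ext (poly_approxM HG IH) => z _; rewrite exprS.
Qed.

Lemma poly_approx_sum I (r : seq I) (F : I -> C -> C) :
  (forall i, poly_approx (F i)) -> poly_approx (fun z => \sum_(i <- r) F i z).
Proof.
move=> HF; elim: r => [|i r IH].
  by apply: poly_approx_ext (poly_approx_const 0) => z _; rewrite big_nil.
by apply: poly_approx_ext (poly_approxD (HF i) IH) => z _; rewrite big_cons.
Qed.

Lemma expr_small (r e : R) : 0 <= r -> r < 1 -> 0 < e -> exists n, r ^+ n <= e.
Proof.
move=> r0 r1 e0; have : `|r| < 1 by rewrite ger0_norm.
move=> /cvg_expr /cvgrPdist_lt /(_ e e0)[n _ /(_ n (leqnn n))] /=.
by rewrite sub0r normrN ger0_norm ?exprn_ge0 // => /ltW; exists n.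
Qed.

(** The geometric series converges uniformly on [E]. *)
Lemma poly_approx_inv1B G (r : R) : r < 1 -> poly_approx G ->
  (forall z, E z -> cabs (G z) <= r) -> poly_approx (fun z => (1 - G z)^-1).
Proof.
move=> r1 HG Gr.
(* On an empty set [r] could be negative, so that case is settled apart. *)
have [[z0 Ez0]|E0] := pselect (exists z, E z); last first.
  by move=> e e0; exists 0 => z Ez; case: E0; exists z.
have r0 : 0 <= r by exact: le_trans (cabs_ge0 _) (Gr _ Ez0).
have r1' : 0 < 1 - r by rewrite subr_gt0.
apply: poly_approx_limit => e e0.
have [n rn] := expr_small r0 r1 (mulr_gt0 e0 r1').
exists (fun z => \sum_(i < n) G z ^+ i).
  by apply: poly_approx_sum => i; exact: poly_approxX.
move=> z Ez.
have den : 1 - r <= cabs (1 - G z).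
  by rewrite (le_trans _ (cabs_ge_dist _ _)) // cabs1 lerD2l lerN2 Gr.
have nz : 1 - G z != 0 by rewrite -cabs_gt0 (lt_le_trans r1').
have -> : \sum_(i < n) G z ^+ i - (1 - G z)^-1 = - (G z ^+ n / (1 - G z)).
  apply: (mulIf nz); rewrite mulrBl mulNr divfK // mulVf // mulrC.
  have := subrX1 (G z) n; set s := \sum_(_ < _) _ => H.
  have -> : (1 - G z) * s = - ((G z - 1) * s) by ring.
  by rewrite -H; ring.
rewrite cabsN cabsM cabsV cabsX ler_pdivrMr ?cabs_gt0 //.
rewrite (le_trans (_ : _ <= r ^+ n)) ?lerXn2r ?nnegrE ?cabs_ge0 ?Gr //.
by rewrite (le_trans rn) // ler_wpM2l // ltW.
Qed.

Hypothesis Ecov : thin_cover E.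

(** A peak polynomial has the form $w = 1 + z r$. Where it is small on the circle, $r$ is close to
    $-1/z = -\bar z$. This is where thinness of [E] makes the closure of the polynomials
    self-adjoint. *)
Lemma poly_approx_conj : poly_approx (fun z => (z^*)%C).
Proof.
apply: poly_approx_limit => e e0.
pose e' := Num.min e 1.
have e'0 : 0 < e' by rewrite lt_min e0 ltr01.
have e'1 : e' <= 1 by rewrite ge_min lexx orbT.
have [w [w0 _ Hw]] := peak_polynomial E1 Ecov e'0 e'1.
pose r := \poly_(i < size w) w`_i.+1.
have wE : w = 1 + 'X * r.
  apply/polyP => -[|i]; rewrite coefD coef1 coefXM /= ?w0 ?addr0 // add0r coef_poly.
  by case: ltnP => // h; rewrite nth_default // (leq_trans h).
exists (fun z => (- r).[z]); first exact: poly_approx_poly.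
move=> z Ez; have z1 : cabs z = 1 := E1 Ez.
have -> : (- r).[z] - (z^*)%C = - (z^*)%C * w.[z].
  rewrite [in RHS]wE !hornerE mulrDr mulr1 mulrA mulNr [_ * z]mulrC mul_conjC.
  by rewrite /sqmod z1 expr1n rmorph1 mulN1r addrC.
rewrite cabsM cabsN cabs_conj z1 mul1r (le_trans (Hw z Ez)) //.
by rewrite ge_min lexx.
Qed.

Hypothesis Ecl : closed_in_C E.

(** Compactness is used on the interval of angles. Around an angle whose point is in [E], continuity
    at that point applies; around any other angle, closedness leaves a neighbourhood without points
    of [E]. *)
Lemma uniformly_continuous_on (g : C -> C) : cont_on E g -> forall e : R, 0 < e ->
  exists2 d : R, 0 < d & forall z w, E z -> E w -> cabs (z - w) <= d -> cabs (g z - g w) <= e.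
Proof.
move=> cg e e0.
have /compact_near_coveringP cov := @segment_compact R 0 (2 * pi).
pose P (d t : R) := E (expi t) ->
  forall w, E w -> cabs (expi t - w) <= d -> cabs (g (expi t) - g w) <= e.
have : \forall d \near 0^'+, `[0, 2 * pi]%classic `<=` P d.
  apply: cov => t _.
  have [Et|nEt] := pselect (E (expi t)).
    have [|d d0 Hd] := cg _ Et (e / 2); first by rewrite divr_gt0.
    exists (ball t (d / 4), [set x | 0 < x < d / 4]).
      split; first by apply: nbhsx_ballx; rewrite divr_gt0.
      exists (d / 4); first by rewrite /= divr_gt0.
      by move=> x; rewrite /= sub0r normrN ltr_norml => /andP[_ h] x0; rewrite x0.
    move=> [s x] /= []; rewrite -ball_normE /= distrC => st /andP[x0 xd] Es w Ew sw.
    have ts : cabs (expi s - expi t) < d / 2.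
      by rewrite (le_lt_trans (expi_lipschitz _ _)) //; lra.
    have gs : cabs (g (expi s) - g (expi t)) < e / 2.
      by apply: Hd => //; rewrite /cdist (lt_trans ts) //; lra.
    have gw : cabs (g w - g (expi t)) < e / 2.
      apply: Hd => //; rewrite /cdist -(subrKA (expi s)) (le_lt_trans (cabsD _ _)) //.
      by rewrite (cabs_distC w); lra.
    rewrite -(subrKA (g (expi t))) (le_trans (cabsD _ _)) //.
    by rewrite (cabs_distC _ (g w)); lra.
  have [d [d0 Hd]] : exists d : R, 0 < d /\ forall w, E w -> d <= cabs (w - expi t).
    apply: contrapT => H; apply: nEt; apply: Ecl => d d0.
    apply: contrapT => H'; apply: H; exists d; split => // w Ew.
    by rewrite leNgt; apply/negP => h; apply: H'; exists w.
  exists (ball t (d / 2), setT).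
    by split; [apply: nbhsx_ballx; rewrite divr_gt0|exact: filterT].
  move=> [s x] /= []; rewrite -ball_normE /= distrC => st _ Es.
  have := Hd _ Es; rewrite leNgt (le_lt_trans (expi_lipschitz _ _)) //.
  by rewrite -ltr_pdivlMl // mulrC.
move=> [d /= d0 H]; exists (d / 2); first by rewrite divr_gt0.
move=> z w Ez Ew zw; have [t /andP[t0 t2] zt] := expi_surj (E1 Ez).
have tI : `[0, 2 * pi]%classic t by rewrite /= in_itv /= t0 ltW.
have : P (d / 2) t.
  apply: H tI; last by rewrite divr_gt0.
  by rewrite /= sub0r normrN ger0_norm ?ltr_pdivrMr //; lra.
by rewrite /P -zt; apply.
Qed.

End PolynomialApproximation.

(** * Weierstrass approximation on $E$ *)

Section Weierstrass.
Variable R : realType.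
Local Notation C := R[i].
Local Notation Re := complex.Re.
Local Notation Im := complex.Im.
Variable E : set C.
Hypothesis E1 : E `<=` @unit_circle R.
Hypothesis Ecov : thin_cover E.
Hypothesis Ecl : closed_in_C E.

(** The centres of a thin cover may lie off [E]. Each centre with a point of [E] within [h] is
    replaced by such a point, at the price of doubling the radius; the other centres are dropped. *)
Lemma finite_net (d : R) : 0 < d -> exists2 ws : seq C, (forall w, w \in ws -> E w) &
  forall z, E z -> exists2 w, w \in ws & cabs (z - w) <= d.
Proof.
move=> d0; have [|h [vs [h0 hd _ _ cover]]] := Ecov (_ : 0 < d / 2).
  by rewrite divr_gt0.
have [ws wsE net] : exists2 ws : seq C, (forall w, w \in ws -> E w) &
    forall z v, E z -> v \in vs -> cabs (z - v) <= h ->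
      exists2 w, w \in ws & cabs (z - w) <= d.
  elim: vs {cover} => [|v vs [ws wsE net]]; first by exists [::].
  have [[w [Ew wv]]|nw] := pselect (exists w, E w /\ cabs (w - v) <= h).
    exists (w :: ws) => [u|z u Ez].
      by rewrite in_cons => /orP[/eqP -> //|]; exact: wsE.
    rewrite in_cons => /orP[/eqP -> zv|uv zu].
      exists w; first exact: mem_head.
      rewrite -(subrKA v) (le_trans (cabsD _ _)) // (cabs_distC v); lra.
    by have [w' w'ws ?] := net z u Ez uv zu; exists w' => //; rewrite in_cons w'ws orbT.
  exists ws => // z u Ez; rewrite in_cons => /orP[/eqP -> zv|]; last exact: net.
  by case: nw; exists z.
by exists ws => // z Ez; have [v vvs zv] := cover z Ez; exact: net zv.
Qed.

Lemma sqmod_parallelogram (z w : C) :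
  sqmod (z + w) = 2 * sqmod z + 2 * sqmod w - sqmod (z - w).
Proof. by rewrite !sqmodE; case: z w => a b [c d] /=; ring. Qed.

(* The average of the values [g w] over a finite net, with weights
   [|z + w|^(2n)] concentrating at [w = z] as [n] grows. *)
Lemma poly_approx_continuous (g : C -> C) : cont_on E g -> poly_approx E g.
Proof.
move=> cg.
have [[z0 Ez0]|E0] := pselect (exists z, E z); last first.
  by move=> e e0; exists 0 => z Ez; case: E0; exists z.
have uc := uniformly_continuous_on E1 Ecl cg.
apply: poly_approx_limit => e e0; have e2 : 0 < e / 2 by rewrite divr_gt0.
have [d' d'0 Hd'] := uc _ e2.
pose d := Num.min d' 1.
have d0 : 0 < d by rewrite lt_min d'0 ltr01.
have d1 : d <= 1 by rewrite ge_min lexx orbT.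
have Hd z w : E z -> E w -> cabs (z - w) <= d -> cabs (g z - g w) <= e / 2.
  by move=> Ez Ew zw; apply: Hd' => //; rewrite (le_trans zw) // ge_min lexx.
have [|ws wsE net] := finite_net (_ : 0 < d / 2); first by rewrite divr_gt0.
pose B := \sum_(w <- ws) cabs (g w) + e / 2.
have B0 : 0 < B by rewrite ltr_wpDl // sumr_ge0 // => w _; exact: cabs_ge0.
have gws w : w \in ws -> cabs (g w) <= B.
  move=> wws; rewrite /B (big_rem w) //= -addrA lerDl addr_ge0 ?(ltW e2) //.
  by apply: sumr_ge0 => *; exact: cabs_ge0.
have gB z : E z -> cabs (g z) <= B.
  move=> Ez; have [w wws zw] := net z Ez.
  rewrite -(subrK (g w) (g z)) (le_trans (cabsD _ _)) // addrC lerD //.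
    rewrite (big_rem w) //= lerDl sumr_ge0 // => *; exact: cabs_ge0.
  by apply: Hd => //; [exact: wsE|rewrite (le_trans zw) // ler_pdivrMr //; lra].
pose K w z : R := sqmod (z + w).
have KE w z : E w -> E z -> K w z = 4 - cabs (z - w) ^+ 2.
  move=> /E1 w1 /E1 z1; rewrite /K sqmod_parallelogram /sqmod w1 z1 expr1n; ring.
have K0 w z : 0 <= K w z by exact: sqmod_ge0.
(* On the circle the kernel is $4 - |z-w|^2$. So [a] is a lower bound at a net point within [d / 2]
   of [z] and [b] an upper bound at the net points further than [d]; as [b < a], high powers make
   the latter negligible. *)
pose a := 4 - (d / 2) ^+ 2; pose b := 4 - d ^+ 2.
have d2 : d ^+ 2 <= 1 by rewrite exprn_ile1 // ltW.
have d20 : 0 < d ^+ 2 by rewrite exprn_gt0.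
have aE : a = 4 - d ^+ 2 / 4 by rewrite /a; field.
have a0 : 0 < a by rewrite aE; lra.
have b0 : 0 <= b by rewrite /b; lra.
have ba : b / a < 1 by rewrite ltr_pdivrMr // mul1r aE /b; lra.
pose M : R := (size ws)%:R.
have M0 : 0 < M.
  have [w wws _] := net z0 Ez0; rewrite ltr0n lt0n size_eq0.
  by apply/eqP => wsnil; rewrite wsnil in wws.
(* Chosen so that [M] far terms of size at most $2 B b^n$ add up to at most $(e/2) a^n$, hence to at
   most $(e/2) s(z)$. *)
have tau0 : 0 < e / (4 * B * M) by rewrite divr_gt0 // !mulr_gt0.
have [n Hn] := expr_small (divr_ge0 b0 (ltW a0)) ba tau0.
have {}Hn : M * (2 * B * b ^+ n) <= e / 2 * a ^+ n.
  have an0 : 0 < a ^+ n by rewrite exprn_gt0.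
  move: Hn; rewrite expr_div_n ler_pdivrMr // => Hn.
  have -> : M * (2 * B * b ^+ n) = (2 * B * M) * b ^+ n by ring.
  have -> : e / 2 * a ^+ n = (2 * B * M) * (e / (4 * B * M) * a ^+ n).
    by field; rewrite !gt_eqF.
  by rewrite ler_wpM2l // !mulr_ge0 // ltW.
pose s z : R := \sum_(w <- ws) K w z ^+ n.
have sa z : E z -> a ^+ n <= s z.
  move=> Ez; have [w wws zw] := net z Ez.
  rewrite /s (big_rem w) //= (le_trans (_ : _ <= K w z ^+ n)) //.
    rewrite lerXn2r ?nnegrE ?(ltW a0) // KE //; last exact: wsE.
    by rewrite lerD2l lerN2 lerXn2r ?nnegrE ?cabs_ge0 // ltW // divr_gt0.
  by rewrite lerDl sumr_ge0 // => *; rewrite exprn_ge0.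
(* An upper bound for the total weight [s]: then $0 \le 1 - s/T \le 1 - a^n/T < 1$ on [E], and $1/s$
   is obtained from [poly_approx_inv1B]. *)
pose T := M * 4 ^+ n.
have T0 : 0 < T by rewrite mulr_gt0 // exprn_gt0.
have sT z : E z -> s z <= T.
  move=> Ez; have : forall w, w \in ws -> K w z ^+ n <= 4 ^+ n.
    by move=> w /wsE Ew; rewrite lerXn2r ?nnegrE ?K0 // KE // gerBl sqr_ge0.
  rewrite /s /T /M; elim: (ws) => [|w l IH] H; first by rewrite big_nil mul0r.
  rewrite big_cons /= -natr1 mulrDl mul1r addrC lerD ?H ?mem_head //.
  by apply: IH => v vl; apply: H; rewrite in_cons vl orbT.
clearbody T.
have s0 z : E z -> 0 < s z by move=> /sa; apply: lt_le_trans; rewrite exprn_gt0.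
have paK w : poly_approx E (fun z => realc (K w z)).
  (* The weight involves the conjugate of [z]; this is what [poly_approx_conj] was proved for. *)
  apply: (@poly_approx_ext _ _ (fun z => (z + w) * ((z^*)%C + (w^*)%C))).
    by move=> z _; rewrite -rmorphD mul_conjC.
  apply: poly_approxM => //; apply: poly_approxD; try exact: poly_approx_const.
    exact: poly_approx_id.
  exact: poly_approx_conj.
have paKn w : poly_approx E (fun z => realc (K w z ^+ n)).
  apply: (@poly_approx_ext _ _ (fun z => realc (K w z) ^+ n)).
    by move=> z _; symmetry; exact: (rmorphXn (real_complex R)).
  exact: poly_approxX.
have pas : poly_approx E (fun z => realc (s z)).
  apply: (@poly_approx_ext _ _ (fun z => \sum_(w <- ws) realc (K w z ^+ n))).
    by move=> z _; symmetry; exact: (rmorph_sum (real_complex R)).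
  exact: poly_approx_sum.
have pasV : poly_approx E (fun z => (realc (s z))^-1).
  apply: (@poly_approx_ext _ _ (fun z => realc T^-1 * (1 - (1 - realc (s z) * realc T^-1))^-1)).
    move=> z Ez; rewrite subKr invfM mulrCA mulfV ?mulr1 // -cabs_eq0.
    by rewrite cabs_realc ?invr_ge0 ?invr_eq0 ?gt_eqF // ltW.
  apply: poly_approxM => //; first exact: poly_approx_const.
  apply: (@poly_approx_inv1B _ _ _ _ (1 - a ^+ n / T)) => //.
  - by rewrite ltrBlDr ltrDl divr_gt0 // exprn_gt0.
  - apply: (@poly_approx_ext _ _ (fun z => 1 + realc (- T^-1) * realc (s z))).
      by move=> z _; rewrite /realc rmorphN mulNr mulrC.
    apply: poly_approxD; first exact: poly_approx_const.
    by apply: poly_approxM => //; exact: poly_approx_const.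
  move=> z Ez; rewrite /realc -rmorphM -(rmorph1 (real_complex R)) -rmorphB.
  rewrite cabs_real ger0_norm.
    by rewrite lerD2l lerN2 ler_wpM2r ?sa // invr_ge0 ltW.
  by rewrite subr_ge0 ler_pdivrMr // mul1r sT.
exists (fun z => (\sum_(w <- ws) g w * realc (K w z ^+ n)) * (realc (s z))^-1).
  apply: poly_approxM => //; apply: poly_approx_sum => w.
  by apply: poly_approxM => //; exact: poly_approx_const.
move=> z Ez.
have sn0 : realc (s z) != 0 by rewrite -cabs_eq0 cabs_realc ?gt_eqF ?s0 // ltW ?s0.
have -> : (\sum_(w <- ws) g w * realc (K w z ^+ n)) / realc (s z) - g z =
          (\sum_(w <- ws) (g w - g z) * realc (K w z ^+ n)) / realc (s z).
  apply: (mulIf sn0); rewrite mulrBl !divfK // {2}/realc /s rmorph_sum mulr_sumr -sumrB.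
  by apply: eq_bigr => w _; rewrite mulrBl.
rewrite cabsM cabsV cabs_realc ?(ltW (s0 _ Ez)) // ler_pdivrMr ?s0 //.
rewrite (le_trans (cabs_sum _ _)) //.
apply: (@le_trans _ _ (\sum_(w <- ws) (e / 2 * K w z ^+ n + 2 * B * b ^+ n))).
  rewrite big_seq [leRHS]big_seq; apply: ler_sum => w wws; have Ew := wsE _ wws.
  have Kn0 : 0 <= K w z ^+ n by rewrite exprn_ge0.
  rewrite cabsM cabs_realc //.
  have Bb0 : 0 <= 2 * B * b ^+ n.
    by apply: mulr_ge0; [apply: mulr_ge0; rewrite // ltW|rewrite exprn_ge0].
  have eK0 : 0 <= e / 2 * K w z ^+ n by rewrite mulr_ge0 // ltW.
  have [near|far] := leP (cabs (z - w)) d.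
    rewrite (le_trans (_ : _ <= e / 2 * K w z ^+ n)) ?lerDl //.
    by rewrite ler_wpM2r // cabs_distC Hd // cabs_distC.
  rewrite (le_trans (_ : _ <= 2 * B * b ^+ n)) ?lerDr //.
  rewrite ler_pM ?cabs_ge0 //.
    by rewrite (le_trans (cabsB _ _)) // mulr_natl mulr2n lerD ?gB.
  have Kb : K w z <= b.
    by rewrite KE // lerD2l lerN2 lerXn2r ?nnegrE ?cabs_ge0 ?(ltW d0) // ltW.
  by rewrite lerXn2r ?nnegrE ?K0.
rewrite big_split /= -mulr_sumr -/(s z) big_const_seq count_predT iter_addr_0.
rewrite -[X in _ + X]mulr_natl -/M (le_trans (_ : _ <= e / 2 * s z + e / 2 * a ^+ n)) //.
  by rewrite lerD2l.
rewrite [leRHS](_ : _ = e / 2 * s z + e / 2 * s z); last by field.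
by rewrite lerD2l ler_wpM2l ?sa // ltW.
Qed.

End Weierstrass.

(** * Zero-free approximation *)

Section ZeroFree.
Variable R : realType.
Local Notation C := R[i].
Local Notation Re := complex.Re.
Local Notation Im := complex.Im.
Local Notation "q ** a" := (polymul_coef q a) (at level 40, left associativity).
Local Notation e0 := (@one_series R).
Variable E : set C.
Hypothesis E1 : E `<=` @unit_circle R.
Hypothesis Ecov : thin_cover E.
Hypothesis Ecl : closed_in_C E.
Implicit Types (G F : C -> C) (p q : {poly C}).

(* The lower bound [pnorm n y <= c * pnorm n (q ** y)] says that [1 / q] is a bounded
   multiplier of H^2; it replaces zero-freeness on the closed disc. *)
Definition zero_free_approx G : Prop := forall e : R, 0 < e ->
  exists q (c : R), [/\ q`_0 != 0, 0 <= c,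
    forall n y, pnorm n y <= c * pnorm n (q ** y),
    forall s, q ** s = e0 -> forall n, pnorm n (s - e0) <= e &
    forall z, E z -> cabs (q.[z] - G z) <= e].

Lemma zero_free_approx_ext G F : (forall z, E z -> G z = F z) ->
  zero_free_approx G -> zero_free_approx F.
Proof.
move=> GF HG e /HG[q [c [? ? ? ? Hq]]]; exists q, c; split => // z Ez.
by rewrite -GF //; exact: Hq.
Qed.

Lemma zero_free_approx_limit G :
  (forall e : R, 0 < e ->
     exists2 F, zero_free_approx F & forall z, E z -> cabs (F z - G z) <= e) ->
  zero_free_approx G.
Proof.
move=> H e e0'; have e2 : 0 < e / 2 by rewrite divr_gt0.
have [F /(_ _ e2)[q [c [q0 c0 Hc Hs Hq]]] HF] := H _ e2; exists q, c; split => //.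
  by move=> s qs n; rewrite (le_trans (Hs s qs n)) // ler_pdivrMr //; lra.
move=> z Ez; rewrite -(subrKA (F z)) (le_trans (cabsD _ _)) // (splitr e) lerD ?Hq ?HF //.
Qed.

(** Take $q = 1 + p(1 - w)$ with $w$ a peak polynomial. As a multiplier, $1 - w$ has norm at most 3
    and $p$ at most $1/4$, so $q$ differs from 1 by at most $3/4$ and its inverse is bounded by 4,
    whatever the precision asked of $w$. *)
Lemma zero_free_approx_small p : l1 p <= 1 / 4 -> zero_free_approx (fun z => 1 + p.[z]).
Proof.
move=> p4 e e_gt0; pose d := Num.min 1 (Num.min e (e ^+ 2 / 3)).
have d0 : 0 < d by rewrite !lt_min ltr01 e_gt0 divr_gt0 // exprn_gt0.
have d1 : d <= 1 by rewrite ge_min lexx.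
have de : d <= e by rewrite !ge_min lexx !orbT.
have de2 : 3 * d <= e ^+ 2.
  have : d <= e ^+ 2 / 3 by rewrite !ge_min lexx !orbT.
  by rewrite ler_pdivlMr // mulrC.
have [w [w0 Mw Ew]] := peak_polynomial E1 Ecov d0 d1.
have M3 n y : pnorm n ((1 - w) ** y) <= 3 * pnorm n y.
  rewrite actBl act1l (le_trans (pnorm_triangleB _ _ _)) //.
  have := Mw n y; have := pnorm_ge0 n y; move: (pnorm n y) => x x0; nra.
set v := w ** e0 - e0.
(* Since $w(0) = 1$, the function $w - 1$ is orthogonal to 1, and $|w - 1|^2 = |w|^2 - 1 \le (1+d)^2
   - 1 \le 3d \le e^2$. *)
have Nv n : pnorm n v <= e.
  case: n => [|n]; first by rewrite /pnorm /psqnorm big_ord0 sqrtr0 ltW.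
  have v0 : v 0%N = 0 by rewrite /v -[LHS]/((w ** e0) 0%N - e0 0%N) act_one w0 subrr.
  have dot0 : pdot n.+1 e0 v = 0.
    rewrite /pdot big_ord_recl v0 big1 ?addr0 /rdot /=; first by rewrite !mulr0 addr0.
    by move=> i _; rewrite !mul0r addr0.
  have := Mw n.+1 e0; rewrite pnorm_one mulr1.
  rewrite -(ler_pXn2r (ltn0Sn 1)) ?nnegrE ?pnorm_ge0 ?addr_ge0 ?(ltW d0) //.
  have -> : w ** e0 = e0 + v by rewrite /v addrC subrK.
  rewrite pnorm_sqr psqnormD dot0 -[psqnorm n.+1 e0]pnorm_sqr pnorm_one mulr0 addr0 expr1n => H.
  rewrite -(ler_pXn2r (ltn0Sn 1)) ?nnegrE ?pnorm_ge0 ?(ltW e_gt0) // pnorm_sqr (le_trans _ de2) //.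
  by move: H; nra.
have pq n y : pnorm n (p ** y) <= 1 / 4 * pnorm n y.
  by rewrite (le_trans (pnorm_act _ _ _)) // ler_wpM2r ?pnorm_ge0.
exists (1 + p * (1 - w)), 4; split => //.
- by rewrite coefD coef1 coefM big_ord1 coefB coef1 w0 subrr mulr0 addr0 oner_neq0.
- move=> n y; set q := 1 + _.
  have -> : y = q ** y - p ** ((1 - w) ** y) by rewrite actDl act1l actM addrK.
  rewrite -/q {2}/q actDl act1l actM addrK.
  have := pnorm_triangleB n (q ** y) (p ** ((1 - w) ** y)).
  have := pq n ((1 - w) ** y); have := M3 n y.
  have -> : q ** y - p ** ((1 - w) ** y) = y by rewrite actDl act1l actM addrK.
  by lra.
- move=> s qs n.
  (* From $s = 1 - p x$ one gets $x = (1 - w) - (1 - w) p x$, so $|x| \le e + (3/4)|x|$. Hence $|x|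
     \le 4e$ and $|s - 1| = |p x| \le e$. *)
  set x := (1 - w) ** s.
  have sE : s = e0 - p ** x by rewrite -qs actDl act1l actM addrK.
  have sB : s - e0 = - (p ** x) by rewrite {1}sE addrAC subrr add0r.
  have xE : x = - v - (1 - w) ** (p ** x).
    by rewrite /x {1}sE actBr actBl act1l /v opprB.
  have := pnorm_triangleB n (- v) ((1 - w) ** (p ** x)); rewrite -xE pnorm_opp.
  have := M3 n (p ** x); have := pq n x; have := Nv n.
  rewrite sB pnorm_opp; have := pnorm_ge0 n x; lra.
move=> z Ez; have := Ew z Ez.
have -> : (1 + p * (1 - w)).[z] - (1 + p.[z]) = - (p.[z] * w.[z]).
  by rewrite !hornerE; ring.
rewrite cabsN cabsM => wd; apply: (@le_trans _ _ (1 * d)); last by rewrite mul1r.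
rewrite ler_pM ?cabs_ge0 // (le_trans (cabs_horner_E E1 p Ez)) //; lra.
Qed.

(** Because $1/(q_1 q_2) - 1/q_2 = (1/q_2)(1/q_1 - 1)$, the factor $q_2$ is chosen first, and the
    precision of $q_1$ depends on the bound [c2] of $1/q_2$ as a multiplier. *)
Lemma zero_free_approxM G F (B : R) : 0 < B ->
  (forall z, E z -> cabs (G z) <= B) -> (forall z, E z -> cabs (F z) <= B) ->
  zero_free_approx G -> zero_free_approx F -> zero_free_approx (fun z => G z * F z).
Proof.
move=> B0 GB FB HG HF e e_gt0.
have d20 : 0 < e / (2 * (B + 1)) by rewrite divr_gt0 // mulr_gt0 // addr_gt0.
have [q2 [c2 [q20 c20 Hc2 Hs2 Hq2]]] := HF _ d20.
have D0 : 0 < 2 * (B + c2) + e by rewrite addr_gt0 // mulr_gt0 // ltr_pwDl.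
have d10 : 0 < e / (2 * (B + c2) + e) by rewrite divr_gt0.
have [q1 [c1 [q10 c10 Hc1 Hs1 Hq1]]] := HG _ d10.
set d2 := e / (2 * (B + 1)) in d20 Hs2 Hq2; set d1 := e / _ in d10 Hs1 Hq1.
have d2E : d2 * (B + 1) = e / 2 by rewrite /d2; field; rewrite gt_eqF // addr_gt0.
have d2e : d2 <= e / 2 by rewrite -d2E mulrDr mulr1 lerDr mulr_ge0 // ltW.
have d1E : d1 * (B + c2) <= e / 2.
  rewrite /d1 mulrAC ler_pdivrMr // ; have := mulr_gt0 e_gt0 e_gt0; lra.
have d11 : d1 <= 1 by rewrite /d1 ler_pdivrMr // mul1r lerDr mulr_ge0 // addr_ge0 // ltW.
have Bd1 : B * d1 <= e / 2.
  by rewrite (le_trans _ d1E) // mulrC ler_wpM2l ?(ltW d10) // lerDl.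
have cd1 : c2 * d1 <= e / 2.
  by rewrite (le_trans _ d1E) // mulrC ler_wpM2l ?(ltW d10) // lerDr ltW.
exists (q1 * q2), (c2 * c1); split.
- by rewrite coefM big_ord1 mulf_neq0.
- exact: mulr_ge0.
- by move=> n y; rewrite actM -mulrA (le_trans (Hc2 n y)) // ler_wpM2l.
- move=> s qs n; have [s2 q2s2] := act_inverse e0 q20.
  have H1 : pnorm n (q2 ** s - e0) <= d1 by apply: Hs1; rewrite -actM.
  have H2 := Hs2 _ q2s2 n.
  have H3 : pnorm n (s - s2) <= c2 * d1.
    by rewrite (le_trans (Hc2 _ _)) // actBr q2s2 ler_wpM2l.
  rewrite -(subrKA s2) (le_trans (pnorm_triangle _ _ _)) //; lra.
move=> z Ez; have -> : (q1 * q2).[z] - G z * F z =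
    (q1.[z] - G z) * q2.[z] + G z * (q2.[z] - F z) by rewrite hornerM; ring.
rewrite (le_trans (cabsD _ _)) // !cabsM.
have a1 := Hq1 z Ez; have a2 := Hq2 z Ez.
have a3 : cabs q2.[z] <= B + d2.
  by rewrite -(subrK (F z) q2.[z]) (le_trans (cabsD _ _)) // addrC lerD ?FB.
apply: (@le_trans _ _ (d1 * (B + d2) + B * d2)).
  by rewrite lerD // ler_pM ?cabs_ge0 ?GB.
have : d1 * d2 <= d2 by rewrite ler_piMl // ltW.
lra.
Qed.

Lemma zero_free_approxMpa G F : poly_approx E G -> poly_approx E F ->
  zero_free_approx G -> zero_free_approx F -> zero_free_approx (fun z => G z * F z).
Proof.
move=> /(poly_approx_bounded E1)[A A0 HA] /(poly_approx_bounded E1)[B B0 HB].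
apply: (@zero_free_approxM _ _ (A + B)); first by rewrite addr_gt0.
  by move=> z Ez; rewrite (le_trans (HA z Ez)) // lerDl ltW.
by move=> z Ez; rewrite (le_trans (HB z Ez)) // lerDr ltW.
Qed.

(** Second-order remainder of the binomial expansion, with a constant independent of the exponent;
    it compares $(1 + p/m)^m$ with $1 + p$. *)
Lemma expr1D_quadratic (y : C) m : m%:R * cabs y <= 1 ->
  forall k, (k <= m)%N ->
  cabs ((1 + y) ^+ k - 1 - k%:R * y) <= (k%:R * cabs y) ^+ 2.
Proof.
move=> my; elim=> [|k IH] km.
  by rewrite expr0 mul0r subr0 subrr cabs0 mul0r expr0n.
have -> : (1 + y) ^+ k.+1 - 1 - k.+1%:R * y =
    (1 + y) * ((1 + y) ^+ k - 1 - k%:R * y) + k%:R * (y * y).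
  by rewrite exprS -natr1; ring.
rewrite (le_trans (cabsD _ _)) // !cabsM.
have ck : cabs (k%:R : C) = k%:R by rewrite -(rmorph_nat (real_complex R)) cabs_realc.
rewrite ck.
have ky : k%:R * cabs y <= 1.
  by rewrite (le_trans _ my) // ler_wpM2r ?cabs_ge0 // ler_nat ltnW.
have c1 : cabs (1 + y) <= 1 + cabs y by rewrite (le_trans (cabsD _ _)) // cabs1.
have {}IH := IH (ltnW km).
apply: (@le_trans _ _ ((1 + cabs y) * (k%:R * cabs y) ^+ 2 + k%:R * (cabs y * cabs y))).
  by rewrite lerD2r ler_pM ?cabs_ge0.
rewrite -natr1; have : 0 <= k%:R :> R by []; have := cabs_ge0 y.
move: (k%:R : R) (cabs y) ky => u t ut t0 u0.
have -> : ((u + 1) * t) ^+ 2 = (u * t) ^+ 2 + 2 * u * t ^+ 2 + t ^+ 2 by ring.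
have : (u * t) * (u * t * t) <= 1 * (u * t * t) by rewrite ler_wpM2r ?mulr_ge0.
have := sqr_ge0 t; rewrite !expr2; nra.
Qed.

Lemma zero_free_approx1 : zero_free_approx (fun=> 1).
Proof.
apply: (@zero_free_approx_ext (fun z => 1 + (0 : {poly C}).[z])).
  by move=> z _; rewrite horner0 addr0.
by apply: zero_free_approx_small; rewrite l10; lra.
Qed.

Lemma zero_free_approxX G m : poly_approx E G -> zero_free_approx G ->
  zero_free_approx (fun z => G z ^+ m).
Proof.
move=> pG zG; elim: m => [|m IH].
  by apply: zero_free_approx_ext zero_free_approx1 => z _; rewrite expr0.
apply: (@zero_free_approx_ext (fun z => G z * G z ^+ m)).
  by move=> z _; rewrite exprS.
by apply: zero_free_approxMpa => //; exact: poly_approxX.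
Qed.

(** A polynomial small on [E] may have a large [l1] norm, out of reach of [zero_free_approx_small].
    But $p/m$ with $m > 4\,$[l1 p] is within reach, and $(1 + p/m)^m$ agrees with $1 + p$ on [E] up
    to [d ^+ 2]. *)
Lemma zero_free_approx_step p (d : R) :
  (forall z, E z -> cabs p.[z] <= d) -> 0 < d -> d <= 1 ->
  exists T, [/\ zero_free_approx T, poly_approx E T &
    forall z, E z -> cabs (T z - 1 - p.[z]) <= d ^+ 2].
Proof.
move=> pd d0 d1; pose m := (Num.trunc (4 * l1 p)).+1.
have m0 : 0 < m%:R :> R by [].
have mp : 4 * l1 p < m%:R.
  by have /andP[] := truncn_itv (mulr_ge0 (ler0n R 4) (l1_ge0 p)).
pose r := realc m%:R^-1 *: p.
have rE z : r.[z] = realc m%:R^-1 * p.[z] by rewrite hornerZ.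
have lr : l1 r <= 1 / 4.
  rewrite l1Z cabs_realc ?invr_ge0 ?(ltW m0) // mulrC ler_pdivrMr //; lra.
have pa : poly_approx E (fun z => 1 + r.[z]).
  apply: poly_approx_ext (@poly_approx_poly _ E (1 + r)) => z _.
  by rewrite hornerD hornerC.
exists (fun z => (1 + r.[z]) ^+ m); split.
- by apply: zero_free_approxX => //; exact: zero_free_approx_small.
- exact: poly_approxX.
move=> z Ez.
have myE : m%:R * r.[z] = p.[z].
  rewrite rE mulrA -(rmorph_nat (real_complex R)) -rmorphM mulfV ?gt_eqF //.
  by rewrite rmorph1 mul1r.
have my : m%:R * cabs r.[z] = cabs p.[z].
  by rewrite -myE cabsM -(rmorph_nat (real_complex R)) cabs_realc.
have := @expr1D_quadratic r.[z] m _ m (leqnn m); rewrite my myE => H.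
rewrite (le_trans (H _)) ?(le_trans (pd z Ez)) //.
by rewrite lerXn2r ?nnegrE ?cabs_ge0 ?pd // ltW.
Qed.

(** A multiplicative iteration: write $F = T \cdot (F/T)$ with $T$ given by [zero_free_approx_step].
    The quadratic error makes $F/T$ three times closer to 1 than $F$, and the argument is repeated
    on $F/T$. *)
Lemma zero_free_approx_near1 F : poly_approx E F ->
  (forall z, E z -> cabs (F z - 1) <= 1 / 16) -> zero_free_approx F.
Proof.
move=> paF HF.
have iter k : forall F (d : R), 0 < d -> d <= 1 / 16 -> poly_approx E F ->
    (forall z, E z -> cabs (F z - 1) <= d) ->
    exists F', [/\ zero_free_approx F', poly_approx E F' &
      forall z, E z -> cabs (F' z - F z) <= 2 * d / 2 ^+ k].
  elim: k => [|k IH] {HF paF}F d d0 d16 paF HF.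
    exists (fun=> 1); split; [exact: zero_free_approx1|exact: poly_approx_const|].
    move=> z Ez; rewrite cabs_distC expr0 divr1 (le_trans (HF z Ez)) //; lra.
  have d8 : 0 < d / 8 by rewrite divr_gt0.
  have [p Hp] := poly_approxD paF (poly_approx_const E (-1)) d8.
  have pd z : E z -> cabs p.[z] <= 9 / 8 * d.
    move=> Ez; rewrite -(subrK (F z - 1) p.[z]) (le_trans (cabsD _ _)) //.
    by have := Hp z Ez; have := HF z Ez; lra.
  have [||T [zT paT HT]] := zero_free_approx_step pd; [by lra..|].
  (* The error is at most $d/8$ from [p] plus $(9d/8)^2$ from [T]; the assumption $d \le 1/16$
     brings the sum below $d/4$. *)
  have FT z : E z -> cabs (F z - T z) <= d / 4.
    move=> Ez; have -> : F z - T z = - (p.[z] - (F z - 1)) - (T z - 1 - p.[z]) by ring.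
    rewrite (le_trans (cabsB _ _)) // cabsN.
    have := Hp z Ez; have := HT z Ez; have : d * d <= d * (1 / 16) by rewrite ler_pM2l.
    by rewrite exprMn expr2 (expr2 d); lra.
  have T1 z : E z -> cabs (1 - T z) <= 1 / 8.
    move=> Ez; rewrite cabs_distC -(subrKA (F z)) (le_trans (cabsD _ _)) //.
    by rewrite (cabs_distC (T z)); have := FT z Ez; have := HF z Ez; lra.
  have Tge z : E z -> 59 / 64 <= cabs (T z).
    move=> Ez; have := cabs_ge_dist 1 (1 - T z); rewrite cabs1 subKr.
    have : cabs (1 - T z) <= 5 / 64; last by lra.
    rewrite cabs_distC -(subrKA (F z)) (le_trans (cabsD _ _)) //.
    by rewrite (cabs_distC (T z)); have := FT z Ez; have := HF z Ez; lra.
  have T0 z : E z -> T z != 0 by move=> /Tge h; rewrite -cabs_gt0; lra.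
  have paTV : poly_approx E (fun z => (T z)^-1).
    apply: (@poly_approx_ext _ _ (fun z => (1 - (1 - T z))^-1)).
      by move=> z _; rewrite subKr.
    apply: (@poly_approx_inv1B _ _ E1 _ (1 / 8)) => //; first by lra.
    apply: (@poly_approx_ext _ _ (fun z => 1 + (-1) * T z)).
      by move=> z _; rewrite mulN1r.
    apply: poly_approxD; first exact: poly_approx_const.
    by apply: poly_approxM => //; exact: poly_approx_const.
  have [||||F1 [zF1 paF1 HF1]] := IH (fun z => F z * (T z)^-1) (d / 3).
  - by rewrite divr_gt0.
  - by lra.
  - exact: poly_approxM.
  - move=> z Ez; have -> : F z / T z - 1 = (F z - T z) / T z by rewrite mulrBl divff ?T0.
    rewrite cabsM cabsV ler_pdivrMr ?cabs_gt0 ?T0 // (le_trans (FT z Ez)) //.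
    have : d / 3 * (59 / 64) <= d / 3 * cabs (T z).
      by rewrite ler_wpM2l ?Tge // divr_ge0 // ltW.
    by lra.
  exists (fun z => T z * F1 z); split; [exact: zero_free_approxMpa|exact: poly_approxM|].
  move=> z Ez; have -> : T z * F1 z - F z = T z * (F1 z - F z / T z).
    by rewrite mulrBr mulrCA mulfV ?T0 ?mulr1.
  (* Multiplying back by [T] costs a factor $9/8$, so one round gains $(9/8)(1/3) < 1/2$ on the
     error. *)
  have Tle : cabs (T z) <= 9 / 8.
    have := cabsB 1 (1 - T z); rewrite subKr cabs1; have := T1 z Ez; lra.
  rewrite cabsM (le_trans (ler_pM _ _ Tle (HF1 z Ez))) ?cabs_ge0 //.
  rewrite exprS invfM; set x := (2 ^+ k)^-1.
  have : 0 <= d * x by rewrite mulr_ge0 ?(ltW d0) // invr_ge0 exprn_ge0.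
  by lra.
apply: zero_free_approx_limit => e e_gt0.
have h2 : (1 / 2 : R) < 1 by lra.
have [|k Hk] := @expr_small R (1 / 2) e _ h2 e_gt0; first by lra.
have [||F' [zF' _ HF']] := iter k F (1 / 16) _ _ paF HF; [by lra..|].
exists F' => // z Ez; rewrite (le_trans (HF' z Ez)) // (le_trans _ Hk) //.
have -> : (1 / 2 : R) ^+ k = (2 ^+ k)^-1 by rewrite div1r exprVn.
rewrite ler_piMl ?invr_ge0 ?exprn_ge0 //; lra.
Qed.

(** Keeping the inverse in the uniform closure of the polynomials lets one form the quotients of
    neighbouring functions along a path. *)
Definition nonvanishing_approx G : Prop :=
  [/\ zero_free_approx G, poly_approx E G & poly_approx E (fun z => (G z)^-1)].

Lemma nonvanishing_near1 F : poly_approx E F ->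
  (forall z, E z -> cabs (F z - 1) <= 1 / 16) -> nonvanishing_approx F.
Proof.
move=> paF HF; split => //; first exact: zero_free_approx_near1.
apply: (@poly_approx_ext _ _ (fun z => (1 - (1 - F z))^-1)).
  by move=> z _; rewrite subKr.
apply: (@poly_approx_inv1B _ _ E1 _ (1 / 16)) => //; first by lra.
  apply: (@poly_approx_ext _ _ (fun z => 1 + (-1) * F z)).
    by move=> z _; rewrite mulN1r.
  apply: poly_approxD; first exact: poly_approx_const.
  by apply: poly_approxM => //; exact: poly_approx_const.
by move=> z Ez; rewrite cabs_distC HF.
Qed.

Lemma nonvanishingM G F : nonvanishing_approx G -> nonvanishing_approx F ->
  nonvanishing_approx (fun z => G z * F z).
Proof.
move=> [zG pG iG] [zF pF iF]; split; [exact: zero_free_approxMpa|exact: poly_approxM|].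
apply: (@poly_approx_ext _ _ (fun z => (G z)^-1 * (F z)^-1)).
  by move=> z _; rewrite invfM.
exact: poly_approxM.
Qed.

Lemma nonvanishing_ext G F : (forall z, E z -> G z = F z) ->
  nonvanishing_approx G -> nonvanishing_approx F.
Proof.
move=> GF [zG pG iG]; split.
- exact: zero_free_approx_ext zG.
- exact: poly_approx_ext pG.
by apply: poly_approx_ext iG => z Ez; rewrite GF.
Qed.

(** The segment is cut into [m] equal steps. Its distance [c] from 0 bounds the denominators, so
    consecutive quotients are within [1 / 16] of 1 and [nonvanishing_near1] applies to each. *)
Lemma nonvanishing_segment G0 G1 (c : R) : 0 < c ->
  nonvanishing_approx G0 -> poly_approx E G1 ->
  (forall t z, 0 <= t -> t <= 1 -> E z -> c <= cabs (G0 z + realc t * (G1 z - G0 z))) ->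
  nonvanishing_approx G1.
Proof.
move=> c0 nG0 pG1 H; have [_ pG0 _] := nG0.
pose D z := G1 z - G0 z.
have pD : poly_approx E D.
  apply: (@poly_approx_ext _ _ (fun z => G1 z + (-1) * G0 z)).
    by move=> z _; rewrite mulN1r.
  by apply: poly_approxD => //; apply: poly_approxM => //; exact: poly_approx_const.
have [B B0 HB] := poly_approx_bounded E1 pD.
(* A step moves by at most [B / m], and $B/(mc) \le 1/16$. *)
pose m := (Num.trunc (16 * B / c)).+1.
have m0 : 0 < m%:R :> R by [].
have Bm : 16 * B <= m%:R * c.
  have h0 : 0 <= 16 * B / c by rewrite divr_ge0 ?mulr_ge0 // ltW.
  have /andP[_ /ltW] := truncn_itv h0; rewrite -/m.
  by rewrite ler_pdivrMr.
pose g (j : nat) z := G0 z + realc (j%:R / m%:R) * D z.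
have t1 j : (j <= m)%N -> 0 <= j%:R / m%:R :> R /\ j%:R / m%:R <= 1 :> R.
  by move=> jm; rewrite divr_ge0 // ler_pdivrMr // mul1r ler_nat.
have gc j z : (j <= m)%N -> E z -> c <= cabs (g j z) by move=> /t1[? ?] Ez; exact: H.
have ng j : (j <= m)%N -> nonvanishing_approx (g j).
  elim: j => [_|j IH jm].
    by apply: nonvanishing_ext nG0 => z _; rewrite /g mul0r /realc rmorph0 mul0r addr0.
  have {}IH := IH (ltnW jm).
  have [_ _ iG] := IH.
  have g0 z : E z -> g j z != 0.
    by move=> Ez; rewrite -cabs_gt0 (lt_le_trans c0) // gc // ltnW.
  pose F z := 1 + realc m%:R^-1 * (D z * (g j z)^-1).
  have gS z : g j.+1 z = g j z + realc m%:R^-1 * D z.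
    by rewrite /g -natr1 mulrDl mul1r /realc rmorphD mulrDl addrA.
  apply: (@nonvanishing_ext (fun z => g j z * F z)).
    by move=> z Ez; rewrite gS /F mulrDr mulr1 [X in _ + X]mulrCA [g j z * _]mulrC divfK ?g0.
  apply: nonvanishingM => //; apply: nonvanishing_near1.
    apply: poly_approxD; first exact: poly_approx_const.
    by apply: poly_approxM => //; [exact: poly_approx_const|exact: poly_approxM].
  move=> z Ez; rewrite /F addrAC subrr add0r !cabsM cabsV cabs_realc ?invr_ge0 //.
  rewrite mulrA ler_pdivrMr ?cabs_gt0 ?g0 // mulrC ler_pdivrMr //.
  have := HB z Ez; have := gc j z (ltnW jm) Ez.
  move: Bm; move: (m%:R : R) m0 (cabs (D z)) (cabs (g j z)) => M M0 x y HM cy xB.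
  have : M * c <= M * y by rewrite ler_pM2l.
  lra.
have [_ t11] := t1 m (leqnn m).
apply: nonvanishing_ext (ng m (leqnn m)) => z _.
by rewrite /g divff ?gt_eqF // /realc rmorph1 mul1r addrC subrK.
Qed.

Lemma nonvanishing1 : nonvanishing_approx (fun=> 1).
Proof.
apply: nonvanishing_near1; first exact: poly_approx_const.
by move=> z _; rewrite subrr cabs0; lra.
Qed.

(** The segment from 1 to a nonzero number of nonnegative real part avoids 0. Any nonzero constant
    is the square of such a number, one of its two square roots. *)
Lemma nonvanishing_const (c : C) : c != 0 -> nonvanishing_approx (fun=> c).
Proof.
have half (d : C) : d != 0 -> 0 <= Re d -> nonvanishing_approx (fun=> d).
  move=> d0 Rd.
  pose m := Num.min 1 (cabs d); have m0 : 0 < m by rewrite lt_min ltr01 cabs_gt0.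
  have m1 : m ^+ 2 <= 1 by rewrite exprn_ile1 ?(ltW m0) // ge_min lexx.
  have md : m ^+ 2 <= Re d ^+ 2 + Im d ^+ 2.
    rewrite -sqmodE /sqmod lerXn2r ?nnegrE ?cabs_ge0 ?(ltW m0) //.
    by rewrite ge_min lexx orbT.
  (* For nonnegative real part, $|1 - t + t d|^2 \ge (1-t)^2 + t^2 |d|^2 \ge m^2 ((1-t)^2 + t^2) \ge
     m^2/2$. *)
  apply: (@nonvanishing_segment _ _ (m / 2)) nonvanishing1 _ _.
  - by rewrite divr_gt0.
  - exact: poly_approx_const.
  move=> t z t0 t1 _; rewrite -(ler_pXn2r (ltn0Sn 1)) ?nnegrE ?cabs_ge0 //; last first.
    by rewrite divr_ge0 // ltW.
  rewrite -/(sqmod _) sqmodE; move: Rd md.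
  case: (d) => x y /= x0 md.
  have -> : (1 + (t * (x - 1) - 0 * (y - 0))) ^+ 2 + (0 + (t * (y - 0) + 0 * (x - 1))) ^+ 2 =
     (1 - t) ^+ 2 + 2 * ((1 - t) * t * x) + t ^+ 2 * (x ^+ 2 + y ^+ 2) by ring.
  have h1 : 0 <= (1 - t) * t * x by rewrite !mulr_ge0 // subr_ge0.
  have h2 : t ^+ 2 * m ^+ 2 <= t ^+ 2 * (x ^+ 2 + y ^+ 2) by rewrite ler_wpM2l ?sqr_ge0.
  have h3 : (1 - t) ^+ 2 * m ^+ 2 <= (1 - t) ^+ 2 * 1 by rewrite ler_wpM2l ?sqr_ge0.
  have h4 : 0 <= (2 * t - 1) ^+ 2 * m ^+ 2 by rewrite mulr_ge0 ?sqr_ge0.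
  have h5 := sqr_ge0 m.
  rewrite expr_div_n; move: h1 h2 h3 h4 h5; rewrite !expr2; nra.
move=> c0; pose d := sqrtc c.
have dd : d * d = c by rewrite -expr2 sqr_sqrtc.
have d0 : d != 0 by rewrite sqrtc_eq0.
have nd : exists2 u, u * u = c & nonvanishing_approx (fun=> u).
  have [Rd|Rd] := leP 0 (Re d); first by exists d => //; exact: half.
  exists (- d); first by rewrite mulrNN.
  by apply: half; [rewrite oppr_eq0|move: Rd; case: (d) => a b /=; lra].
case: nd => u uu nu.
by apply: nonvanishing_ext (nonvanishingM nu nu) => z _.
Qed.

(** * Linear factors and polynomials, by means of a point of the circle outside $E$ *)

Variable zeta : C.
Hypotheses (zeta1 : cabs zeta = 1) (zetaE : ~ E zeta).

Lemma gap : exists2 d : R, 0 < d & forall z, E z -> d <= cabs (z - zeta).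
Proof.
apply: contrapT => H; apply: zetaE; apply: Ecl => d d0.
apply: contrapT => H'; apply: H; exists d => // w Ew.
by rewrite leNgt; apply/negP => h; apply: H'; exists w.
Qed.

Lemma poly_approx_XsubC (a : C) : poly_approx E (fun z => z - a).
Proof.
by apply: poly_approx_ext (@poly_approx_poly _ E ('X - a%:P)) => z _; rewrite hornerXsubC.
Qed.

Lemma nonvanishing_XsubC_out (a : C) : 1 < cabs a -> nonvanishing_approx (fun z => z - a).
Proof.
move=> a1; have a0 : a != 0 by rewrite -cabs_gt0; lra.
apply: (@nonvanishing_segment (fun=> - a) _ (cabs a - 1)).
- by rewrite subr_gt0.
- by apply: nonvanishing_const; rewrite oppr_eq0.
- exact: poly_approx_XsubC.
move=> t z t0 t1 /E1 z1.
have -> : - a + realc t * (z - a - - a) = realc t * z - a by ring.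
rewrite cabs_distC.
rewrite (le_trans _ (cabs_ge_dist _ _)) // lerD2l lerN2 cabsM cabs_realc // z1 mulr1 //.
Qed.

(** The root is moved from $2\zeta$ to 0 along the ray through $\zeta$. It crosses the circle only
    at $\zeta$, which stays at distance [d] from [E]. *)
Lemma nonvanishing_X : nonvanishing_approx id.
Proof.
have [d d0 Hd] := gap.
have n2 : nonvanishing_approx (fun z => z - 2 * zeta).
  apply: nonvanishing_XsubC_out; rewrite cabsM zeta1 mulr1.
  by rewrite -[2](rmorph_nat (real_complex R)) cabs_realc //; lra.
apply: (@nonvanishing_segment _ _ (d / 2)) n2 _ _.
- by rewrite divr_gt0.
- exact: poly_approx_id.
move=> t z t0 t1 Ez; have z1 : cabs z = 1 := E1 Ez.
have -> : z - 2 * zeta + realc t * (z - (z - 2 * zeta)) = z - realc (2 - 2 * t) * zeta.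
  by rewrite /realc rmorphB rmorphM !rmorph_nat; ring.
set s := 2 - 2 * t; have s0 : 0 <= s by rewrite /s; lra.
clearbody s.
(* Either the root $s\zeta$ is at distance at least [d / 2] from the circle, or it is within [d / 2]
   of $\zeta$; both cases give the lower bound [d / 2]. *)
have b1 : `|1 - s| <= cabs (z - realc s * zeta).
  rewrite ler_norml -z1; apply/andP; split.
    rewrite lerNl opprB cabs_distC (le_trans _ (cabs_ge_dist _ _)) //.
    by rewrite cabsM zeta1 mulr1 cabs_realc.
  by rewrite (le_trans _ (cabs_ge_dist _ _)) // cabsM zeta1 mulr1 cabs_realc.
have b2 : d <= cabs (z - realc s * zeta) + `|1 - s|.
  rewrite (le_trans (Hd z Ez)) //.
  have -> : z - zeta = (z - realc s * zeta) - realc (1 - s) * zeta.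
    by rewrite /realc rmorphB rmorph1; ring.
  by rewrite (le_trans (cabsB _ _)) // cabsM zeta1 mulr1 cabs_real.
lra.
Qed.

Lemma nonvanishing_XsubC_in (a : C) : cabs a < 1 -> nonvanishing_approx (fun z => z - a).
Proof.
move=> a1; apply: (@nonvanishing_segment _ _ (1 - cabs a)) nonvanishing_X _ _.
- by rewrite subr_gt0.
- exact: poly_approx_XsubC.
move=> t z t0 t1 /E1 z1.
have -> : z + realc t * (z - a - z) = z - realc t * a by ring.
rewrite (le_trans _ (cabs_ge_dist _ _)) // z1 lerD2l lerN2 cabsM cabs_realc //.
by rewrite ler_piMl ?cabs_ge0.
Qed.

(** A root on the circle may belong to [E]; it is pushed slightly outwards, and the function is
    recovered as a limit. Only zero-free approximability, not the inverse, survives this limit. *)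
Lemma zero_free_approx_XsubC (a : C) : zero_free_approx (fun z => z - a).
Proof.
have [/nonvanishing_XsubC_in[]//|a1] := ltP (cabs a) 1.
apply: zero_free_approx_limit => e e_gt0.
have a0 : 0 < cabs a by lra.
pose d := e / cabs a; have d0 : 0 < d by rewrite divr_gt0.
exists (fun z => z - realc (1 + d) * a).
  have [] // : nonvanishing_approx (fun z => z - realc (1 + d) * a).
  apply: nonvanishing_XsubC_out; rewrite cabsM cabs_realc ?addr_ge0 ?(ltW d0) //.
  by rewrite (lt_le_trans (_ : 1 < 1 + d)) ?ltrDl // ler_peMr // addr_ge0 // ltW.
move=> z Ez; have -> : z - realc (1 + d) * a - (z - a) = - (realc d * a).
  by rewrite /realc rmorphD rmorph1; ring.
by rewrite cabsN cabsM cabs_realc ?(ltW d0) // /d divfK // gt_eqF.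
Qed.

Lemma zero_free_approx_const (c : C) : zero_free_approx (fun=> c).
Proof.
have [->|c0] := eqVneq c 0; last by have [] := nonvanishing_const c0.
apply: zero_free_approx_limit => e e_gt0; exists (fun=> realc e).
  have [] // : nonvanishing_approx (fun=> realc e).
  by apply: nonvanishing_const; rewrite -cabs_gt0 cabs_realc // ltW.
by move=> z _; rewrite subr0 cabs_realc // ltW.
Qed.

Lemma zero_free_approx_poly p : zero_free_approx (fun z => p.[z]).
Proof.
have [rs pE] := closed_field_poly_normal p.
have : zero_free_approx (fun z => (\prod_(a <- rs) ('X - a%:P)).[z]).
  elim: rs {pE} => [|a rs IH].
    by apply: zero_free_approx_ext (zero_free_approx_const 1) => z _; rewrite big_nil hornerC.
  apply: (@zero_free_approx_ext (fun z => (z - a) * (\prod_(a <- rs) ('X - a%:P)).[z])).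
    by move=> z _; rewrite big_cons hornerM hornerXsubC.
  apply: zero_free_approxMpa => //; [exact: poly_approx_XsubC|exact: poly_approx_poly|].
  exact: zero_free_approx_XsubC.
move=> H; apply: (@zero_free_approx_ext
  (fun z => lead_coef p * (\prod_(a <- rs) ('X - a%:P)).[z])).
  by move=> z _; rewrite {2}pE hornerZ.
apply: zero_free_approxMpa => //; [exact: poly_approx_const|exact: poly_approx_poly|].
exact: zero_free_approx_const.
Qed.

Lemma zero_free_approximation G : poly_approx E G -> zero_free_approx G.
Proof.
move=> pG; apply: zero_free_approx_limit => e /pG[p Hp].
by exists (fun z => p.[z]) => //; exact: zero_free_approx_poly.
Qed.

End ZeroFree.

(** * Optimal approximants of Blaschke type *)

Section Blaschke.
Variable R : realType.
Local Notation C := R[i].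
Local Notation Re := complex.Re.
Local Notation Im := complex.Im.
Local Notation "q ** a" := (polymul_coef q a) (at level 40, left associativity).
Local Notation e0 := (@one_series R).
Implicit Types (a y : nat -> C) (p q : {poly C}) (al : seq C).

Lemma act_XsubC (c : C) y : ('X - c%:P) ** y = zshift y + (- c) *: y.
Proof. by rewrite actBl actXl actCl scaleNr. Qed.

Lemma pdot_conj n (c : C) a b : pdot n a ((- c) *: b) = pdot n b ((- (c^*)%C) *: a).
Proof.
apply: eq_bigr => k _; rewrite /rdot.
have -> : ((- c) *: b) k = - c * b k by [].
have -> : ((- (c^*)%C) *: a) k = - (c^*)%C * a k by [].
by case: c (a k) (b k) => c1 c2 [a1 a2] [b1 b2] /=; ring.
Qed.

(** On truncations the isometry holds up to a boundary term: for [n > 0] the last difference is the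
    squared modulus of the coefficient [n - 1] of [y]. *)
Lemma psqnorm_reflect n (c : C) y :
  psqnorm n ((1 - (c^*)%C *: 'X) ** y) =
  psqnorm n (('X - c%:P) ** y) + (1 - sqmod c) * (psqnorm n y - psqnorm n (zshift y)).
Proof.
rewrite act_XsubC act_binomial !psqnormD !psqnorm_scale !sqmodN [pdot n (zshift y) _]pdot_conj.
by rewrite [sqmod (c^*)%C]/sqmod cabs_conj -/(sqmod c); ring.
Qed.

Lemma pnorm_reflect_le n (c : C) y : cabs c <= 1 ->
  pnorm n (('X - c%:P) ** y) <= pnorm n ((1 - (c^*)%C *: 'X) ** y).
Proof.
move=> c1; rewrite ler_wsqrtr // psqnorm_reflect lerDl mulr_ge0 // subr_ge0 ?psqnorm_shift_le //.
by rewrite exprn_ile1 ?cabs_ge0.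
Qed.

Lemma H2_term_small y : H2 y -> forall (e : R) n, 0 < e ->
  exists2 m, (n <= m)%N & sqmod (y m) < e.
Proof.
move=> /cvg_series_cvg_0 Hy e n e_gt0.
move: Hy => /cvgrPdist_lt /(_ e e_gt0)[k _ Hk].
exists (maxn n k); first exact: leq_maxl.
have := Hk _ (leq_maxr n k); rewrite /= sub0r normrN ger0_norm //; exact: sqmod_ge0.
Qed.

(** The boundary term of [psqnorm_reflect] is made smaller than any [e] by truncating at a late
    index; such indices exist because the coefficients of [y] tend to 0. *)
Lemma pnorm_reflect_ge (c : C) y (d : R) : cabs c <= 1 -> H2 y ->
  (forall m, pnorm m (('X - c%:P) ** y) <= d) ->
  forall n, pnorm n ((1 - (c^*)%C *: 'X) ** y) <= d.
Proof.
move=> c1 Hy Hd n; have d0 : 0 <= d := le_trans (pnorm_ge0 _ _) (Hd 0%N).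
rewrite -(ler_pXn2r (ltn0Sn 1)) ?nnegrE ?pnorm_ge0 // pnorm_sqr.
apply/ler_addgt0Pr => e e_gt0; have [m nm ym] := H2_term_small Hy n e_gt0.
rewrite (le_trans (psqnorm_mono _ (leqW nm))) // psqnorm_reflect psqnorm_shift.
rewrite (psqnormS m y) (addrAC (psqnorm m y)) subrr add0r lerD //.
  by rewrite -pnorm_sqr lerXn2r ?nnegrE ?pnorm_ge0.
rewrite (le_trans _ (ltW ym)) // ler_piMl ?sqmod_ge0 // gerBl; exact: sqmod_ge0.
Qed.

Definition roots_poly al : {poly C} := \prod_(c <- al) ('X - c%:P).
Definition reflected_poly al : {poly C} := \prod_(c <- al) (1 - (c^*)%C *: 'X).

Lemma pnorm_roots_le al n y : (forall c, c \in al -> cabs c < 1) ->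
  pnorm n (roots_poly al ** y) <= pnorm n (reflected_poly al ** y).
Proof.
rewrite /roots_poly /reflected_poly; elim: al y => [|c al IH] y H.
  by rewrite !big_nil.
rewrite !big_cons actM (le_trans (pnorm_reflect_le _ _ _)) //.
  by rewrite ltW // H ?mem_head.
rewrite -actM mulrC actM mulrC actM [X in _ <= X]/=.
by rewrite (le_trans (IH _ _)) // => d dal; rewrite H // in_cons dal orbT.
Qed.

Lemma pnorm_roots_ge al y (d : R) : (forall c, c \in al -> cabs c < 1) -> H2 y ->
  (forall m, pnorm m (roots_poly al ** y) <= d) ->
  forall n, pnorm n (reflected_poly al ** y) <= d.
Proof.
rewrite /roots_poly /reflected_poly; elim: al y => [|c al IH] y H Hy.
  by rewrite !big_nil.
rewrite !big_cons => Hd n; rewrite mulrC actM; apply: IH.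
- by move=> b bal; rewrite H // in_cons bal orbT.
- exact: H2_act.
move=> m; rewrite -actM mulrC actM; apply: pnorm_reflect_ge.
- by rewrite ltW // H ?mem_head.
- exact: H2_act.
by move=> k; rewrite -actM.
Qed.

(** Each factor $1 - \bar c z$ is bounded below by $1 - |c|$, the shift being a contraction. This
    gives membership in $H^2$ after division by the reflected polynomial. *)
Lemma reflected_bounded_below al : (forall c, c \in al -> cabs c < 1) ->
  exists2 d : R, 0 <= d & forall n y, pnorm n y <= d * pnorm n (reflected_poly al ** y).
Proof.
rewrite /reflected_poly; elim: al => [|c al IH] H.
  by exists 1 => // n y; rewrite big_nil act1l mul1r.
have [|d d0 Hd] := IH; first by move=> b bal; rewrite H // in_cons bal orbT.
have c1 : 0 < 1 - cabs c by rewrite subr_gt0 H ?mem_head.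
exists (d / (1 - cabs c)) => [|n y]; first by rewrite divr_ge0 // ltW.
rewrite (le_trans (Hd n y)) // -mulrA ler_wpM2l // big_cons actM.
set x := _ ** y; rewrite mulrC ler_pdivlMr // mulrBr mulr1 lerBlDr.
have xE : x = (1 - (c^*)%C *: 'X) ** x + (c^*)%C *: zshift x.
  by rewrite act_binomial scaleNr subrK.
rewrite {1}xE (le_trans (pnorm_triangle _ _ _)) // lerD2l pnorm_scale cabs_conj mulrC.
by rewrite ler_wpM2r ?cabs_ge0 ?pnorm_shift_le.
Qed.

Lemma reflected_coef0 al : (reflected_poly al)`_0 = 1.
Proof.
rewrite /reflected_poly; elim: al => [|c al IH]; first by rewrite big_nil coef1.
by rewrite big_cons coefM big_ord1 IH coefB coef1 coefZ coefX mulr0 subr0 mulr1.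
Qed.

Lemma pdot_one n a : pdot n.+1 a e0 = Re (a 0%N).
Proof.
rewrite /pdot big_ord_recl big1 ?addr0 /rdot /=; first by rewrite mulr1 mulr0 addr0.
by move=> i _; rewrite !mulr0 addr0.
Qed.

(* The isometry [|P y| = |P^* y|] turns [|Q f - 1|^2] into
   [|y|^2 - 2 Re(P(0) y(0)) + 1] with [y = Q P^* u], minimal for the constant
   [y = conj (P(0))]. *)
Lemma opa_blaschke al q u n : (forall c, c \in al -> cabs c < 1) ->
  (reflected_poly al * q) ** u = e0 -> H2 u -> (size q <= n.+1)%N ->
  is_opa (roots_poly al ** u) n (((roots_poly al)`_0)^*%C *: q).
Proof.
move=> al1 qu Hu qn; set P := roots_poly al; set b := P`_0; split.
  by rewrite (leq_trans (size_scale_leq _ _)).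
(* The two norms are compared through $\sqrt{1 - |P(0)|^2}$, the distance from 1 to the multiples of
   [f]. *)
move=> q' _; apply: (@le_trans _ _ (Num.sqrt (1 - sqmod b))).
  apply: h2norm_le => -[|n']; first by rewrite /pnorm /psqnorm big_ord0 sqrtr0 sqrtr_ge0.
  rewrite ler_wsqrtr // opa_residualE actZl -actM mulrC actM.
  set g := P ** (q ** u).
  have Pq : reflected_poly al ** (q ** u) = e0 by rewrite -actM.
  have g1 : psqnorm n'.+1 g <= 1.
    rewrite -pnorm_sqr exprn_ile1 ?pnorm_ge0 // (le_trans (pnorm_roots_le _ _ al1)) // Pq.
    exact: pnorm_one_le.
  have g0 : g 0%N = b.
    have := congr1 (fun y => y 0%N) Pq; rewrite /g !act_at0 reflected_coef0 mul1r => ->.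
    by rewrite mulr1.
  have -> : (b^*)%C *: g - e0 = (-1) *: e0 + (b^*)%C *: g.
    by rewrite scaleN1r addrC.
  rewrite psqnormD !psqnorm_scale sqmodN -[psqnorm _ e0]pnorm_sqr pnorm_one [sqmod 1]/sqmod cabs1.
  have -> : pdot n'.+1 ((-1) *: e0) ((b^*)%C *: g) = - sqmod b.
    rewrite /pdot big_ord_recl big1 ?addr0 => [|i _].
      rewrite -[((b^*)%C *: g) _]/((b^*)%C * g 0%N) g0 mulrC mul_conjC.
      by rewrite -[((-1) *: e0) _]/(-1 * 1) /rdot /=; ring.
    by rewrite -[((-1) *: e0) _]/(-1 * 0) mulr0 /rdot /= !mul0r addr0.
  rewrite [sqmod (b^*)%C]/sqmod cabs_conj -/(sqmod b).
  have : sqmod b * psqnorm n'.+1 g <= sqmod b * 1 by rewrite ler_wpM2l ?sqmod_ge0.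
  lra.
have Hf : H2 (P ** u) by exact: H2_act.
have HP m : pnorm m.+1 (q' ** (P ** u) - e0) <= h2norm (opa_residual q' (P ** u)).
  by rewrite -opa_residualE pnorm_le_h2norm //; exact: H2_residual.
set c := h2norm _ in HP *; have c0 : 0 <= c by exact: h2norm_ge0.
rewrite -(ger0_norm c0) -sqrtr_sqr ler_wsqrtr //.
set y := q' ** u.
have qP : q' ** (P ** u) = P ** y by rewrite /y -!actM mulrC.
(* Expanding $|P y - 1|^2 \le c^2$ bounds $|P y|^2$ by this number, uniformly in the truncation. *)
pose d := c ^+ 2 + 2 * Re (b * y 0%N) - 1.
have Hd m : psqnorm m (P ** y) <= d.
  rewrite (le_trans (psqnorm_mono _ (leqnSn m))) //.
  have := HP m; rewrite qP -(ler_pXn2r (ltn0Sn 1)) ?nnegrE ?pnorm_ge0 // pnorm_sqr.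
  have -> : psqnorm m.+1 (P ** y - e0) = psqnorm m.+1 (P ** y) - 2 * Re (b * y 0%N) + 1.
    have -> : P ** y - e0 = P ** y + (realc (-1)) *: e0.
      by rewrite /realc rmorphN rmorph1 scaleN1r.
    rewrite psqnormD pdot_scale pdot_one act_at0 psqnorm_scale sqmod_real.
    rewrite -[psqnorm _ e0]pnorm_sqr pnorm_one.
    by rewrite -/b; ring.
  rewrite /d; lra.
have d0 : 0 <= d := le_trans (psqnorm_ge0 _ _) (Hd 0%N).
have Hs m : pnorm m (P ** y) <= Num.sqrt d by rewrite ler_wsqrtr.
(* Only the constant coefficient of the reflected product is kept: $|y(0)|^2 \le d$, that is $c^2
   \ge 1 - |b|^2 + |\bar b - y(0)|^2$. *)
have := pnorm_roots_ge al1 (H2_act (p := q') Hu) Hs 1%N.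
rewrite -(ler_pXn2r (ltn0Sn 1)) ?nnegrE ?pnorm_ge0 ?sqrtr_ge0 // pnorm_sqr sqr_sqrtr //.
rewrite /psqnorm big_ord1 -/y act_at0 reflected_coef0 mul1r /d => H.
have := sqmod_ge0 ((b^*)%C - y 0%N); move: H; rewrite !sqmodE.
by case: (b) (y 0%N) => b1 b2 [y1 y2] /=; nra.
Qed.

End Blaschke.

(** * Density *)

Section Density.
Variable R : realType.
Local Notation C := R[i].
Local Notation Re := complex.Re.
Local Notation Im := complex.Im.
Local Notation "q ** a" := (polymul_coef q a) (at level 40, left associativity).
Local Notation e0 := (@one_series R).
Implicit Types (a y : nat -> C) (p q : {poly C}) (al : seq C).

Lemma poly_dense y (e : R) : H2 y -> 0 < e ->
  exists p, forall m, pnorm m (p ** e0 - y) <= e.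
Proof.
move=> Hy e_gt0.
have cy : series (fun k => sqmod (y k)) @ \oo --> limn (series (fun k => sqmod (y k))) by [].
have up n : psqnorm n y <= limn (series (fun k => sqmod (y k))).
  rewrite psqnorm_series; apply: nondecreasing_cvgn_le => //.
  by apply: nondecreasing_series => k _ _; exact: sqmod_ge0.
move: cy up; set L := limn _.
move=> /cvgrPdist_lt /(_ _ (exprn_gt0 2 e_gt0))[n _ /(_ n (leqnn n))] /=.
rewrite -psqnorm_series ltr_norml => /andP[_ Ln] up.
exists (\poly_(i < n) y i) => m.
rewrite -(ler_pXn2r (ltn0Sn 1)) ?nnegrE ?pnorm_ge0 ?(ltW e_gt0) // pnorm_sqr.
suff H k : psqnorm (n + k) (\poly_(i < n) y i ** e0 - y) = psqnorm (n + k) y - psqnorm n y.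
  rewrite (le_trans (psqnorm_mono _ (leq_addl n m))) // H (le_trans _ (ltW Ln)) //.
  by rewrite lerD2r up.
have yk i : (\poly_(i < n) y i ** e0 - y) i = if (i < n)%N then 0 else - y i.
  rewrite -[LHS]/((\poly_(i < n) y i ** e0) i - y i) act_one coef_poly.
  by case: ifP; rewrite ?subrr ?sub0r.
elim: k => [|k IH].
  rewrite addn0 subrr /psqnorm big1 // => i _; rewrite yk ltn_ord; exact: sqmod0.
rewrite addnS !psqnormS IH yk ltnNge leq_addr /= sqmodN; ring.
Qed.

Lemma l1_XsubC (c : C) : l1 ('X - c%:P) <= 1 + cabs c.
Proof. by rewrite (le_trans (l1B _ _)) // l1X l1C. Qed.

Lemma perturb_root (c : C) (e : R) : 0 < e ->
  exists c', [/\ c' != 0, cabs c' != 1 & cabs (c - c') <= e].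
Proof.
move=> e_gt0.
have [->|c0] := eqVneq c 0.
  pose t := Num.min e (1 / 2); have t0 : 0 < t by rewrite lt_min e_gt0 /=; lra.
  have te : t <= e by rewrite ge_min lexx.
  have t2 : t <= 1 / 2 by rewrite ge_min lexx orbT.
  exists (realc t); rewrite -cabs_gt0 sub0r cabsN cabs_realc ?(ltW t0) //; split => //.
  by rewrite lt_eqF //; lra.
have [c1|c1] := eqVneq (cabs c) 1; last by exists c; split; rewrite ?subrr ?cabs0 ?ltW.
exists (realc (1 + e) * c).
have H : cabs (realc (1 + e) * c) = 1 + e by rewrite cabsM c1 mulr1 cabs_realc //; lra.
split; first by rewrite -cabs_gt0 H; lra.
  by rewrite H gt_eqF //; lra.
have -> : c - realc (1 + e) * c = - (realc e * c) by rewrite /realc rmorphD rmorph1; ring.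
by rewrite cabsN cabsM c1 mulr1 cabs_realc // ltW.
Qed.

(** Roots off the circle make the factors invertible after reflection of the inner ones; roots
    different from 0 keep $P(0) \ne 0$, without which the optimal approximant $\overline{P(0)}\, q$
    would vanish. *)
Definition generic_poly p : Prop := exists (c : C) (al be : seq C),
  [/\ c != 0, forall v, v \in al -> v != 0 /\ cabs v < 1,
      forall v, v \in be -> 1 < cabs v & p = c *: (roots_poly al * roots_poly be)].

Lemma generic_polyZ (c : C) p : c != 0 -> generic_poly p -> generic_poly (c *: p).
Proof.
move=> c0 [d [al [be [d0 H1 H2 ->]]]]; exists (c * d), al, be; split => //.
  by rewrite mulf_neq0.
by rewrite scalerA.
Qed.

Lemma generic_polyX p (c : C) : c != 0 -> cabs c != 1 -> generic_poly p ->
  generic_poly (('X - c%:P) * p).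
Proof.
move=> c0 c1 [d [al [be [d0 H1 H2 ->]]]].
have [cl|cg|/eqP] := ltgtP (cabs c) 1; last by rewrite (negPf c1).
  exists d, (c :: al), be; split => //.
    by move=> a; rewrite in_cons => /orP[/eqP -> //|]; exact: H1.
  by rewrite /roots_poly big_cons -scalerAr mulrA.
exists d, al, (c :: be); split => //.
  by move=> a; rewrite in_cons => /orP[/eqP -> //|]; exact: H2.
by rewrite /roots_poly big_cons -scalerAr mulrCA.
Qed.

Lemma generic_dense p (e : R) : 0 < e -> exists2 r, generic_poly r & l1 (p - r) <= e.
Proof.
have gen1 : generic_poly 1.
  by exists 1, [::], [::]; split; rewrite ?oner_neq0 // /roots_poly !big_nil mulr1 scale1r.
have monic rs : forall e : R, 0 < e ->
    exists2 r, generic_poly r & l1 (\prod_(z <- rs) ('X - z%:P) - r) <= e.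
  elim: rs => [|z rs IH] d d0; first by exists 1; rewrite // big_nil subrr l10 ltW.
  have h1 : 0 < 1 + cabs z by rewrite ltr_pwDl ?cabs_ge0.
  have [|r gr Hr] := IH (d / (2 * (1 + cabs z))); first by rewrite divr_gt0 // mulr_gt0.
  have h2 : 0 < l1 r + 1 by rewrite ltr_wpDl ?l1_ge0.
  have [|z' [z'0 z'1 zz]] := @perturb_root z (d / (2 * (l1 r + 1))).
    by rewrite divr_gt0 // mulr_gt0.
  exists (('X - z'%:P) * r); first exact: generic_polyX.
  rewrite big_cons; set p' := \prod_(_ <- _) _ in Hr *.
  (* Roots are perturbed one at a time. The product [r] for the remaining ones is fixed first, so
     the displacement of [z] may depend on [l1 r]. *)
  have -> : ('X - z%:P) * p' - ('X - z'%:P) * r = ('X - z%:P) * (p' - r) - (z - z')%:P * r.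
    by rewrite polyCB; ring.
  rewrite (le_trans (l1B _ _)) // (splitr d) lerD //.
    rewrite (le_trans (l1M _ _)) //.
    have -> : d / 2 = (1 + cabs z) * (d / (2 * (1 + cabs z))) by field; rewrite gt_eqF.
    by rewrite ler_pM ?l1_ge0 ?l1_XsubC.
  rewrite (le_trans (l1M _ _)) // l1C.
  have -> : d / 2 = (d / (2 * (l1 r + 1))) * (l1 r + 1) by field; rewrite gt_eqF.
  by rewrite ler_pM ?l1_ge0 ?cabs_ge0 // lerDl.
move=> e_gt0; have [p0|p0] := eqVneq p 0.
  have ce : realc e != 0 by rewrite -cabs_gt0 cabs_realc // ltW.
  exists (realc e *: 1); first exact: generic_polyZ.
  by rewrite p0 sub0r l1N l1Z l11 mulr1 cabs_realc // ltW.
have [rs pE] := closed_field_poly_normal p.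
have lc0 : lead_coef p != 0 by rewrite lead_coef_eq0.
have lc : 0 < cabs (lead_coef p) by rewrite cabs_gt0.
have [|r gr Hr] := monic rs (e / cabs (lead_coef p)); first by rewrite divr_gt0.
exists (lead_coef p *: r); first exact: generic_polyZ.
by rewrite {1}pE -scalerBr l1Z mulrC -ler_pdivlMr.
Qed.

(** Invertibility in the Wiener algebra, expressed through polynomial approximate inverses so that
    no infinite series is handled. *)
Definition l1_invertible p : Prop := forall e : R, 0 < e -> exists q, l1 (q * p - 1) <= e.

Lemma l1_invertibleM p q : l1_invertible p -> l1_invertible q -> l1_invertible (p * q).
Proof.
move=> Hp Hq e e_gt0; pose d := Num.min 1 (e / 3).
have d0 : 0 < d by rewrite lt_min ltr01 divr_gt0.
have d1 : d <= 1 by rewrite ge_min lexx.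
have de : d <= e / 3 by rewrite ge_min lexx orbT.
have [p' Hp'] := Hp d d0; have [q' Hq'] := Hq d d0; exists (p' * q').
have -> : p' * q' * (p * q) - 1 =
  (p' * p - 1) * (q' * q - 1) + (p' * p - 1) + (q' * q - 1) by ring.
rewrite (le_trans (l1D _ _)) // (le_trans (lerD (l1D _ _) (lexx _))) //.
have : l1 ((p' * p - 1) * (q' * q - 1)) <= 1 * d.
  by rewrite (le_trans (l1M _ _)) // ler_pM ?l1_ge0 // (le_trans Hp').
lra.
Qed.

Lemma l1_invertible_const (c : C) : c != 0 -> l1_invertible c%:P.
Proof.
move=> c0 e e_gt0; exists (c^-1)%:P.
by rewrite -polyCM mulVf // polyC1 subrr l10 ltW.
Qed.

Lemma l1_invertible_1subX (c : C) : cabs c < 1 -> l1_invertible (1 - c *: 'X).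
Proof.
move=> c1 e e_gt0; have [n Hn] := expr_small (cabs_ge0 c) c1 e_gt0.
exists (geo c n); rewrite mulrC geoE addrAC subrr add0r l1N l1Z cabsX.
have -> : l1 'X^n = 1 :> R; last by rewrite mulr1.
elim: n {Hn} => [|n IH]; first by rewrite expr0 l11.
by rewrite exprS l1XM.
Qed.

Lemma l1_invertible_XsubC (c : C) : 1 < cabs c -> l1_invertible ('X - c%:P).
Proof.
move=> c1; have c0 : c != 0 by rewrite -cabs_gt0; lra.
have -> : 'X - c%:P = (- c)%:P * (1 - c^-1 *: 'X).
  rewrite mul_polyC scalerBr scalerA mulNr mulfV // scaleN1r opprK addrC.
  by rewrite scaleNr alg_polyC addrC.
apply: l1_invertibleM; first by apply: l1_invertible_const; rewrite oppr_eq0.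
by apply: l1_invertible_1subX; rewrite cabsV invf_lt1 //; lra.
Qed.

Lemma l1_invertible_prod (I : eqType) (r : seq I) (F : I -> {poly C}) :
  (forall i, i \in r -> l1_invertible (F i)) -> l1_invertible (\prod_(i <- r) F i).
Proof.
elim: r => [|i r IH] H.
  by rewrite big_nil -[1]polyC1; apply: l1_invertible_const; rewrite oner_neq0.
rewrite big_cons; apply: l1_invertibleM; first by apply: H; rewrite mem_head.
by apply: IH => j jr; apply: H; rewrite in_cons jr orbT.
Qed.

Variable E : set C.
Hypothesis E1 : E `<=` @unit_circle R.
Hypothesis Ecov : thin_cover E.
Hypothesis Ecl : closed_in_C E.
Variable zeta : C.
Hypotheses (zeta1 : cabs zeta = 1) (zetaE : ~ E zeta).

(** With [D = Ps * Bc], the inequality $|P y| \le |P^* y|$ bounds the distance from [f = P ** u] to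
    [p = P * Bc] by that from $s = P^* u = 1/(q_0 q_1)$ to [D]. Here $q_0$ nearly inverts [D], and
    $q_1$ corrects the values on [E] while $1/q_1$ stays near 1. *)
Lemma opa_dense_generic p (e d : R) (g : C -> C) (k : nat) :
  generic_poly p -> 0 < e -> 0 < d -> poly_approx E g ->
  exists f n Q, [/\ H2 f, f 0%N != 0, forall m, pnorm m (f - p ** e0) <= e,
    (k <= n)%N & is_opa f n Q /\ forall z, E z -> cabs (Q.[z] - g z) <= d].
Proof.
move=> [c [al [be [c0 Hal Hbe pE]]]] e_gt0 d_gt0 pg.
have al1 v : v \in al -> cabs v < 1 by case/Hal.
pose P := roots_poly al; pose Ps := reflected_poly al; pose b := P`_0.
have b0 : b != 0.
  have : forall v, v \in al -> v != 0 by move=> v /Hal[].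
  rewrite /b /P /roots_poly; elim: al {Hal al1 pE P Ps b} => [|a al IH] H.
    by rewrite big_nil coef1 oner_neq0.
  rewrite big_cons coefM big_ord1 mulf_neq0 //.
    by rewrite coefB coefX coefC sub0r oppr_eq0 H ?mem_head.
  by apply: IH => v vl; apply: H; rewrite in_cons vl orbT.
have cb0 : 0 < cabs b by rewrite cabs_gt0.
pose Bc := c%:P * roots_poly be; pose D := Ps * Bc.
have pPB : p = P * Bc by rewrite pE -mul_polyC mulrCA.
have Dinv : l1_invertible D.
  apply: l1_invertibleM.
    apply: l1_invertible_prod => a /al1 a1.
    by apply: l1_invertible_1subX; rewrite cabs_conj.
  apply: l1_invertibleM; first exact: l1_invertible_const.
  by apply: l1_invertible_prod => v /Hbe; exact: l1_invertible_XsubC.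
have D1 : 0 < l1 D + 1 by rewrite ltr_wpDl ?l1_ge0.
(* The bound [1 / 2] keeps $q_0 D$ away from 0 at the origin and on [E]; the other one makes the
   total error, at most $5\, e_1$ times [l1 D], smaller than [e]. *)
pose e1 := Num.min (1 / 2) (e / (8 * (l1 D + 1))).
have e10 : 0 < e1 by rewrite lt_min divr_gt0 ?ltr01 //= divr_gt0 // mulr_gt0.
have e1h : e1 <= 1 / 2 by rewrite ge_min lexx.
have e1e : e1 * (l1 D + 1) <= e / 8.
  have : e1 <= e / (8 * (l1 D + 1)) by rewrite ge_min lexx orbT.
  by rewrite ler_pdivlMr ?mulr_gt0 // ler_pdivlMr // mulrA mulrAC mulrC.
clearbody e1.
have [q0 Hq0] := Dinv e1 e10.
have q00 : q0`_0 != 0.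
  apply/eqP => q00; have := @cabs_horner _ (q0 * D - 1) 0.
  rewrite cabs0 hornerD hornerM hornerN hornerC horner_coef0 q00 mul0r sub0r cabsN cabs1.
  by move=> /(_ ler01); have := le_trans Hq0 e1h; lra.
have q0z z : E z -> cabs (1 - (q0 * D).[z]) <= 1 / 2.
  move=> Ez; have := cabs_horner_E E1 (q0 * D - 1) Ez.
  rewrite hornerD hornerN hornerC cabs_distC => h.
  by rewrite (le_trans h) // (le_trans Hq0).
have q0Dz z : E z -> (q0 * D).[z] != 0.
  move=> Ez; apply/eqP => h; have := q0z z Ez; rewrite h subr0 cabs1; lra.
have q0z0 z : E z -> q0.[z] != 0.
  by move=> /q0Dz; rewrite (hornerM q0) mulf_eq0 negb_or => /andP[].
have paq0 : poly_approx E (fun z => (q0.[z])^-1).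
  apply: (@poly_approx_ext _ _ (fun z => D.[z] * (1 - (1 - (q0 * D).[z]))^-1)).
    move=> z Ez; rewrite subKr (hornerM q0) invfM mulrCA mulfV ?mulr1 //.
    by have := q0Dz z Ez; rewrite (hornerM q0) mulf_eq0 negb_or => /andP[].
  apply: poly_approxM => //; first exact: poly_approx_poly.
  apply: (@poly_approx_inv1B _ _ E1 _ (1 / 2)) => //; first by lra.
  apply: poly_approx_ext (@poly_approx_poly _ E (1 - q0 * D)) => z _.
  by rewrite !hornerE.
have l10' : 0 < l1 q0 + 1 by rewrite ltr_wpDl ?l1_ge0.
(* The 1 yields $|s_1| \le 2$, [e1] enters the $H^2$ estimate, and the last bound absorbs the factor
   $\bar b q_0$ that multiplies the error on [E]. *)
pose e2 := Num.min (Num.min 1 e1) (d / (cabs b * (l1 q0 + 1))).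
have e20 : 0 < e2 by rewrite !lt_min ltr01 e10 /= divr_gt0 // mulr_gt0.
have e21 : e2 <= 1 by rewrite !ge_min lexx.
have e2e1 : e2 <= e1 by rewrite !ge_min lexx !orbT.
have e2d : cabs b * (l1 q0 + 1) * e2 <= d.
  have : e2 <= d / (cabs b * (l1 q0 + 1)) by rewrite !ge_min lexx !orbT.
  by rewrite ler_pdivlMr ?mulr_gt0 // mulrC.
have paG : poly_approx E (fun z => ((b^*)%C)^-1 * g z * (q0.[z])^-1).
  apply: poly_approxM => //; apply: poly_approxM => //; exact: poly_approx_const.
have [q1 [c1 [q10 c10 Hc1 Hs1 Hq1]]] :=
  zero_free_approximation E1 Ecov Ecl zeta1 zetaE paG e20.
have [u Hu] : exists u, (Ps * (q0 * q1)) ** u = e0.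
  apply: act_inverse; rewrite coefM big_ord1 subnn reflected_coef0 mul1r coefM big_ord1.
  by rewrite mulf_neq0.
pose s := Ps ** u; pose s1 := q0 ** s.
have q1s1 : q1 ** s1 = e0 by rewrite /s1 /s -!actM -Hu; congr (_ ** _); ring.
have s1e m : pnorm m (s1 - e0) <= e2 by exact: Hs1.
have s12 m : pnorm m s1 <= 2.
  rewrite -(subrK e0 s1) (le_trans (pnorm_triangle _ _ _)) //.
  by have := s1e m; have := @pnorm_one_le R m; lra.
(* Here $s_1 = q_0 s = 1/q_1$. Writing $s = D s_1 - (q_0 D - 1) s$ turns the approximate inverse
   into a bound for [s], as the last term is at most half of [s]. *)
have sE : s = D ** s1 - (q0 * D - 1) ** s.
  by rewrite actBl act1l /s1 -actM mulrC opprB addrC subrK.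
have sD m : pnorm m s <= 4 * (l1 D).
  have := pnorm_triangleB m (D ** s1) ((q0 * D - 1) ** s); rewrite -sE.
  have : pnorm m (D ** s1) <= l1 D * 2.
    by rewrite (le_trans (pnorm_act _ _ _)) // ler_wpM2l ?l1_ge0.
  have : pnorm m ((q0 * D - 1) ** s) <= 1 / 2 * pnorm m s.
    by rewrite (le_trans (pnorm_act _ _ _)) // ler_wpM2r ?pnorm_ge0 // (le_trans Hq0).
  lra.
have HN m : pnorm m (s - D ** e0) <= e.
  have -> : s - D ** e0 = D ** (s1 - e0) - (q0 * D - 1) ** s.
    by rewrite {1}sE actBr addrAC.
  rewrite (le_trans (pnorm_triangleB _ _ _)) //.
  have : pnorm m (D ** (s1 - e0)) <= l1 D * e1.
    by rewrite (le_trans (pnorm_act _ _ _)) // ler_wpM2l ?l1_ge0 // (le_trans (s1e m)).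
  have : pnorm m ((q0 * D - 1) ** s) <= e1 * (4 * l1 D).
    by rewrite (le_trans (pnorm_act _ _ _)) // ler_pM ?l1_ge0 ?pnorm_ge0.
  move: e1e; lra.
have H2u : H2 u.
  have [dd dd0 Hdd] := reflected_bounded_below al1.
  apply/H2P; exists (dd * (4 * l1 D)) => m.
  by rewrite (le_trans (Hdd m u)) // ler_wpM2l // sD.
(* The optimal approximants no longer change once the degree reaches that of $q_0 q_1$, so the
   degree can be taken beyond any [k]. *)
exists (P ** u), (maxn k (size (q0 * q1))), ((b^*)%C *: (q0 * q1)); split.
- exact: H2_act.
- rewrite act_at0 mulf_neq0 //; apply/eqP => u0.
  have := congr1 (fun y => y 0%N) Hu; rewrite act_at0 u0 mulr0 => /esym/eqP.
  by rewrite oner_eq0.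
- move=> m; rewrite pPB actM -actBr (le_trans (pnorm_roots_le _ _ al1)) //.
  by rewrite actBr -[reflected_poly al ** (_ ** _)]actM HN.
- exact: leq_maxl.
split.
  apply: opa_blaschke => //.
  by rewrite (leq_trans (leq_maxr k _)) // leqnSn.
move=> z Ez; have bz : (b^*)%C != 0 by rewrite -cabs_eq0 cabs_conj cabs_eq0.
have -> : ((b^*)%C *: (q0 * q1)).[z] - g z =
   (b^*)%C * q0.[z] * (q1.[z] - ((b^*)%C)^-1 * g z * (q0.[z])^-1).
  by rewrite hornerZ hornerM; field; rewrite bz q0z0.
rewrite !cabsM cabs_conj (le_trans _ e2d) // ler_pM ?mulr_ge0 ?cabs_ge0 ?Hq1 //.
rewrite ler_wpM2l ?cabs_ge0 // (le_trans (cabs_horner_E E1 _ Ez)) // lerDl //.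
Qed.

Lemma opa_dense f0 (e d : R) (g : C -> C) (k : nat) :
  H2 f0 -> 0 < e -> 0 < d -> poly_approx E g ->
  exists f n Q, [/\ H2 f, f 0%N != 0, h2norm (f - f0) <= e,
    (k <= n)%N & is_opa f n Q /\ forall z, E z -> cabs (Q.[z] - g z) <= d].
Proof.
move=> Hf0 e_gt0 d_gt0 pg; have e3 : 0 < e / 3 by rewrite divr_gt0.
have [p Hp] := poly_dense Hf0 e3.
have [r gr pr] := generic_dense p e3.
have [f [n [Q [Hf f00 Hfr kn HQ]]]] := opa_dense_generic k gr e3 d_gt0 pg.
exists f, n, Q; split => //; apply: h2norm_le => m.
rewrite -(subrKA (r ** e0)) (le_trans (pnorm_triangle _ _ _)) //.
have h1 := pnorm_triangle m (r ** e0 - p ** e0) (p ** e0 - f0).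
rewrite subrKA -actBl in h1.
have h2 : pnorm m ((r - p) ** e0) <= e / 3 * 1.
  rewrite (le_trans (pnorm_act _ _ _)) // ler_pM ?l1_ge0 ?pnorm_ge0 ?pnorm_one_le //.
  by rewrite -opprB l1N.
have := Hfr m; have := Hp m; lra.
Qed.

End Density.

(** * Existence and stability of optimal approximants *)

Section OptimalApproximants.
Variable R : realType.
Local Notation C := R[i].
Local Notation Re := complex.Re.
Local Notation Im := complex.Im.
Local Notation "q ** a" := (polymul_coef q a) (at level 40, left associativity).
Local Notation e0 := (@one_series R).
Implicit Types (a b x y : nat -> C) (p q : {poly C}) (n m k : nat).

(** The intervals of centre [x s] and radius [e s] meet pairwise, so the supremum of their left ends
    lies in all of them. *)
Lemma real_limit (x e : nat -> R) : (forall s, 0 <= e s) ->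
  (forall s t, (s <= t)%N -> `|x s - x t| <= e s) ->
  exists l, forall s, `|l - x s| <= e s.
Proof.
move=> e_ge0 Hx.
have ub s t : x s - e s <= x t + e t.
  have [st|/ltnW ts] := leqP s t.
    by have := Hx s t st; have := e_ge0 t; rewrite ler_norml => ? /andP[]; lra.
  by have := Hx t s ts; have := e_ge0 s; rewrite ler_norml => ? /andP[]; lra.
pose S := [set y | exists s, y = x s - e s].
have S0 : S !=set0 by exists (x 0%N - e 0%N); exists 0%N.
exists (sup S) => s; rewrite ler_distl; apply/andP; split.
  by apply: ub_le_sup; [exists (x 0%N + e 0%N) => _ [t ->]; exact: ub|exists s].
by apply: ge_sup => // _ [t ->]; exact: ub.
Qed.

Lemma complex_limit (x : nat -> C) (e : nat -> R) : (forall s, 0 <= e s) ->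
  (forall s t, (s <= t)%N -> cabs (x s - x t) <= e s) ->
  exists l, forall s, cabs (l - x s) <= 2 * e s.
Proof.
move=> e_ge0 Hx.
have [|u Hu] := @real_limit (fun s => Re (x s)) e e_ge0.
  move=> s t st; apply: le_trans (Hx s t st); apply: le_trans (cabs_Re _).
  by case: (x s) (x t) => ? ? [? ?].
have [|v Hv] := @real_limit (fun s => Im (x s)) e e_ge0.
  move=> s t st; apply: le_trans (Hx s t st); apply: le_trans (cabs_Im _).
  by case: (x s) (x t) => ? ? [? ?].
exists (u +i* v)%C => s; rewrite (le_trans (cabs_ReIm _)) // mulr_natl mulr2n.
by have := Hu s; have := Hv s; case: (x s) => ? ? /= ? ?; rewrite lerD.
Qed.

Lemma h2norm_sqr_le a (c : R) : (forall n, psqnorm n a <= c) -> h2norm a ^+ 2 <= c.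
Proof.
move=> H; have c0 : 0 <= c := le_trans (psqnorm_ge0 0 a) (H 0%N).
rewrite -[leRHS]sqr_sqrtr // lerXn2r ?nnegrE ?h2norm_ge0 ?sqrtr_ge0 //.
by apply: h2norm_le => n; rewrite ler_wsqrtr.
Qed.

Lemma h2norm_parallelogram x y : H2 x -> H2 y ->
  h2norm (x - y) ^+ 2 + h2norm (x + y) ^+ 2 <= 2 * (h2norm x ^+ 2 + h2norm y ^+ 2).
Proof.
move=> Hx Hy; rewrite -lerBrDr; apply: h2norm_sqr_le => n.
rewrite lerBrDr addrC -lerBrDr; apply: h2norm_sqr_le => m.
rewrite lerBrDr; set k := maxn m n.
apply: (@le_trans _ _ (psqnorm k (x + y) + psqnorm k (x - y))).
  by rewrite lerD // psqnorm_mono ?leq_maxl ?leq_maxr.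
have -> : psqnorm k (x - y) = psqnorm k x - 2 * pdot k x y + psqnorm k y.
  have -> : x - y = x + realc (- 1) *: y by rewrite /realc rmorphN rmorph1 scaleN1r.
  by rewrite psqnormD pdot_scale psqnorm_scale sqmod_real; ring.
rewrite psqnormD -!pnorm_sqr.
have : pnorm k x ^+ 2 <= h2norm x ^+ 2.
  by rewrite lerXn2r ?nnegrE ?pnorm_ge0 ?h2norm_ge0 ?pnorm_le_h2norm.
have : pnorm k y ^+ 2 <= h2norm y ^+ 2.
  by rewrite lerXn2r ?nnegrE ?pnorm_ge0 ?h2norm_ge0 ?pnorm_le_h2norm.
lra.
Qed.

Lemma h2norm_scale (c : C) a : H2 a -> h2norm (c *: a) <= cabs c * h2norm a.
Proof.
by move=> Ha; apply: h2norm_le => n; rewrite pnorm_scale ler_wpM2l ?cabs_ge0 ?pnorm_le_h2norm.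
Qed.

(** Multiplication by a nonzero [a] is injective on polynomials of bounded degree. Starting from the
    first nonzero coefficient [a j], the system for the coefficients of [q] is triangular and is
    solved with bounds. *)
Lemma coef_control a n : a <> h2zero R -> exists m (c : R), 0 < c /\
  forall q, (size q <= n)%N -> l1 q <= c * pnorm m (q ** a).
Proof.
move=> a0.
have ex : exists j, a j != 0.
  apply: contrapT => H; apply: a0; apply/funext => j; apply/eqP/negPn/negP => aj.
  by apply: H; exists j.
pose j := ex_minn ex; have [aj jmin] : a j != 0 /\ forall i, a i != 0 -> (j <= i)%N.
  by rewrite /j; case: ex_minnP.
have ai i : (i < j)%N -> a i = 0.
  by move=> ij; apply/eqP/negPn/negP => /jmin; rewrite leqNgt ij.
have aj0 : 0 < cabs (a j) by rewrite cabs_gt0.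
pose m := (n + j)%N.
have key k : (k <= n)%N -> exists2 c : R, 0 <= c &
    forall q, \sum_(i < k) cabs q`_i <= c * pnorm m (q ** a).
  elim: k => [_|k IH kn]; first by exists 0 => // q; rewrite big_ord0 mul0r.
  have [c c0 Hc] := IH (ltnW kn).
  pose A := \sum_(i < k) cabs (a (k + j - i)%N).
  have A0 : 0 <= A by apply: sumr_ge0 => i _; exact: cabs_ge0.
  have sum_le q : cabs (\sum_(i < k) q`_i * a (k + j - i)%N) <= c * pnorm m (q ** a) * A.
    rewrite (le_trans (cabs_sum _ _)) // mulr_sumr; apply: ler_sum => i _.
    rewrite cabsM ler_wpM2r ?cabs_ge0 // (le_trans _ (Hc q)) //.
    by rewrite (bigD1 i) //= lerDl sumr_ge0 // => *; exact: cabs_ge0.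
  exists (c + (1 + c * A) / cabs (a j)).
    by rewrite addr_ge0 // divr_ge0 ?addr_ge0 ?mulr_ge0 ?cabs_ge0.
  move=> q; rewrite big_ord_recr /= mulrDl lerD //.
  rewrite mulrAC ler_pdivlMr // -cabsM.
  (* In the coefficient of index [k + j], the terms beyond [k] vanish because [a] is zero below
     [j]. *)
  have -> : q`_k * a j = (q ** a) (k + j)%N - \sum_(i < k) q`_i * a (k + j - i)%N.
    rewrite /polymul_coef; have -> : (k + j).+1 = (k + j.+1)%N by rewrite addnS.
    rewrite big_split_ord /= big_ord_recl /= addn0 addKn.
    rewrite [X in _ + (_ + X)]big1 ?addr0 => [|i _]; first by rewrite addrAC subrr add0r.
    by rewrite ai ?mulr0 // subnDl ltn_subrL /= (leq_ltn_trans _ (ltn_ord i)).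
  rewrite (le_trans (cabsB _ _)) // mulrDl mul1r lerD //.
    by rewrite cabs_le_pnorm // ltn_add2r.
  by rewrite (le_trans (sum_le q)) // mulrAC.
have [c c0 Hc] := key n (leqnn n).
exists m, (c + 1); split=> [|q qn]; first by rewrite ltr_wpDl.
by rewrite (l1E qn) (le_trans (Hc q)) // ler_wpM2r ?pnorm_ge0 // lerDl.
Qed.

Section Distance.
Variables (a : nat -> C) (n : nat) (d : R).
Hypothesis Ha : H2 a.
Hypothesis d_ge0 : 0 <= d.
Hypothesis d_le : forall q, (size q <= n.+1)%N -> d <= h2norm (opa_residual q a).

(** The parallelogram law: the residual of the midpoint of [p] and [q] has norm at least [d], which
    leaves little room for the difference. *)
Lemma near_minimizers p q (de : R) : 0 <= de ->
  (size p <= n.+1)%N -> (size q <= n.+1)%N ->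
  h2norm (opa_residual p a) <= d + de -> h2norm (opa_residual q a) <= d + de ->
  h2norm ((p - q) ** a) ^+ 2 <= 4 * ((d + de) ^+ 2 - d ^+ 2).
Proof.
move=> de0 sp sq Hp Hq.
have := h2norm_parallelogram (H2_residual (q := p) Ha) (H2_residual (q := q) Ha).
set x := opa_residual p a in Hp *; set y := opa_residual q a in Hq *.
have -> : x - y = (p - q) ** a.
  by rewrite /x /y !opa_residualE opprB addrA subrK actBl.
have : d <= cabs (realc (1 / 2)) * h2norm (x + y).
  apply: (@le_trans _ _ (h2norm (realc (1 / 2) *: (x + y)))); last first.
    by apply: h2norm_scale; apply: H2D; exact: H2_residual.
  have -> : realc (1 / 2) *: (x + y) = opa_residual (realc (1 / 2) *: (p + q)) a.
    rewrite /x /y !opa_residualE actZl actDl addrACA -opprD scalerBr; congr (_ - _).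
    rewrite scalerDr -scalerDl /realc -rmorphD (_ : 1 / 2 + 1 / 2 = 1 :> R); last by field.
    by rewrite rmorph1 scale1r.
  apply: d_le; rewrite (leq_trans (size_scale_leq _ _)) //.
  by rewrite (leq_trans (size_polyD _ _)) // geq_max sp.
rewrite cabs_realc; last by lra.
have h1 : h2norm x ^+ 2 <= (d + de) ^+ 2 by rewrite lerXn2r ?nnegrE ?h2norm_ge0 ?addr_ge0.
have h2 : h2norm y ^+ 2 <= (d + de) ^+ 2 by rewrite lerXn2r ?nnegrE ?h2norm_ge0 ?addr_ge0.
move=> h3; have h4 : (2 * d) ^+ 2 <= h2norm (x + y) ^+ 2.
  by rewrite lerXn2r ?nnegrE ?h2norm_ge0 ?mulr_ge0 //; lra.
by move: h1 h2 h4; rewrite (exprMn 2); lra.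
Qed.

End Distance.

Lemma h2norm_residual_perturb p q a : H2 a ->
  h2norm (opa_residual p a) <= h2norm (opa_residual q a) + l1 (p - q) * h2norm a.
Proof.
move=> Ha; have -> : opa_residual p a = opa_residual q a + (p - q) ** a.
  by rewrite !opa_residualE actBl [RHS]addrC addrA subrK.
rewrite (le_trans (h2norm_triangle _ _)) ?lerD2l ?h2norm_act //.
  exact: H2_residual.
exact: H2_act.
Qed.

Lemma harmonic_small (x K : R) : 0 <= K -> (forall s : nat, x <= K * s.+1%:R^-1) -> x <= 0.
Proof.
move=> K0 H; rewrite leNgt; apply/negP => x0.
have K1 : 0 < K + 1 by rewrite ltr_wpDl.
have y0 : 0 < x / (K + 1) by rewrite divr_gt0.
have [m _ Hm] := near_infty_natSinv_lt (PosNum y0).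
have {Hm} /= := Hm m (leqnn m); have := H m.
rewrite ltr_pdivlMr //; have : 0 < m.+1%:R^-1 :> R by rewrite invr_gt0.
move: (m.+1%:R^-1) => h; lra.
Qed.

(** A minimizing sequence is Cauchy by [near_minimizers], then Cauchy coefficientwise by
    [coef_control]; its limit attains the infimum. *)
Lemma opa_exists a n : H2 a -> a <> h2zero R -> exists Q, is_opa a n Q.
Proof.
move=> Ha a0; have [m [c [c0 Hc]]] := coef_control n.+1 a0.
pose F q := h2norm (opa_residual q a).
pose S := [set x : R | exists2 q : {poly C}, (size q <= n.+1)%N & x = F q].
have hS : has_inf S.
  split; first by exists (F 0), 0; rewrite ?size_poly0.
  by exists 0 => _ [q _ ->]; exact: h2norm_ge0.
pose d := inf S.
have d_le q : (size q <= n.+1)%N -> d <= F q.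
  by move=> qn; apply: ge_inf; [case: hS|exists q].
have d_ge0 : 0 <= d.
  by apply: lb_le_inf; [case: hS|move=> _ [q _ ->]; exact: h2norm_ge0].
pose h (s : nat) : R := s.+1%:R^-1.
have h0 s : 0 < h s by rewrite invr_gt0.
have h1 s : h s <= 1 by rewrite invf_le1 // ler1n.
have hmono s t : (s <= t)%N -> h t <= h s by move=> st; rewrite lef_pV2 ?posrE // ler_nat.
(* The excess over the infimum is a square because [near_minimizers] bounds squared norms; this
   leaves a rate linear in [h s]. *)
have appr s : exists q, (size q <= n.+1)%N /\ F q <= d + h s ^+ 2.
  have [|_ [q qn ->] Fq] := @inf_adherent _ S (h s ^+ 2) _ hS; first by rewrite exprn_gt0.
  by exists q; split => //; rewrite ltW.
have [q Hq] := choice appr.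
pose ka := c * (2 * (2 * d + 1)).
have ka0 : 0 <= ka by rewrite !mulr_ge0 ?addr_ge0 ?mulr_ge0 // ltW.
have dq s t : (s <= t)%N -> l1 (q s - q t) <= ka * h s.
  move=> st; have [sz1 F1] := Hq s; have [sz2 F2] := Hq t.
  have sz : (size (q s - q t)%R <= n.+1)%N.
    by rewrite (leq_trans (size_polyD _ _)) // size_polyN geq_max sz1.
  rewrite (le_trans (Hc _ sz)) // /ka -mulrA ler_pM2l //.
  rewrite (le_trans (pnorm_le_h2norm m (H2_act Ha))) //.
  rewrite -(ler_pXn2r (ltn0Sn 1)) ?nnegrE ?h2norm_ge0 //; last first.
    by rewrite !mulr_ge0 ?addr_ge0 ?mulr_ge0 // ltW.
  rewrite (le_trans (near_minimizers Ha d_ge0 d_le (de := h s ^+ 2) _ sz1 sz2 F1 _)) //.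
    exact: sqr_ge0.
    rewrite (le_trans F2) // lerD2l lerXn2r ?nnegrE ?(ltW (h0 _)) //; exact: hmono.
  have hh : h s ^+ 2 <= 1 by rewrite exprn_ile1 // ltW.
  have hh0 := sqr_ge0 (h s).
  rewrite [leRHS]exprMn; move: (h s ^+ 2) hh hh0 d_ge0 => u; clear; nra.
have lim i : exists l, forall s, cabs (l - (q s)`_i) <= 2 * (ka * h s).
  apply: complex_limit; first by move=> s; rewrite mulr_ge0 // ltW.
  move=> s t st; rewrite (le_trans _ (dq s t st)) // -coefB.
  have [isz|isz] := ltnP i (size (q s - q t)); last first.
    by rewrite nth_default // cabs0 l1_ge0.
  by rewrite /l1 (bigD1 (Ordinal isz)) //= lerDl sumr_ge0 // => *; exact: cabs_ge0.
have [l Hl] := choice lim.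
pose Q := \poly_(i < n.+1) l i.
have szQ : (size Q <= n.+1)%N by exact: size_poly.
exists Q; split => // q' sz'; rewrite -[leRHS]/(F q').
suff H : F Q <= d by rewrite (le_trans H) // d_le.
rewrite -subr_le0; pose K := n.+1%:R * (2 * ka) * h2norm a.
apply: (@harmonic_small _ (1 + K)).
  by rewrite addr_ge0 // mulr_ge0 ?h2norm_ge0 // mulr_ge0 // mulr_ge0.
move=> s; rewrite -/(h s) lerBlDr.
rewrite (le_trans (h2norm_residual_perturb Q (q s) Ha)) //.
have [szs Fs] := Hq s.
have hs2 : h s ^+ 2 <= h s by rewrite expr2 ler_piMl // ltW.
suff : l1 (Q - q s) <= n.+1%:R * (2 * ka) * h s.
  move=> /(ler_wpM2r (h2norm_ge0 a)); rewrite mulrAC -/K => h3.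
  move: Fs; rewrite /F; lra.
have szQs : (size (Q - q s)%R <= n.+1)%N.
  by rewrite (leq_trans (size_polyD _ _)) // size_polyN geq_max szQ.
rewrite (l1E szQs).
apply: (@le_trans _ _ (\sum_(i < n.+1) 2 * (ka * h s))).
  by apply: ler_sum => i _; rewrite coefB coef_poly ltn_ord.
by rewrite sumr_const card_ord -[leLHS]mulr_natl !mulrA.
Qed.

(** The optimal approximant of a nearby [b] is almost optimal for [a], hence close to [Q] by
    [near_minimizers]. An a priori bound on its [l1] norm, the same for all such [b], comes
    first. *)
Lemma opa_stable a n Q (e : R) : H2 a -> a <> h2zero R -> is_opa a n Q -> 0 < e ->
  exists2 de : R, 0 < de & forall b Q', H2 b -> h2norm (b - a) < de ->
    is_opa b n Q' -> l1 (Q' - Q) <= e.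
Proof.
move=> Ha a0 [szQ minQ] e_gt0; have [m [c [c0 Hc]]] := coef_control n.+1 a0.
pose d := h2norm (opa_residual Q a).
have d_ge0 : 0 <= d by exact: h2norm_ge0.
have r0 b : opa_residual 0 b = - e0 by rewrite opa_residualE act0l sub0r.
have n0 : h2norm (- e0) <= 1 by apply: h2norm_le => k; rewrite pnorm_opp pnorm_one_le.
have d1 : d <= 1 by rewrite (le_trans (minQ 0 _)) ?size_poly0 // r0.
(* Exchanging [a] and [b] costs [l1 Q] times the distance for [Q], and at most [4 * c] times the
   distance for [Q']. *)
pose ka := l1 Q + 4 * c + 1.
have ka0 : 0 < ka by rewrite ltr_wpDl // addr_ge0 ?l1_ge0 // mulr_ge0 // ltW.
(* The first bound absorbs half of [l1 Q'] in its own estimate and gives [4 * c]. The second makes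
   $x = $ [ka * eta] at most 1, so that, as $d \le 1$, $4((d+x)^2 - d^2) \le 12x$; the third makes
   $12 c^2 x \le e^2$. *)
pose de := Num.min (1 / (2 * c)) (Num.min (1 / ka) (e ^+ 2 / (12 * c ^+ 2 * ka))).
have p1 : 0 < 2 * c by rewrite mulr_gt0.
have p2 : 0 < 12 * c ^+ 2 * ka by rewrite !mulr_gt0 // exprn_gt0.
have de0 : 0 < de by rewrite !lt_min !divr_gt0 // exprn_gt0.
exists de => // b Q' Hb ba [szQ' minQ'].
pose eta := h2norm (b - a); have eta0 : 0 <= eta by exact: h2norm_ge0.
have [e1 [e2 e3]] : eta * (2 * c) <= 1 /\ eta * ka <= 1 /\ eta * (12 * c ^+ 2 * ka) <= e ^+ 2.
  move: (ltW ba); rewrite -/eta !le_min => /and3P[].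
  by rewrite !ler_pdivlMr.
have Hba : H2 (b - a) by exact: H2B.
have swap q x y : H2 x -> H2 y ->
    h2norm (opa_residual q x) <= h2norm (opa_residual q y) + l1 q * h2norm (x - y).
  move=> Hx Hy; have -> : opa_residual q x = opa_residual q y + q ** (x - y).
    by rewrite !opa_residualE actBr [RHS]addrC addrA subrK.
  by rewrite (le_trans (h2norm_triangle _ _)) ?lerD2l ?h2norm_act //;
    [exact: H2_residual|apply: H2_act|]; exact: H2B.
have ab : h2norm (a - b) <= eta.
  by apply: h2norm_le => k; rewrite pnorm_distC pnorm_le_h2norm.
have Q'b1 : h2norm (opa_residual Q' b) <= 1.
  by rewrite (le_trans (minQ' 0 _)) ?size_poly0 // r0.
have l1Q' : l1 Q' <= 4 * c.
  have h1 : pnorm m (Q' ** a) <= 2 + l1 Q' * eta.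
    have -> : Q' ** a = (opa_residual Q' b - - e0) - Q' ** (b - a).
      by rewrite opa_residualE actBr opprK subrK opprB addrC subrK.
    rewrite (le_trans (pnorm_triangleB _ _ _)) // lerD //.
      rewrite (le_trans (pnorm_triangleB _ _ _)) // -[2]/(1 + 1) lerD // ?pnorm_opp ?pnorm_one_le //.
      by rewrite (le_trans (pnorm_le_h2norm m _)) //; exact: H2_residual.
    by rewrite (le_trans (pnorm_act _ _ _)) // ler_wpM2l ?l1_ge0 // pnorm_le_h2norm.
  have := Hc _ szQ'; have : c * pnorm m (Q' ** a) <= c * (2 + l1 Q' * eta) by rewrite ler_pM2l.
  have := l1_ge0 Q'.
  have : l1 Q' * (eta * (2 * c)) <= l1 Q' * 1 by rewrite ler_wpM2l ?l1_ge0.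
  lra.
have Q'a : h2norm (opa_residual Q' a) <= d + ka * eta.
  rewrite (le_trans (swap Q' a b Ha Hb)) //.
  have h1 := minQ' _ szQ; have h2 := swap Q b a Hb Ha; rewrite -/d -/eta in h2.
  have h3 : l1 Q' * h2norm (a - b) <= 4 * c * eta.
    by rewrite ler_pM ?l1_ge0 ?h2norm_ge0.
  by rewrite /ka; lra.
have Qa : d <= d + ka * eta by rewrite lerDl mulr_ge0 // ltW.
have kaeta : 0 <= ka * eta by rewrite mulr_ge0 // ltW.
have := near_minimizers Ha d_ge0 minQ kaeta szQ' szQ Q'a Qa.
have sz : (size (Q' - Q)%R <= n.+1)%N.
  by rewrite (leq_trans (size_polyD _ _)) // size_polyN geq_max szQ'.
move=> H; rewrite (le_trans (Hc _ sz)) //.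
rewrite -(ler_pXn2r (ltn0Sn 1)) ?nnegrE ?(ltW e_gt0) //; last first.
  by rewrite mulr_ge0 ?pnorm_ge0 // ltW.
rewrite (le_trans _ e3) // exprMn.
have : pnorm m ((Q' - Q) ** a) ^+ 2 <= h2norm ((Q' - Q) ** a) ^+ 2.
  by rewrite lerXn2r ?nnegrE ?pnorm_ge0 ?h2norm_ge0 ?pnorm_le_h2norm //; exact: H2_act.
move=> /le_trans /(_ H) h1.
have -> : eta * (12 * c ^+ 2 * ka) = c ^+ 2 * (12 * (ka * eta)) by ring.
rewrite ler_wpM2l ?sqr_ge0 // (le_trans h1) //.
have e2' : ka * eta <= 1 by rewrite mulrC.
by move: (ka * eta) kaeta e2' d_ge0 d1 => u; clear; nra.
Qed.

End OptimalApproximants.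

(** * Baire category *)

Section Baire.
Variable R : realType.
Local Notation C := R[i].
Implicit Types (a b f : nat -> C) (n k s t : nat).

Lemma pnorm_le_sum n a : pnorm n a <= \sum_(k < n) cabs (a k).
Proof.
elim: n => [|n IH]; first by rewrite /pnorm /psqnorm !big_ord0 sqrtr0.
rewrite pnormS big_ord_recr (le_trans (cabs_ReIm _)) //=.
by rewrite !ger0_norm ?pnorm_ge0 ?cabs_ge0 // lerD2r.
Qed.

(** Nested closed balls, with the limit of the centres taken coefficient by coefficient. *)
Lemma h2_baire (O : nat -> set (nat -> C)) : (forall n, h2_open (O n)) ->
  (forall n f (e : R), H2 f -> 0 < e ->
     exists f', [/\ H2 f', O n f' & h2norm (f' - f) <= e]) ->
  forall f (e : R), H2 f -> 0 < e ->
    exists a, [/\ H2 a, h2norm (a - f) <= e & forall n, O n a].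
Proof.
move=> Oopen Odense f e Hf e_gt0.
(* A state holds the stage, the centre and the radius. The requirements are conditional on a valid
   state, so that a successor exists for every state and can be chosen. *)
pose next (p p' : nat * ((nat -> C) * R)) := p'.1 = p.1.+1 /\ (H2 p.2.1 -> 0 < p.2.2 ->
  [/\ H2 p'.2.1, 0 < p'.2.2, p'.2.2 <= p.2.2 / 2, h2norm (p'.2.1 - p.2.1) <= p.2.2 / 2 &
    forall b, H2 b -> h2norm (b - p'.2.1) <= p'.2.2 -> O p.1 b]).
have pick p : exists p', next p p'.
  case: p => s [g d]; have [[Hg d0]|ngd] := pselect (H2 g /\ 0 < d); last first.
    by exists (s.+1, (g, d)); split => // Hg d0; case: ngd.
  have [|g' [Hg' Og' gg']] := Odense s g (d / 2) Hg; first by rewrite divr_gt0.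
  have [r r0 Hr] := Oopen s g' Hg' Og'.
  exists (s.+1, (g', Num.min (d / 2) (r / 2))); split => //= _ _; split => //.
  - by rewrite lt_min !divr_gt0.
  - by rewrite ge_min lexx.
  move=> b Hb; rewrite le_min => /andP[_ br]; apply: Hr => //.
  by apply: le_lt_trans br _; rewrite ltr_pdivrMr //; lra.
have [F HF] := choice pick.
pose x s := iter s F (0%N, (f, e)); pose g s := (x s).2.1; pose d s := (x s).2.2.
have xs s : (x s).1 = s by elim: s => [//|s IH]; rewrite /x iterS (HF _).1 -/(x s) IH.
have inv s : H2 (g s) /\ 0 < d s.
  elim: s => [//|s [IH1 IH2]]; have [_ /(_ IH1 IH2)[? ? _ _ _]] := HF (x s).
  by rewrite /g /d /x iterS.
have Hg s := (inv s).1; have d0 s := (inv s).2.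
have step s : [/\ d s.+1 <= d s / 2, h2norm (g s.+1 - g s) <= d s / 2 &
    forall b, H2 b -> h2norm (b - g s.+1) <= d s.+1 -> O s b].
  have [_ /(_ (Hg s) (d0 s))[_ _ ? ?]] := HF (x s).
  by rewrite xs => ?; rewrite /g /d /x iterS.
(* Each centre moves by at most half the radius and the radius at least halves, so the displacement
   telescopes to the loss of radius: the balls are nested. *)
have dist s t n : (s <= t)%N -> pnorm n (g t - g s) <= d s - d t.
  move=> /subnK <-; elim: (t - s)%N => [|j IH]; first by rewrite add0n !subrr pnorm0.
  rewrite addSn -(subrKA (g (j + s)%N)) (le_trans (pnorm_triangle _ _ _)) //.
  have [h1 h2 _] := step (j + s)%N.
  have := pnorm_le_h2norm n (H2B (Hg (j + s).+1) (Hg (j + s)%N)); lra.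
have dsmall t : d t <= e * t.+1%:R^-1.
  elim: t => [|t IH]; first by rewrite invr1 mulr1.
  have [h _ _] := step t; rewrite (le_trans h) //.
  rewrite ler_pdivrMr // (le_trans IH) // -mulrA ler_pM2l //.
  rewrite -ler_pdivrMr // -invfM lef_pV2 ?posrE ?mulr_gt0 // -natrM ler_nat.
  by rewrite muln2 doubleS !ltnS -addnn leq_addl.
have lim k : exists l, forall s, cabs (l - g s k) <= 2 * d s.
  apply: complex_limit => [s|s t st]; first exact: ltW.
  rewrite cabs_distC -[X in cabs X]/((g t - g s) k).
  rewrite (le_trans (cabs_le_pnorm _ (ltnSn k))) // (le_trans (dist s t _ st)) //.
  by rewrite gerBl ltW.
have [a Ha] := choice lim.
(* Coefficientwise convergence controls only a fixed truncation; for fixed [n] the error tends to 0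
   in [t], and the bound [d s] remains. *)
have close s n : pnorm n (a - g s) <= d s.
  rewrite -subr_le0; apply: (@harmonic_small _ _ (n%:R * (2 * e))).
    by rewrite mulr_ge0 // mulr_ge0 // ltW.
  move=> t; rewrite lerBlDr; pose t' := maxn s t.
  rewrite -(subrKA (g t')) (le_trans (pnorm_triangle _ _ _)) // lerD //; last first.
    by rewrite (le_trans (dist s t' _ (leq_maxl _ _))) // gerBl ltW.
  rewrite (le_trans (pnorm_le_sum _ _)) //.
  apply: (@le_trans _ _ (\sum_(k < n) 2 * (e * t.+1%:R^-1))).
    apply: ler_sum => k _; rewrite (le_trans (Ha k t')) // ler_pM2l //.
    rewrite (le_trans (dsmall t')) // ler_pM2l // lef_pV2 ?posrE // ler_nat ltnS.
    exact: leq_maxr.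
  by rewrite sumr_const card_ord -[leLHS]mulr_natl !mulrA.
have Ha2 : H2 a.
  have /H2P[M HM] := Hf; apply/H2P; exists (e + M) => n.
  by rewrite -(subrK f a) (le_trans (pnorm_triangle _ _ _)) // lerD // (close 0%N).
exists a; split => // [|n]; first by apply: h2norm_le => n; exact: (close 0%N).
have [_ _] := step n; apply => //.
by apply: h2norm_le => m; exact: close.
Qed.

End Baire.

(** * Universality as a countable intersection of dense open conditions *)

Section Universality.
Variable R : realType.
Local Notation C := R[i].
Local Notation "q ** a" := (polymul_coef q a) (at level 40, left associativity).

(** A countable family of targets, dense in the [l1] norm; lists of pairs of rationals form a
    countable type and serve as indices. *)
Definition rational_poly (s : seq (rat * rat)) : {poly C} :=
  \poly_(i < size s) (ratr (nth (0, 0) s i).1 +i* ratr (nth (0, 0) s i).2)%C.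

Lemma rational_poly_dense (p : {poly C}) (e : R) : 0 < e ->
  exists s, l1 (rational_poly s - p) <= e.
Proof.
move=> e_gt0; pose n := size p; pose d := e / (2 * n.+1%:R).
have d0 : 0 < d by rewrite divr_gt0 // mulr_gt0.
have rat_near (x : R) : exists q : rat, `|ratr q - x| <= d.
  have [|q] := @rat_in_itvoo R (x - d) (x + d); first by lra.
  by rewrite in_itv /= => /andP[? ?]; exists q; rewrite ler_distl !ltW.
have [f Hf] := choice rat_near.
exists (mkseq (fun i => (f (complex.Re p`_i), f (complex.Im p`_i))) n).
set s := mkseq _ _; have ss : size s = n by rewrite size_mkseq.
have sz : (size (rational_poly s - p)%R <= n)%N.
  by rewrite (leq_trans (size_polyD _ _)) // size_polyN geq_max leqnn andbT -ss size_poly.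
rewrite (l1E sz) (@le_trans _ _ (\sum_(i < n) 2 * d)) //.
  apply: ler_sum => i _; rewrite coefB coef_poly ss ltn_ord nth_mkseq //=.
  rewrite (le_trans (cabs_ReIm _)) // mulr_natl mulr2n.
  have := Hf (complex.Re p`_i); have := Hf (complex.Im p`_i).
  by case: (p`_i) => x y /= ? ?; rewrite lerD.
rewrite sumr_const card_ord -[leLHS]mulr_natl /d.
have -> : n%:R * (2 * (e / (2 * n.+1%:R))) = e * (n%:R / n.+1%:R) :> R.
  have : n.+1%:R != 0 :> R by rewrite pnatr_eq0.
  by move: (n.+1%:R : R) => u u0; field.
by rewrite ler_piMr ?(ltW e_gt0) // ler_pdivrMr // mul1r ler_nat.
Qed.

Variable E : set C.
Hypothesis E1 : E `<=` @unit_circle R.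
Hypothesis Ecl : closed_in_C E.
Hypothesis Enull : arc_null E.

(** The full circle has angular measure $2\pi$. *)
Lemma null_gap : exists2 zeta : C, cabs zeta = 1 & ~ E zeta.
Proof.
apply: contrapT => H.
have ET z : cabs z = 1 -> E z.
  by move=> z1; apply: contrapT => nE; apply: H; exists z.
have := Enull; rewrite /arc_null.
have -> : [set t : R | 0 <= t < 2 * pi /\ E (expi t)] = `[0, 2 * pi[%classic.
  apply/seteqP; split => t /=; rewrite in_itv /=; first by case.
  by move=> ht; split => //; apply: ET; exact: cabs_expi.
have pi2 : 0 < 2 * pi :> R by rewrite mulr_gt0 // pi_gt0.
rewrite lebesgue_measure_itv /= lte_fin pi2 sube0 => -[] /eqP.
by rewrite gt_eqF.
Qed.

Lemma horner_lipschitz (p : {poly C}) : exists2 L : R, 0 <= L &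
  forall z w, E z -> E w -> cabs (p.[w] - p.[z]) <= L * cabs (w - z).
Proof.
elim/poly_ind: p => [|p c [L L0 HL]].
  by exists 0 => // z w _ _; rewrite !horner0 subrr cabs0 mul0r.
exists (L + l1 p) => [|z w Ez Ew]; first by rewrite addr_ge0 ?l1_ge0.
have w1 : cabs w = 1 := E1 Ew.
have -> : (p * 'X + c%:P).[w] - (p * 'X + c%:P).[z] =
    (p.[w] - p.[z]) * w + p.[z] * (w - z) by rewrite !hornerE; ring.
rewrite (le_trans (cabsD _ _)) // !cabsM w1 mulr1 mulrDl lerD ?HL //.
by rewrite ler_wpM2r ?cabs_ge0 // (cabs_horner_E E1).
Qed.

Lemma cont_on_horner (p : {poly C}) : cont_on E (fun z => p.[z]).
Proof.
have [L L0 HL] := horner_lipschitz p; have L1 : 0 < L + 1 by rewrite ltr_wpDl.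
move=> z Ez e e_gt0; exists (e / (L + 1)); first by rewrite divr_gt0.
move=> w Ew; rewrite /cdist ltr_pdivlMr // => h.
rewrite (le_lt_trans (HL z w Ez Ew)) // (le_lt_trans _ h) // mulrC.
by rewrite ler_wpM2l ?cabs_ge0 // lerDl.
Qed.

(** The intermediate [r], strictly below the tolerance, bounds the error uniformly on [E] and leaves
    the slack that makes the condition open. The lower bound [m] on the degree later provides
    increasing degrees. *)
Definition approximating (s : seq (rat * rat)) (k m : nat) : set (nat -> C) :=
  [set a | a <> h2zero R /\ exists n Q r, [/\ (m <= n)%N, is_opa a n Q,
    r < k.+1%:R^-1 & forall z, E z -> cabs (Q.[z] - (rational_poly s).[z]) <= r]].

Lemma approximating_open s k m : h2_open (approximating s k m).
Proof.
move=> a Ha [a0 [n [Q [r [mn HQ rk Hr]]]]].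
have [j aj] : exists j, a j != 0.
  apply: contrapT => H; apply: a0; apply/funext => j; apply/eqP/negPn/negP => aj.
  by apply: H; exists j.
have e_gt0 : 0 < (k.+1%:R^-1 - r) / 2 by rewrite divr_gt0 // subr_gt0.
have [d d0 Hd] := opa_stable Ha a0 HQ e_gt0.
(* The second radius keeps [b j] different from 0, so that [b] is nonzero and has an optimal
   approximant of degree [n]. *)
exists (Num.min d (cabs (a j))); first by rewrite lt_min d0 cabs_gt0.
move=> b Hb; rewrite -[h2sub b a]/(b - a) lt_min => /andP[bd bj].
have b0 : b <> h2zero R.
  move=> b0; move: bj; rewrite ltNge => /negP; apply.
  apply: le_trans (pnorm_le_h2norm j.+1 (H2B Hb Ha)).
  rewrite (le_trans _ (cabs_le_pnorm _ (ltnSn j))) // -[(b - a) j]/(b j - a j) b0.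
  by rewrite sub0r cabsN.
split => //; have [Q' HQ'] := opa_exists n Hb b0.
exists n, Q', ((k.+1%:R^-1 - r) / 2 + r); split => //.
  by move: rk; move: (k.+1%:R^-1 : R) => u ru; lra.
move=> z Ez; rewrite -(subrKA Q.[z]) (le_trans (cabsD _ _)) // lerD ?Hr //.
by rewrite -hornerN -hornerD (le_trans (cabs_horner_E E1 _ Ez)) // (Hd b).
Qed.

Lemma universal_approximating a s k m : universal_opa E a -> approximating s k m a.
Proof.
move=> [Ha [a0 /(_ _ (cont_on_horner (rational_poly s)))[ms [Q [ms_lt [HQ cQ]]]]]].
split => //.
have ms_ge t : (t <= ms t)%N.
  by elim: t => // t IH; apply: leq_ltn_trans IH (ms_lt t).
have h0 : 0 < k.+1%:R^-1 / 2 :> R by rewrite divr_gt0 // invr_gt0.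
have [t0 Ht0] := cQ _ h0; pose t := maxn m t0.
exists (ms t), (Q t), (k.+1%:R^-1 / 2); split => //.
- by rewrite (leq_trans (leq_maxl m t0)).
- by rewrite ltr_pdivrMr // ltr_pMr ?invr_gt0 // ltr1n.
by move=> z Ez; apply/ltW/Ht0; rewrite ?leq_maxr.
Qed.

Let Ecov : thin_cover E := null_thin_cover E1 Ecl Enull.

(** A continuous target is approached by a polynomial, then by a rational one, then by an optimal
    approximant, whence three errors. Degrees increase strictly because each stage asks for a degree
    above the previous one. *)
Lemma approximating_universal a : H2 a -> (forall s k m, approximating s k m a) ->
  universal_opa E a.
Proof.
move=> Ha app; split => //; split; first by have [] := app [::] 0%N 0%N.
move=> g /(poly_approx_continuous E1 Ecov Ecl) pg.
have pick (u : nat * nat) : exists v : nat * {poly C}, [/\ (u.2 <= v.1)%N,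
    is_opa a v.1 v.2 & forall z, E z -> cabs (v.2.[z] - g z) <= 3 * u.1.+1%:R^-1].
  case: u => k m /=; have h0 : 0 < k.+1%:R^-1 :> R by rewrite invr_gt0.
  have [p Hp] := pg _ h0; have [s Hs] := rational_poly_dense p h0.
  have [_ [n [Q [r [mn HQ rk Hr]]]]] := app s k m.
  exists (n, Q); split => //= z Ez.
  have h1 : cabs (Q.[z] - p.[z]) <= cabs (Q.[z] - (rational_poly s).[z]) +
      cabs ((rational_poly s).[z] - p.[z]).
    by rewrite -(subrKA (rational_poly s).[z]) cabsD.
  rewrite -(subrKA p.[z]) (le_trans (cabsD _ _)) //.
  have := Hp z Ez; have := Hr z Ez.
  have := le_trans (cabs_horner_E E1 (rational_poly s - p) Ez) Hs.
  rewrite hornerD hornerN; move: rk; move: (k.+1%:R^-1 : R) => u; lra.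
have [F HF] := choice pick.
pose x := fix x s := if s is s'.+1 then F (s'.+1, (x s').1.+1) else F (0%N, 0%N).
have Hx s : is_opa a (x s).1 (x s).2 /\
    forall z, E z -> cabs ((x s).2.[z] - g z) <= 3 * s.+1%:R^-1.
  by case: s => [|s]; [have [_ ? ?] := HF (0%N, 0%N)|have [_ ? ?] := HF (s.+1, (x s).1.+1)].
exists (fun s => (x s).1), (fun s => (x s).2); split; [|split].
- by move=> s; have [] := HF (s.+1, (x s).1.+1).
- by move=> s; have [] := Hx s.
move=> e e_gt0; have e3 : 0 < e / 3 by rewrite divr_gt0.
have [n _ Hn] := near_infty_natSinv_lt (PosNum e3).
exists n => s ns z Ez; have [_ /(_ z Ez) h] := Hx s; rewrite /cdist (le_lt_trans h) //.
by have /= := Hn s ns; rewrite ltr_pdivlMr // mulrC.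
Qed.

Lemma approximating_dense s k m (f : nat -> C) (e : R) : H2 f -> 0 < e ->
  exists f', [/\ H2 f', approximating s k m f' & h2norm (f' - f) <= e].
Proof.
move=> Hf e_gt0; have [zeta zeta1 zetaE] := null_gap.
have h0 : 0 < k.+1%:R^-1 / 2 :> R by rewrite divr_gt0 // invr_gt0.
have [f' [n [Q [Hf' f'0 ff' mn [HQ HQE]]]]] :=
  opa_dense E1 Ecov Ecl zeta1 zetaE m Hf e_gt0 h0 (poly_approx_poly E (rational_poly s)).
exists f'; split => //; split; first by move=> f'00; rewrite f'00 eqxx in f'0.
exists n, Q, (k.+1%:R^-1 / 2); split => //.
by rewrite ltr_pdivrMr // ltr_pMr ?invr_gt0 // ltr1n.
Qed.

(** The triples of parameters are enumerated through their encoding; a number that encodes no triple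
    imposes no condition. *)
Definition universal_open (j : nat) : set (nat -> C) :=
  if unpickle j is Some (s, k, m) then approximating s k m else setT.

Lemma universal_opaP a : H2 a -> universal_opa E a <-> forall j, universal_open j a.
Proof.
move=> Ha; split=> [Ua j|H].
  rewrite /universal_open; case: unpickle => [[[s k] m]|//].
  exact: universal_approximating.
apply: approximating_universal => // s k m.
by have := H (pickle (s, k, m)); rewrite /universal_open pickleK.
Qed.

Lemma universal_open_open j : h2_open (universal_open j).
Proof.
rewrite /universal_open; case: unpickle => [[[s k] m]|]; first exact: approximating_open.
by move=> a _ _; exists 1.
Qed.

Lemma universal_open_dense j (f : nat -> C) (e : R) : H2 f -> 0 < e ->
  exists f', [/\ H2 f', universal_open j f' & h2norm (f' - f) <= e].
Proof.
move=> Hf e_gt0; rewrite /universal_open; case: unpickle => [[[s k] m]|].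
  exact: approximating_dense.
by exists f; split => //; rewrite subrr; apply: h2norm_le => n; rewrite pnorm0 ltW.
Qed.

End Universality.

Unset Implicit Arguments.

Theorem theorem1p1 (R : realType) (E : set R[i]) :
  E `<=` @unit_circle R -> closed_in_C E -> arc_null E ->
  h2_dense (universal_opa E) /\ h2_Gdelta (universal_opa E).
Proof.
move=> E1 Ecl Enull; split; split; try by move=> a [].
  move=> f Hf e e_gt0; have e2 : 0 < e / 2 by rewrite divr_gt0.
  have [a [Ha af Oa]] := h2_baire (@universal_open_open _ _ E1)
    (@universal_open_dense _ _ E1 Ecl Enull) Hf e2.
  exists a; first exact/universal_opaP.
  by rewrite -[h2sub a f]/(a - f) (le_lt_trans af) // ltr_pdivrMr //; lra.
exists (universal_open E); split; first exact: universal_open_open.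
by move=> a; exact: universal_opaP.
Qed.
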